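(* Let $Y_1(0),\dots,Y_N(0)$ be i.i.d. with law $\widetilde\mu_0$ on $\mathbb R^d$ (write $Y(0)$ for a generic copy). Assume that $$\mathbb E\exp\{\alpha\|Y(0)\|^2\}<\infty,\qquad \mathrm{Cov}(Y(0))\ge c_0I_d$$ for some $\alpha>0$, $c_0>0$. Let $\widetilde\mu_t$ and $\widetilde\mu_t^N$ be the mean-field and $N$-particle matrix-SVGD solutions for the standard Gaussian target $\gamma_d$ and the kernel $\widetilde K_2(y,y')=(1+y^\top y')I_d$, started from $\widetilde\mu_0$ and from $(Y_1(0),\dots,Y_N(0))$ respectively. Then there is a constant $C=C(d,c_0,\alpha,\mathbb E e^{\alpha\|Y(0)\|^2})<\infty$ such that $$\mathbb E\Big[\sup_{t\ge0}D_2^2\big((\widetilde m^N(t),\widetilde S^N(t)),(\widetilde m(t),\widetilde S(t))\big)\Big]\le CN^{-1},$$ where $\widetilde m(t)=\int y\,\widetilde\mu_t(dy)$, $\widetilde S(t)=\int yy^\top\widetilde\mu_t(dy)$, $\widetilde m^N(t)=\int y\,\widetilde\mu^N_t(dy)$, $\widetilde S^N(t)=\int yy^\top\widetilde\mu_t^N(dy)$.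
   Context: **Matrix-kernel SVGD.** For a target $\pi\propto e^{-V}$ on $\mathbb R^d$ and a positive-definite matrix-valued kernel $K:\mathbb R^d\times\mathbb R^d\to\mathbb R^{d\times d}$, set $v_\rho(x):=\int\{-K(x,y)\nabla V(y)+\mathrm{div}_yK(x,y)\}\rho(dy)$, with $[\mathrm{div}_yK(x,y)]_a:=\sum_b\partial_{y_b}K_{ab}(x,y)$. The mean-field flow is the weak solution of $\partial_t\mu_t+\nabla\cdot(v_{\mu_t}\mu_t)=0$ with initial law $\mu_0$; the $N$-particle system is $\dot X_i(t)=v_{\mu_t^N}(X_i(t))$, $\mu_t^N=\frac1N\sum_i\delta_{X_i(t)}$. Here the target is $\gamma_d(dy)=(2\pi)^{-d/2}e^{-\|y\|^2/2}dy$ (so $V(y)=\|y\|^2/2$) and $K=\widetilde K_2$, for which $v_\rho(y)=-m_\rho+(I_d-S_\rho)y$ with $m_\rho=\int y\,\rho(dy)$, $S_\rho=\int yy^\top\rho(dy)$. The particle and mean-field systems are globally well-posed. **Moment distance.** $D_2((m,S),(\bar m,\bar S)):=(\|m-\bar m\|^2+\|S-\bar S\|_F^2)^{1/2}$, $\|\cdot\|_F$ the Frobenius norm. $A\ge B$ for symmetric matrices means $A-B$ is positive semidefinite. *)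

(* Defs.v *)
From HB Require Import structures.
From mathcomp Require Import all_boot all_order all_algebra.
From mathcomp Require Import all_classical all_reals all_analysis.

Set Implicit Arguments.
Unset Strict Implicit.
Unset Printing Implicit Defensive.

Import Order.TTheory GRing.Theory Num.Theory.
Import numFieldNormedType.Exports.

Local Open Scope classical_set_scope.
Local Open Scope ring_scope.

(* Vectors of R^d are rows 'rV[R]_d, measurable for the Borel sigma-algebra.  *)
(* Their library norm `|x| is the sup norm: it is used for the topology only. *)
HB.instance Definition _ (R : realType) (d : nat) :=
  isMeasurable.Build (sigma_display (@open 'rV[R]_d)) 'rV[R]_d
    (@sigma_algebra0 _ setT (@open 'rV[R]_d)) (@sigma_algebraC _ (@open 'rV[R]_d))
    (@sigma_algebra_bigcup _ setT (@open 'rV[R]_d)).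

Section euclidean.
Context (R : realType) (d : nat).
Implicit Types (x y : 'rV[R]_d) (A B : 'M[R]_d).

Definition dot x y : R := \sum_(i < d) x 0 i * y 0 i.

Definition enorm x : R := Num.sqrt (dot x x).

Definition frobenius A : R := Num.sqrt (\sum_(i < d) \sum_(j < d) A i j ^+ 2).

Definition psd A : Prop :=
  A^T = A /\ forall u : 'rV[R]_d, 0 <= (u *m A *m u^T) 0 0.

Definition loewner_ge A B : Prop := psd (A - B).

Definition D2 (p q : 'rV[R]_d * 'M[R]_d) : R :=
  Num.sqrt (enorm (p.1 - q.1) ^+ 2 + frobenius (p.2 - q.2) ^+ 2).

Definition partial (i : 'I_d) (f : 'rV[R]_d -> R) : 'rV[R]_d -> R :=
  fun x => 'D_(delta_mx 0 i) f x.

Definition grad (f : 'rV[R]_d -> R) (x : 'rV[R]_d) : 'rV[R]_d :=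
  \row_(i < d) partial i f x.

(* Compactly supported C^oo functions: every iterated partial derivative      *)
(* exists everywhere and is continuous.                                       *)
Definition smooth (f : 'rV[R]_d -> R) : Prop :=
  forall s : seq 'I_d, let g := foldr partial f s in
    continuous g /\ forall i x, derivable g x (delta_mx 0 i).

Definition test_function (f : 'rV[R]_d -> R) : Prop :=
  smooth f /\ compact (closure [set x | f x != 0]).

End euclidean.

Section moments.
Context (R : realType) (d : nat).

Definition mean (rho : {measure set 'rV[R]_d -> \bar R}) : 'rV[R]_d :=
  \row_(i < d) \int[rho]_y (y 0 i).

Definition second_moment (rho : {measure set 'rV[R]_d -> \bar R}) : 'M[R]_d :=
  \matrix_(i < d, j < d) \int[rho]_y (y 0 i * y 0 j).

Definition cov_mx (rho : probability 'rV[R]_d R) : 'M[R]_d :=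
  \matrix_(i < d, j < d)
    fine (covariance rho (fun y : 'rV[R]_d => y 0 i)
                         (fun y : 'rV[R]_d => y 0 j)).

End moments.

Section empirical_measure.
Context (R : realType) (d N : nat) (x : 'I_N -> 'rV[R]_d).

Definition empirical (A : set 'rV[R]_d) : \bar R :=
  ((N%:R^-1)%:E * \sum_(i < N) \d_(x i) A)%E.

Let atom (k : nat) : {measure set 'rV[R]_d -> \bar R} :=
  if insub k is Some i then \d_(x i) else mzero.

Let empiricalE : empirical = mscale (N%:R^-1)%:nng (msum atom N).
Proof.
apply/funext => A; rewrite /empirical /mscale /= /msum; congr (_ * _)%E.
by apply: eq_bigr => i _; rewrite /atom valK.
Qed.

Let empirical0 : empirical set0 = 0%E.
Proof. by rewrite empiricalE measure0. Qed.

Let empirical_ge0 A : (0 <= empirical A)%E.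
Proof. by rewrite empiricalE measure_ge0. Qed.

Let empirical_sigma_additive : semi_sigma_additive empirical.
Proof. by rewrite empiricalE; exact: measure_semi_sigma_additive. Qed.

HB.instance Definition _ := isMeasure.Build _ _ _ empirical
  empirical0 empirical_ge0 empirical_sigma_additive.

End empirical_measure.

Section svgd.
Context (R : realType) (d : nat).
Variables (V : 'rV[R]_d -> R) (K : 'rV[R]_d -> 'rV[R]_d -> 'M[R]_d).

(* [div_y K(x, y)]_a = \sum_b d_{y_b} K_{ab}(x, y).                           *)
Definition div2 (x y : 'rV[R]_d) : 'rV[R]_d :=
  \row_(a < d) \sum_(b < d) partial b (fun z => K x z a b) y.

(* V is the potential of the target exp (- V).                                *)
Definition velocity (rho : {measure set 'rV[R]_d -> \bar R}) (x : 'rV[R]_d) :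
    'rV[R]_d :=
  \row_(a < d) \int[rho]_y
    ((- (K x y *m (grad V y)^T)^T + div2 x y) 0 a).

(* Weak solution of d/dt mu_t + div (v_{mu_t} mu_t) = 0 on [0, +oo[ in the    *)
(* class of narrowly continuous curves of probability measures whose second   *)
(* moments are locally bounded in time; mu t is irrelevant for t < 0.         *)
Definition mean_field_solution (mu0 : probability 'rV[R]_d R)
    (mu : R -> probability 'rV[R]_d R) : Prop :=
  [/\ forall A, measurable A -> mu 0 A = mu0 A,
      forall f : 'rV[R]_d -> R, continuous f -> bounded_fun f ->
        {within `[0, +oo[, continuous (fun t => \int[mu t]_x f x)},
      forall T : R, exists M : R, forall t, 0 <= t <= T ->
        (\int[mu t]_x (enorm x ^+ 2)%:E <= M%:E)%E &
      forall f : 'rV[R]_d -> R, test_function f -> forall t, 0 <= t ->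
        \int[mu t]_x f x = \int[mu 0]_x f x +
          \int[lebesgue_measure]_(s in `[0, t])
            \int[mu s]_x dot (grad f x) (velocity (mu s) x)].

Definition particle_solution (N : nat) (X : 'I_N -> R -> 'rV[R]_d) : Prop :=
  forall i, {within `[0, +oo[, continuous (X i)} /\
    forall t : R, 0 < t ->
      is_derive t 1 (X i) (velocity (empirical (fun j => X j t)) (X i t)).

End svgd.

Section target.
Context (R : realType) (d : nat).

Definition gaussian_potential (y : 'rV[R]_d) : R := enorm y ^+ 2 / 2.

Definition K2 (y z : 'rV[R]_d) : 'M[R]_d := (1 + dot y z)%:M.

End target.

Definition iid_with_law (disp : measure_display) (Omega : measurableType disp)
    (R : realType) (d N : nat) (P : probability Omega R)
    (Y : 'I_N -> {mfun Omega >-> 'rV[R]_d}) (law : probability 'rV[R]_d R) :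
    Prop :=
  (forall i A, measurable A -> distribution P (Y i) A = law A) /\
  (forall A : 'I_N -> set 'rV[R]_d, (forall i, measurable (A i)) ->
    P (\bigcap_i (Y i @^-1` A i)) = (\prod_(i < N) P (Y i @^-1` A i))%E).

(* Main.v *)
(** Both the mean-field and the empirical moments solve the closed system
    m' = - m S, S' = 2 (S - S^2 - m^T m) (row vectors).  For two solutions, let
    e = S - Sb, del = m - mb and E = |e|^2 + 2 |del|^2.  Then E' equals
    - 4 \int |y e + del|^2 rho(dy) <= 0, rho having the moments (m, S), plus
    terms quadratic in (e, del) and linear in (Sb - 1, mb), so
    E' <= 8 sqrt(L) E, where L = |Sb - 1|^2 + 2 |mb|^2 is the distance of the
    mean-field moments to the equilibrium (0, 1).  Only the mean-field side has
    to be nondegenerate: the relative entropy of N(mb, Sb - mb^T mb) with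
    respect to the target decreases, hence det (Sb - mb^T mb) stays bounded
    below, and the identity for E applied to the equilibrium gives the
    exponential decay of L.  By Gronwall sup_t E(t) <= C E(0) along every
    trajectory, and the expectation of E(0) is at most C / N because the N
    initial positions are independent with finite fourth moments.

    The weak equation only allows compactly supported test functions; the
    moment equations follow by testing against p(x) e exp(-1/(1 - l |x|^2))
    with p of degree at most 2 and letting l tend to 0. *)

Require Import Defs.
From HB Require Import structures.
From mathcomp Require Import all_boot all_order all_algebra perm.
From mathcomp Require Import all_classical all_reals all_analysis.
From mathcomp Require Import measurable_realfun ring lra.

Set Implicit Arguments.
Unset Strict Implicit.
Unset Printing Implicit Defensive.

Import Order.TTheory GRing.Theory Num.Theory.
Import numFieldNormedType.Exports.

Local Open Scope classical_set_scope.
Local Open Scope ring_scope.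

(** * The Frobenius inner product and positive semidefinite matrices *)

(** With fewer than [d] particles the empirical covariance is singular, so the particle side can
    contribute no more than [psd]; every quantitative bound is taken from the mean-field flow, whose
    initial data are controlled by [c0] and the exponential moment. This makes the constant uniform
    in [N] and in the sample point. The weight 2 in E is the one for which the cubic terms in (e,
    del) produced by the two equations fit into the square of the dissipation: nothing superlinear
    in E is left, and Gronwall closes without a smallness assumption. Decay of L makes the Gronwall
    rate integrable over all times. The determinant bound turns into a bound on the smallest
    eigenvalue because the trace stays bounded too, the distance of the mean-field moments to (0, 1)
    being nonincreasing. Adjugates, Schur complements and Cauchy-Schwarz take the place of
    diagonalization. *)

Section mxdot.
Context (R : realFieldType).

(** A trace form on rectangular matrices serves both as the Euclidean product of rows and as the
    Frobenius product; its adjunction rules come from cyclicity of the trace. *)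
Definition mxdot m n (A B : 'M[R]_(m, n)) : R := \tr (A *m B^T).

Lemma mxdotE m n (A B : 'M[R]_(m, n)) :
  mxdot A B = \sum_i \sum_j A i j * B i j.
Proof.
by apply: eq_bigr => i _; rewrite !mxE; apply: eq_bigr => j _; rewrite mxE.
Qed.

Lemma mxdotC m n (A B : 'M[R]_(m, n)) : mxdot A B = mxdot B A.
Proof. by rewrite /mxdot -mxtrace_tr trmx_mul trmxK. Qed.

Lemma mxdotDl m n (A B C : 'M[R]_(m, n)) :
  mxdot (A + B) C = mxdot A C + mxdot B C.
Proof. by rewrite /mxdot mulmxDl mxtraceD. Qed.

Lemma mxdotZl m n k (A B : 'M[R]_(m, n)) : mxdot (k *: A) B = k * mxdot A B.
Proof. by rewrite /mxdot -scalemxAl mxtraceZ. Qed.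

Lemma mxdotNl m n (A B : 'M[R]_(m, n)) : mxdot (- A) B = - mxdot A B.
Proof. by rewrite -scaleN1r mxdotZl mulN1r. Qed.

Lemma mxdotDr m n (A B C : 'M[R]_(m, n)) :
  mxdot A (B + C) = mxdot A B + mxdot A C.
Proof. by rewrite !(mxdotC A) mxdotDl. Qed.

Lemma mxdotZr m n k (A B : 'M[R]_(m, n)) : mxdot A (k *: B) = k * mxdot A B.
Proof. by rewrite !(mxdotC A) mxdotZl. Qed.

Lemma mxdotNr m n (A B : 'M[R]_(m, n)) : mxdot A (- B) = - mxdot A B.
Proof. by rewrite !(mxdotC A) mxdotNl. Qed.

Lemma mxdot0l m n (A : 'M[R]_(m, n)) : mxdot 0 A = 0.
Proof. by rewrite /mxdot mul0mx mxtrace0. Qed.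

Lemma mxdot0r m n (A : 'M[R]_(m, n)) : mxdot A 0 = 0.
Proof. by rewrite mxdotC mxdot0l. Qed.

Definition mxdot_lin := (mxdotDl, mxdotDr, mxdotNl, mxdotNr, mxdotZl, mxdotZr).

Lemma mxdot_mulr m n p (A : 'M[R]_(m, n)) (C : 'M[R]_(n, p)) B :
  mxdot (A *m C) B = mxdot A (B *m C^T).
Proof. by rewrite /mxdot trmx_mul trmxK mulmxA. Qed.

Lemma mxdot_mull m n p (C : 'M[R]_(m, n)) (A : 'M[R]_(n, p)) B :
  mxdot (C *m A) B = mxdot A (C^T *m B).
Proof. by rewrite /mxdot trmx_mul trmxK -mulmxA mxtrace_mulC -mulmxA. Qed.

Lemma mxdot_tr m n (A B : 'M[R]_(m, n)) : mxdot A^T B^T = mxdot A B.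
Proof. by rewrite [RHS]mxdotC /mxdot trmxK mxtrace_mulC. Qed.

Lemma mxdot_ge0 m n (A : 'M[R]_(m, n)) : 0 <= mxdot A A.
Proof.
rewrite mxdotE; apply: sumr_ge0 => i _; apply: sumr_ge0 => j _.
by rewrite -expr2 sqr_ge0.
Qed.

Lemma mxdot_entry m n (A : 'M[R]_(m, n)) i j : A i j ^+ 2 <= mxdot A A.
Proof.
rewrite mxdotE (bigD1 i)//= (bigD1 j)//= expr2 -addrA lerDl addr_ge0//.
  by apply: sumr_ge0 => k _; rewrite -expr2 sqr_ge0.
by apply: sumr_ge0 => l _; apply: sumr_ge0 => k _; rewrite -expr2 sqr_ge0.
Qed.

Lemma mxdot_rows m n (A B : 'M[R]_(m, n)) :
  mxdot A B = \sum_i mxdot (row i A) (row i B).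
Proof.
rewrite mxdotE; apply: eq_bigr => i _; rewrite mxdotE big_ord1.
by apply: eq_bigr => j _; rewrite !mxE.
Qed.

(** Common source of Cauchy-Schwarz for the inner product and for a merely semidefinite form, so
    [a = 0] has to be allowed. When [a] is positive the form is evaluated at (-b, a). *)
Lemma discriminant_le (a b c : R) : 0 <= a -> 0 <= c ->
  (forall x y, 0 <= x ^+ 2 * a + 2 * x * y * b + y ^+ 2 * c) ->
  b ^+ 2 <= a * c.
Proof.
move=> a0 c0 H; have [a_eq0|aN0] := eqVneq a 0.
  (* With [a = 0] the value at (-(c + 1), b) is -(c + 2) b^2, which forces b = 0. *)
  have := H (- (c + 1)) b.
  have -> : (- (c + 1)) ^+ 2 * a + 2 * - (c + 1) * b * b + b ^+ 2 * c =
    (c + 1) ^+ 2 * a - (c + 2) * b ^+ 2 by ring.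
  by rewrite a_eq0 mulr0 mul0r sub0r oppr_ge0 pmulr_rle0// ltr_wpDl.
have {}a0 : 0 < a by rewrite lt_def aN0.
have := H (- b) a.
have -> : (- b) ^+ 2 * a + 2 * - b * a * b + a ^+ 2 * c = a * (a * c - b ^+ 2).
  by ring.
by rewrite pmulr_rge0// subr_ge0.
Qed.

Lemma mxdot_CS m n (A B : 'M[R]_(m, n)) :
  mxdot A B ^+ 2 <= mxdot A A * mxdot B B.
Proof.
apply: discriminant_le; try exact: mxdot_ge0.
move=> x y; have := mxdot_ge0 (x *: A + y *: B).
by rewrite !mxdot_lin (mxdotC B A); congr (_ <= _); ring.
Qed.

(** Each entry of [A *m B] is the product of a row of [A] with a column of [B]; after Cauchy-Schwarz
    entry by entry, the double sum of the bounds factorizes. *)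
Lemma mxdot_mul_le m n p (A : 'M[R]_(m, n)) (B : 'M[R]_(n, p)) :
  mxdot (A *m B) (A *m B) <= mxdot A A * mxdot B B.
Proof.
rewrite [mxdot A A]mxdot_rows -(mxdot_tr B B) (mxdot_rows B^T) mxdotE big_distrlr.
apply: ler_sum => i _; apply: ler_sum => j _ /=.
have -> : (A *m B) i j = mxdot (row i A) (row j B^T).
  by rewrite mxdotE big_ord1 mxE; apply: eq_bigr => k _; rewrite !mxE.
by rewrite -expr2 mxdot_CS.
Qed.

End mxdot.

Section psd.
Context (R : realType) (d : nat).
Implicit Types (A B : 'M[R]_d) (u v : 'rV[R]_d).

Lemma quad_mxdot A u v : (u *m A *m v^T) 0 0 = mxdot (u *m A) v.
Proof. by rewrite /mxdot /mxtrace big_ord1. Qed.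

Lemma psdP A : psd A <-> A^T = A /\ forall u, 0 <= mxdot (u *m A) u.
Proof.
by rewrite /psd; split=> -[sA pA]; split=> // u; have := pA u; rewrite quad_mxdot.
Qed.

Lemma psd_CS A u v : psd A ->
  mxdot (u *m A) v ^+ 2 <= mxdot (u *m A) u * mxdot (v *m A) v.
Proof.
move=> /psdP[sA pA]; apply: discriminant_le => // x y.
have := pA (x *: u + y *: v).
have vu : mxdot (v *m A) u = mxdot (u *m A) v.
  by rewrite mxdot_mulr sA mxdotC.
by rewrite mulmxDl -!scalemxAl !mxdot_lin vu; congr (_ <= _); ring.
Qed.

Lemma psd_diag_ge0 A i : psd A -> 0 <= A i i.
Proof.
move=> /psdP[_ /(_ (delta_mx 0 i))]; rewrite -rowE /mxdot trmx_delta.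
rewrite /mxtrace big_ord1 -colE !mxE; by [].
Qed.

Lemma psd_trace_ge0 A : psd A -> 0 <= \tr A.
Proof. by move=> pA; apply: sumr_ge0 => i _; apply: psd_diag_ge0. Qed.

Lemma psd_entry_le A i j : psd A -> A i j ^+ 2 <= A i i * A j j.
Proof.
move=> pA; have := psd_CS (delta_mx 0 i) (delta_mx 0 j) pA.
by rewrite -!rowE /mxdot !trmx_delta /mxtrace !big_ord1 -!colE !mxE.
Qed.

Lemma psd_norm_entry_le A i j : psd A -> `|A i j| <= \tr A.
Proof.
move=> pA; have tA := psd_trace_ge0 pA.
rewrite -(ler_pXn2r (_ : 0 < 2)%N)// ?nnegrE// real_normK ?num_real//.
rewrite (le_trans (psd_entry_le i j pA))// expr2.
have le_tr k : A k k <= \tr A.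
  rewrite /mxtrace (bigD1 k)//= lerDl; apply: sumr_ge0 => l _.
  exact: psd_diag_ge0.
by apply: ler_pM => //; exact: psd_diag_ge0.
Qed.

Lemma psd_mxdot_le A : psd A -> mxdot A A <= (\tr A) ^+ 2.
Proof.
move=> pA; rewrite mxdotE expr2 /mxtrace big_distrlr/=.
apply: ler_sum => i _; apply: ler_sum => j _; rewrite -expr2; exact: psd_entry_le.
Qed.

(* Cauchy-Schwarz for the form A: [|uA|^4 <= (uAu) (uA A uA) <= (uAu) |A| |uA|^2]. *)
Lemma psd_mul_le A u : psd A ->
  mxdot (u *m A) (u *m A) <= \tr A * mxdot (u *m A) u.
Proof.
move=> pA; have tA := psd_trace_ge0 pA; set v := u *m A.
have [v0|v0] := eqVneq (mxdot v v) 0.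
  by rewrite v0 mulr_ge0//; case/psdP : pA => _; apply.
have {}v0 : 0 < mxdot v v by rewrite lt_def v0 mxdot_ge0.
have h1 := psd_CS u v pA; rewrite -/v in h1.
have uAu : 0 <= mxdot v u by case/psdP : pA => _; apply.
have h2 : mxdot (v *m A) v <= \tr A * mxdot v v.
  rewrite -(ler_pXn2r (_ : 0 < 2)%N)// ?nnegrE ?mulr_ge0 ?mxdot_ge0//; last first.
    by case/psdP : pA => _; apply.
  rewrite (le_trans (mxdot_CS _ _))//.
  rewrite exprMn expr2 [X in _ <= _ * X]expr2 mulrA ler_wpM2r ?mxdot_ge0//.
  rewrite (le_trans (mxdot_mul_le _ _))// mulrC ler_wpM2r ?mxdot_ge0//.
  exact: psd_mxdot_le.
rewrite -(ler_pM2r v0) -expr2 (le_trans h1)// -[leRHS]mulrA mulrCA.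
by rewrite ler_wpM2l.
Qed.

Lemma mxdot_psd_ge0 A (B : 'M[R]_d) : psd A -> 0 <= mxdot (B *m A) B.
Proof.
move=> /psdP[_ pA]; rewrite mxdot_rows; apply: sumr_ge0 => i _.
by rewrite row_mul.
Qed.

Lemma mxdot_rows_ge (lam : R) A (B : 'M[R]_d) :
  (forall u, lam * mxdot u u <= mxdot (u *m A) u) ->
  lam * mxdot B B <= mxdot (B *m A) B.
Proof.
move=> hA; rewrite mxdot_rows [leRHS]mxdot_rows mulr_sumr; apply: ler_sum => i _.
by rewrite row_mul.
Qed.

End psd.

(* Schur complements: the pivots of A are at least c. *)
Lemma det_ge_expr (R : realFieldType) (c : R) n (A : 'M[R]_n) : 0 < c ->
  A^T = A -> (forall u : 'rV_n, c * mxdot u u <= mxdot (u *m A) u) ->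
  c ^+ n <= \det A.
Proof.
move=> c0; elim: n A => [|n IHn] A; first by rewrite det_mx00 expr0.
rewrite -[n.+1]/(1 + n)%N in A * => sA hA.
set a := ulsubmx A; set b := ursubmx A; set D := drsubmx A.
have dlE : dlsubmx A = b^T by rewrite -[in LHS]sA trmx_ursub.
have AE : A = block_mx a b b^T D by rewrite -[LHS]submxK dlE.
have sD : D^T = D by rewrite /D trmx_drsub sA.
set al := a 0 0; have aE : a = al%:M by rewrite [LHS]mx11_scalar.
have quad (x : R) (u : 'rV[R]_n) :
    mxdot (row_mx x%:M u *m A) (row_mx x%:M u) =
    x ^+ 2 * al + 2 * x * mxdot b u + mxdot (u *m D) u.
  rewrite AE mul_row_block /mxdot tr_row_mx mul_row_col mxtraceD !mulmxDl.
  rewrite !mxtraceD tr_scalar_mx aE !mul_scalar_mx mul_mx_scalar scale_scalar_mx.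
  have -> : \tr (x *: (x * al)%:M : 'M[R]_1) = x ^+ 2 * al.
    by rewrite mxtraceZ mxtrace_scalar mulr1n; ring.
  rewrite !mul_mx_scalar -!scalemxAl !mxtraceZ.
  have -> : \tr (u *m b^T) = \tr (b *m u^T).
    by rewrite -[LHS]mxtrace_tr trmx_mul trmxK.
  by rewrite /mxdot; ring.
have nrm (x : R) (u : 'rV[R]_n) :
    mxdot (row_mx x%:M u) (row_mx x%:M u) = x ^+ 2 + mxdot u u.
  rewrite /mxdot tr_row_mx mul_row_col mxtraceD tr_scalar_mx -scalar_mxM.
  by rewrite mxtrace_scalar mulr1n -expr2.
have al_ge : c <= al.
  have := hA (row_mx 1%:M 0); rewrite quad nrm mul0mx !mxdot0r.
  by rewrite !expr1n !mulr0 !addr0 mulr1 mul1r.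
have al0 : 0 < al by exact: lt_le_trans al_ge.
set S := D - al^-1 *: (b^T *m b).
(* One step of block elimination: the determinant is the pivot times that of the Schur complement
   [S]. *)
have AS : A = block_mx 1%:M 0 (al^-1 *: b^T) 1%:M *m block_mx a b 0 S.
  rewrite mulmx_block !mul1mx !mul0mx !addr0 -!scalemxAl addrC.
  rewrite {1}AE aE mul_mx_scalar scalerA mulVf ?gt_eqF// scale1r.
  by rewrite /S subrK.
have -> : \det A = al * \det S.
  by rewrite AS det_mulmx det_lblock det_ublock !det1 !mul1r aE det_scalar1.
have SE u : mxdot (u *m S) u = mxdot (u *m D) u - al^-1 * mxdot b u ^+ 2.
  rewrite /S mulmxBr mxdotDl mxdotNl -scalemxAr mxdotZl mulmxA.
  rewrite [mxdot (_ *m _ *m _) _]mxdot_mulr; congr (_ - _ * _).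
  rewrite mxdotE !big_ord1 -expr2.
  by congr (_ ^+ 2); rewrite mxdotC /mxdot /mxtrace big_ord1.
have hS (u : 'rV[R]_n) : c * mxdot u u <= mxdot (u *m S) u.
  (* This first coordinate minimizes the form for fixed [u]; the minimum is the form of [S], which
     thus inherits the lower bound [c]. *)
  have := hA (row_mx (- (al^-1 * mxdot b u))%:M u).
  rewrite quad nrm SE sqrrN => h.
  have h2 : 0 <= c * (al^-1 * mxdot b u) ^+ 2 by rewrite mulr_ge0 ?sqr_ge0 ?ltW.
  have eal : (al^-1 * mxdot b u) ^+ 2 * al = al^-1 * mxdot b u ^+ 2.
    by field; rewrite gt_eqF.
  have ebu : 2 * - (al^-1 * mxdot b u) * mxdot b u = - 2 * (al^-1 * mxdot b u ^+ 2).
    by ring.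
  by rewrite eal ebu mulrDr in h; lra.
have sS : S^T = S.
  by rewrite /S linearB linearZ /= trmx_mul trmxK sD.
rewrite exprS; apply: ler_pM => //; [exact: ltW|by rewrite exprn_ge0// ltW|].
exact: IHn.
Qed.

(** * Differential calculus of matrix curves *)

Section calculus.
Context (R : realType).
Local Notation Rplus := (`[0, +oo[%classic : set R).

Lemma is_derive_bigsum (V W : normedModType R) (I : Type) (r : seq I)
    (P : pred I) (h : I -> V -> W) (dh : I -> W) (x v : V) :
  (forall i, is_derive x v (h i) (dh i)) ->
  is_derive x v (fun y => \sum_(i <- r | P i) h i y) (\sum_(i <- r | P i) dh i).
Proof.
move=> hd; elim: r => [|i r IHr].
  rewrite big_nil (_ : (fun _ => _) = cst 0); first exact: is_derive_cst.
  by apply/funext => y; rewrite big_nil.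
rewrite big_cons; case: ifP => Pi; last first.
  by under eq_fun do rewrite big_cons Pi.
under eq_fun do rewrite big_cons Pi.
exact: is_deriveD.
Qed.

Lemma is_derive_mul (V : normedModType R) (f g : V -> R) (df dg : R) (x v : V) :
  is_derive x v f df -> is_derive x v g dg ->
  is_derive x v (fun s => f s * g s) (f x * dg + g x * df).
Proof. exact: is_deriveM. Qed.

Lemma is_derive_cstM (V : normedModType R) (a : R) (g : V -> R) (dg : R) (x v : V) :
  is_derive x v g dg -> is_derive x v (fun s => a * g s) (a * dg).
Proof. exact: is_deriveZ. Qed.

Lemma is_derive_exprn (V : normedModType R) (f : V -> R) (df : R) (x v : V) k :
  is_derive x v f df ->
  is_derive x v (fun s => f s ^+ k) (k%:R * f x ^+ k.-1 * df).
Proof.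
by move=> /(is_deriveX k); rewrite (_ : f ^+ k = fun s => f s ^+ k)// exprfctE.
Qed.

Lemma is_derive_comp (V : normedModType R) (f : R -> R) (g : V -> R) (df dg : R)
    (x v : V) :
  is_derive (g x) 1 f df -> is_derive x v g dg ->
  is_derive x v (fun s => f (g s)) (df * dg).
Proof.
move=> hf [hg <-].
(* Directional derivatives are derivatives at 0 along [s *: v + x], which reduces the claim to the
   one-variable chain rule. *)
have line (h : V -> R) : 'D_v h x = 'D_1 (fun s : R => h (s *: v + x)) 0.
  rewrite /derive; set h1 := fun s => s^-1 *: _; set h2 := fun s => s^-1 *: _.
  suff -> : h1 = h2 by [].
  by apply/funext => s; rewrite /h1 /h2/= addr0 scale0r add0r [_%:A]mulr1.
have dline : is_derive (0 : R) 1 (fun s : R => g (s *: v + x)) ('D_v g x).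
  by rewrite line; apply: derivableP; exact: (derivable1P g x v).1.
have hf0 : is_derive (g ((0 : R) *: v + x)) 1 f df by rewrite scale0r add0r.
have [dfg <-] := is_derive1_comp hf0 dline.
split; first exact/(derivable1P (fun s => f (g s)) x v).
by rewrite line.
Qed.

Lemma is_derive_expR_comp (f : R -> R) (df t : R) : is_derive t 1 f df ->
  is_derive t 1 (fun s => expR (f s)) (expR (f t) * df).
Proof. by move=> hf; exact: (is_derive1_comp (is_derive_expR _) hf). Qed.

Lemma is_derive_bigprod n (f : 'I_n -> R -> R) (df : 'I_n -> R) (t : R) :
  (forall i, is_derive t 1 (f i) (df i)) ->
  is_derive t 1 (fun s => \prod_i f i s)
    (\sum_i df i * \prod_(j | j != i) f j t).
Proof.
elim: n f df => [|n IHn] f df hf.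
  rewrite big_ord0 (_ : (fun _ => _) = cst 1); first exact: is_derive_cst.
  by apply/funext => s; rewrite big_ord0.
under eq_fun do rewrite big_ord_recl.
have := IHn (fun i => f (lift ord0 i)) _ (fun i => hf (lift ord0 i)).
move=> /(is_deriveM (hf ord0)) /is_derive_eq; apply.
rewrite big_ord_recl addrC; congr (_ + _).
  rewrite /= [in RHS]big_mkcond big_ord_recl /= mul1r; apply: mulrC.
rewrite /= -[_ *: _]/(_ * _) mulr_sumr; apply: eq_bigr => i _.
rewrite [in RHS]big_mkcond big_ord_recl /= mulrCA; congr (_ * (_ * _)).
by rewrite big_mkcond; apply: eq_bigr => j _; rewrite (inj_eq lift_inj).
Qed.

Lemma within_continuousD (D : set R) (f g : R -> R) :
  {within D, continuous f} -> {within D, continuous g} ->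
  {within D, continuous (fun t => f t + g t)}.
Proof. by move=> cf cg x; apply: cvgD; [exact: cf|exact: cg]. Qed.

Lemma within_continuousM (D : set R) (f g : R -> R) :
  {within D, continuous f} -> {within D, continuous g} ->
  {within D, continuous (fun t => f t * g t)}.
Proof. by move=> cf cg x; apply: cvgM; [exact: cf|exact: cg]. Qed.

Lemma within_continuous_cst (D : set R) (k : R) :
  {within D, continuous (fun=> k)}.
Proof. by move=> x; apply: cvg_cst. Qed.

Lemma within_continuous_expR (D : set R) (f : R -> R) :
  {within D, continuous f} -> {within D, continuous (fun t => expR (f t))}.
Proof.
by move=> cf x; apply: continuous_comp; [exact: cf|exact: continuous_expR].
Qed.

Lemma continuousM_fun (T : topologicalType) (f g : T -> R) :
  continuous f -> continuous g -> continuous (fun x => f x * g x).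
Proof. by move=> cf cg x; apply: cvgM; [exact: cf|exact: cg]. Qed.

Lemma continuousD_fun (T : topologicalType) (f g : T -> R) :
  continuous f -> continuous g -> continuous (fun x => f x + g x).
Proof. by move=> cf cg x; apply: cvgD; [exact: cf|exact: cg]. Qed.

Lemma continuous_bigsum (T : topologicalType) (I : Type) (r : seq I)
    (P : pred I) (h : I -> T -> R) : (forall i, continuous (h i)) ->
  continuous (fun x => \sum_(i <- r | P i) h i x).
Proof.
move=> hc; elim: r => [|i r IHr].
  by under eq_fun do rewrite big_nil; move=> x; exact: cvg_cst.
under eq_fun do rewrite big_cons.
by case: (P i) => //; exact: continuousD_fun.
Qed.

Lemma within_continuous_bigsum (D : set R) (I : Type) (r : seq I) (P : pred I)
    (h : I -> R -> R) : (forall i, {within D, continuous (h i)}) ->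
  {within D, continuous (fun t => \sum_(i <- r | P i) h i t)}.
Proof. exact: (@continuous_bigsum (subspace D)). Qed.

Lemma within_continuous_bigprod (D : set R) (I : Type) (r : seq I) (P : pred I)
    (h : I -> R -> R) : (forall i, {within D, continuous (h i)}) ->
  {within D, continuous (fun t => \prod_(i <- r | P i) h i t)}.
Proof.
move=> hc; elim: r => [|i r IHr].
  by under eq_fun do rewrite big_nil; exact: within_continuous_cst.
under eq_fun do rewrite big_cons.
by case: (P i) => //; exact: within_continuousM.
Qed.

(** Moment flows are differentiable at positive times and only continuous up to time 0; the mean
    value argument asks for no more. *)
Lemma nonincreasing_Rplus (f df : R -> R) : {within Rplus, continuous f} ->
  (forall t : R, 0 < t -> is_derive t 1 f (df t)) ->
  (forall t : R, 0 < t -> df t <= 0) ->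
  forall s t : R, 0 <= s -> s <= t -> f t <= f s.
Proof.
move=> cf hf df0 s t s0 st.
have t0 : 0 <= t by exact: le_trans st.
have h x : x \in `]0, t[ -> 0 < x by rewrite in_itv/= => /andP[].
apply: (@ler0_derive1_le_cc _ f 0 t) => //.
- by move=> x /h /hf [].
- by move=> x /h x0; rewrite derive1E (@derive_val _ _ _ _ _ _ _ (hf _ x0)) df0.
- by apply: continuous_subspaceW cf; exact: subset_itvl.
- by rewrite in_itv/= t0 lexx.
- by rewrite in_itv/= s0.
Qed.

(** Entrywise, because the moment equations are obtained one entry at a time, from scalar test
    functions and from sums over particles. *)
Definition mx_derive m n (t : R) (X : R -> 'M[R]_(m, n)) (dX : 'M[R]_(m, n)) :=
  forall i j, is_derive t (1 : R) (fun s => X s i j) (dX i j).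

Definition mx_continuous m n (X : R -> 'M[R]_(m, n)) :=
  forall i j, {within Rplus, continuous (fun s => X s i j)}.

Section mx_derive_rules.
Variables (t : R) (m n p : nat).
Implicit Types (X Y : R -> 'M[R]_(m, n)).

Lemma mx_derive_cst (A : 'M[R]_(m, n)) : mx_derive t (fun=> A) 0.
Proof. by move=> i j; rewrite mxE; exact: is_derive_cst. Qed.

Lemma mx_deriveB X Y dX dY : mx_derive t X dX -> mx_derive t Y dY ->
  mx_derive t (fun s => X s - Y s) (dX - dY).
Proof.
move=> hX hY i j; rewrite !mxE; under eq_fun do rewrite !mxE.
exact: is_deriveB.
Qed.

Lemma mx_derive_tr X dX : mx_derive t X dX ->
  mx_derive t (fun s => (X s)^T) dX^T.
Proof. by move=> hX i j; rewrite mxE; under eq_fun do rewrite mxE. Qed.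

Lemma mx_derive_mul X (Y : R -> 'M[R]_(n, p)) dX dY :
  mx_derive t X dX -> mx_derive t Y dY ->
  mx_derive t (fun s => X s *m Y s) (dX *m Y t + X t *m dY).
Proof.
move=> hX hY i j; under eq_fun do rewrite mxE.
apply: is_derive_eq.
  by apply: is_derive_bigsum => k; apply: is_deriveM; [exact: hX|exact: hY].
rewrite !mxE -big_split/=; apply: eq_bigr => k _.
by rewrite addrC; congr (_ + _); exact: mulrC.
Qed.

Lemma mx_derive_mxdot X Y dX dY : mx_derive t X dX -> mx_derive t Y dY ->
  is_derive t 1 (fun s => mxdot (X s) (Y s)) (mxdot dX (Y t) + mxdot (X t) dY).
Proof.
move=> hX hY; under eq_fun do rewrite mxdotE.
apply: is_derive_eq.
  apply: is_derive_bigsum => i; apply: is_derive_bigsum => j.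
  by apply: is_deriveM; [exact: hX|exact: hY].
rewrite !mxdotE -big_split/=; apply: eq_bigr => i _.
rewrite -big_split/=; apply: eq_bigr => j _.
by rewrite addrC; congr (_ + _); exact: mulrC.
Qed.

Lemma mx_continuous_cst (A : 'M[R]_(m, n)) : mx_continuous (fun=> A).
Proof. by move=> i j; exact: within_continuous_cst. Qed.

Lemma mx_continuousB X Y : mx_continuous X -> mx_continuous Y ->
  mx_continuous (fun s => X s - Y s).
Proof.
move=> hX hY i j; rewrite (_ : (fun s => _) = (fun s => X s i j + -1 * Y s i j)); last first.
  by apply/funext => s; rewrite !mxE mulN1r.
apply: within_continuousD => //; apply: within_continuousM => //.
exact: within_continuous_cst.
Qed.

Lemma mx_continuous_tr X : mx_continuous X -> mx_continuous (fun s => (X s)^T).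
Proof.
move=> hX i j; rewrite (_ : (fun s => _) = (fun s => X s j i)) //.
by apply/funext => s; rewrite mxE.
Qed.

Lemma mx_continuous_mul X (Y : R -> 'M[R]_(n, p)) :
  mx_continuous X -> mx_continuous Y -> mx_continuous (fun s => X s *m Y s).
Proof.
move=> hX hY i j.
rewrite (_ : (fun s => _) = (fun s => \sum_k X s i k * Y s k j)); last first.
  by apply/funext => s; rewrite mxE.
by apply: within_continuous_bigsum => k; exact: within_continuousM.
Qed.

Lemma mx_continuous_mxdot X Y : mx_continuous X -> mx_continuous Y ->
  {within Rplus, continuous (fun s => mxdot (X s) (Y s))}.
Proof.
move=> hX hY.
rewrite (_ : (fun s => _) = (fun s => \sum_i \sum_j X s i j * Y s i j)); last first.
  by apply/funext => s; rewrite mxdotE.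
apply: within_continuous_bigsum => i; apply: within_continuous_bigsum => j.
exact: within_continuousM.
Qed.

End mx_derive_rules.

Lemma mx_derive_trace (t : R) n (X : R -> 'M[R]_n) dX : mx_derive t X dX ->
  is_derive t 1 (fun s => \tr (X s)) (\tr dX).
Proof. by move=> hX; exact: is_derive_bigsum. Qed.

Lemma mx_continuous_trace n (X : R -> 'M[R]_n) : mx_continuous X ->
  {within Rplus, continuous (fun s => \tr (X s))}.
Proof. by move=> hX; exact: within_continuous_bigsum. Qed.

Lemma mx_continuous_det n (X : R -> 'M[R]_n) : mx_continuous X ->
  {within Rplus, continuous (fun s => \det (X s))}.
Proof.
move=> hX; apply: within_continuous_bigsum => s.
apply: within_continuousM; first exact: within_continuous_cst.
by apply: within_continuous_bigprod => i; exact: hX.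
Qed.

(** Jacobi's formula, in adjugate form so that no invertibility is required. *)
Lemma mx_derive_det (t : R) n (X : R -> 'M[R]_n) dX : mx_derive t X dX ->
  is_derive t 1 (fun s => \det (X s)) (\tr (dX *m \adj (X t))).
Proof.
move=> hX; apply: is_derive_eq.
  apply: is_derive_bigsum => s; apply: is_deriveM.
  by apply: is_derive_bigprod => i; exact: hX.
(* [B i] has row [i] differentiated. The product rule in the Leibniz formula gives the sum of the
   [\det (B i)], and the expansion of each along row [i] meets only cofactors of [X t]. *)
pose B i := \matrix_(k, l) if k == i then dX k l else X t k l.
transitivity (\sum_i \det (B i)).
  rewrite /determinant exchange_big/=; apply: eq_bigr => s _.
  rewrite scaler0 addr0 -[_ *: _]/(_ * _) mulr_sumr; apply: eq_bigr => i _.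
  congr (_ * _); rewrite [in RHS](bigD1 i)//= mxE eqxx; congr (_ * _).
  by apply: eq_bigr => j /negPf ji; rewrite mxE ji.
apply: eq_bigr => i _; rewrite (expand_det_row _ i) mxE; apply: eq_bigr => j _.
rewrite !mxE eqxx; congr (_ * _); rewrite /cofactor; congr (_ * \det _).
by apply/matrixP => k l; rewrite !mxE eq_sym (negPf (neq_lift _ _)).
Qed.

End calculus.

(** * The moment equations *)

Section mxnorm.
Context (R : rcfType).

Definition mxnorm m n (A : 'M[R]_(m, n)) : R := Num.sqrt (mxdot A A).

Lemma mxnorm_ge0 m n (A : 'M[R]_(m, n)) : 0 <= mxnorm A.
Proof. exact: sqrtr_ge0. Qed.

Lemma sqr_mxnorm m n (A : 'M[R]_(m, n)) : mxnorm A ^+ 2 = mxdot A A.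
Proof. by rewrite sqr_sqrtr// mxdot_ge0. Qed.

Lemma normr_mxdot_le m n (A B : 'M[R]_(m, n)) :
  `|mxdot A B| <= mxnorm A * mxnorm B.
Proof. by rewrite -sqrtr_sqr -sqrtrM ?mxdot_ge0// ler_wsqrtr// mxdot_CS. Qed.

Lemma mxnorm_mul_le m n p (A : 'M[R]_(m, n)) (B : 'M[R]_(n, p)) :
  mxnorm (A *m B) <= mxnorm A * mxnorm B.
Proof. by rewrite -sqrtrM ?mxdot_ge0// ler_wsqrtr// mxdot_mul_le. Qed.

Lemma mxdot_mul_le_norm m n (A : 'M[R]_(m, n)) (D : 'M[R]_n) (B : 'M[R]_(m, n)) :
  `|mxdot (A *m D) B| <= mxnorm A * mxnorm D * mxnorm B.
Proof.
rewrite (le_trans (normr_mxdot_le _ _))// ler_wpM2r ?mxnorm_ge0//.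
exact: mxnorm_mul_le.
Qed.

End mxnorm.

Section moment_flow.
Context (R : realType) (d : nat).
Implicit Types (m : R -> 'rV[R]_d) (S : R -> 'M[R]_d).
Local Notation Rplus := (`[0, +oo[%classic : set R).

(** Particles, mean field and the constant equilibrium all enter the stability estimate through this
    predicate. Time 0 is covered by continuity within [Rplus] only. *)
Definition moment_flow m S : Prop :=
  [/\ mx_continuous m, mx_continuous S,
      forall t : R, 0 < t -> mx_derive t m (- (m t *m S t)) &
      forall t : R, 0 < t ->
        mx_derive t S (2 *: (S t - S t *m S t - (m t)^T *m m t))].

Definition covariance_mx (m : 'rV[R]_d) (S : 'M[R]_d) : 'M[R]_d := S - m^T *m m.

Lemma covariance_mx_sym (m : 'rV[R]_d) (S : 'M[R]_d) :
  (covariance_mx m S)^T = covariance_mx m S -> S^T = S.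
Proof.
by rewrite /covariance_mx linearB/= trmx_mul trmxK => /(@addIr _ _ _ _).
Qed.

(** With weight 2 the cubic cross terms of the derivative match the cross term of [dissipation]. The
    weight costs at most a factor 2 against the squared [D2]. *)
Definition moment_dist2 (m1 m2 : 'rV[R]_d) (S1 S2 : 'M[R]_d) : R :=
  mxdot (S1 - S2) (S1 - S2) + 2 * mxdot (m1 - m2) (m1 - m2).

Lemma moment_dist2_ge0 (m1 m2 : 'rV[R]_d) (S1 S2 : 'M[R]_d) : 0 <= moment_dist2 m1 m2 S1 S2.
Proof. by rewrite addr_ge0 ?mulr_ge0 ?mxdot_ge0. Qed.

(* [\int |y e + del|^2 rho(dy)] for rho of mean m and second moment S. *)
Definition dissipation (m del : 'rV[R]_d) (S e : 'M[R]_d) : R :=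
  mxdot (e *m S) e + 2 * mxdot (m *m e) del + mxdot del del.

(** The second moment of [y e + del] is its variance plus the squared norm of its mean; in this form
    nonnegativity needs only a semidefinite covariance. *)
Lemma dissipationE (m del : 'rV[R]_d) (S e : 'M[R]_d) : e^T = e ->
  dissipation m del S e =
  mxdot (e *m covariance_mx m S) e + mxdot (m *m e + del) (m *m e + del).
Proof.
move=> se.
have eSe : mxdot (e *m S) e =
    mxdot (e *m covariance_mx m S) e + mxdot (m *m e) (m *m e).
  have -> : mxdot (m *m e) (m *m e) = mxdot (e *m (m^T *m m)) e.
    by rewrite mulmxA [RHS]mxdot_mulr -[LHS]mxdot_tr trmx_mul se.
  by rewrite -mxdotDl -mulmxDr subrK.
rewrite /dissipation eSe !mxdot_lin (mxdotC del); ring.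
Qed.

Lemma dissipation_ge0 (m del : 'rV[R]_d) (S e : 'M[R]_d) : e^T = e ->
  psd (covariance_mx m S) -> 0 <= dissipation m del S e.
Proof.
by move=> se pS; rewrite dissipationE// addr_ge0 ?mxdot_ge0 ?mxdot_psd_ge0.
Qed.

(** After substituting [S = Sb + e] and [m = mb + del], all cubic terms are collected by the
    dissipation at the first solution. What remains is quadratic in (e, del) with coefficients
    [1%:M - Sb] and [mb], which vanish at equilibrium. *)
Lemma moment_dist2_identity (m mb : 'rV[R]_d) (S Sb : 'M[R]_d) :
  S^T = S -> Sb^T = Sb ->
  let e := S - Sb in let del := m - mb in
  2 * mxdot e (2 *: (S - S *m S - m^T *m m)
               - 2 *: (Sb - Sb *m Sb - mb^T *m mb))
  + 4 * mxdot del (- (m *m S) - - (mb *m Sb)) =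
  4 * mxdot (e *m (1%:M - Sb)) e + 4 * mxdot (del *m (1%:M - Sb)) del
  - 4 * mxdot (mb *m e) del - 4 * dissipation m del S e.
Proof.
move=> sS sSb e del; have se : e^T = e by rewrite /e linearB/= sS sSb.
have -> : S = Sb + e by rewrite addrC subrK.
have -> : m = mb + del by rewrite addrC subrK.
rewrite /dissipation; move: e del se => e del se.
have h1 (a b : 'rV[R]_d) : mxdot e (a^T *m b) = mxdot (a *m e) b.
  by rewrite mxdotC mxdot_mull trmxK mxdotC.
have h2 (a b : 'rV[R]_d) : mxdot (b *m e) a = mxdot (a *m e) b.
  by rewrite mxdot_mulr se mxdotC.
have h3 : mxdot e (Sb *m e) = mxdot (e *m Sb) e.
  by rewrite mxdotC -mxdot_tr trmx_mul se sSb.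
have h4 : mxdot e (e *m Sb) = mxdot (e *m Sb) e by rewrite mxdotC.
have h5 (a b : 'rV[R]_d) : mxdot a (b *m Sb) = mxdot (a *m Sb) b.
  by rewrite mxdot_mulr sSb.
have h6 (a b : 'rV[R]_d) : mxdot a (b *m e) = mxdot (b *m e) a by rewrite mxdotC.
have -> : (mb + del)^T = mb^T + del^T by rewrite linearD.
rewrite !(mulmxDl, mulmxDr, mulmxN, mulNmx) !mulmx1 !mxdot_lin.
rewrite !h1 !h6 h3 h4 (h2 mb del) (mxdotC e (e *m e)) (mxdotC del (del *m Sb)).
ring.
Qed.

(** The norms of [1%:M - Sb] and [mb] are at most the root of the distance to equilibrium. The two
    pure remainders cost a factor 4, and the mixed one, split between |e|^2 and |del|^2, another 4,
    whence the 8. *)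
Lemma moment_dist2_rate_le (m mb : 'rV[R]_d) (S Sb : 'M[R]_d) :
  S^T = S -> Sb^T = Sb -> psd (covariance_mx m S) ->
  2 * mxdot (S - Sb) (2 *: (S - S *m S - m^T *m m)
               - 2 *: (Sb - Sb *m Sb - mb^T *m mb))
  + 4 * mxdot (m - mb) (- (m *m S) - - (mb *m Sb)) <=
  8 * Num.sqrt (moment_dist2 mb 0 Sb 1%:M) * moment_dist2 m mb S Sb.
Proof.
move=> sS sSb pS; rewrite moment_dist2_identity//.
set e := S - Sb; set del := m - mb.
have se : e^T = e by rewrite /e linearB/= sS sSb.
have Q0 := dissipation_ge0 del se pS.
have := mxdot_mul_le_norm e (1%:M - Sb) e.
have := mxdot_mul_le_norm del (1%:M - Sb) del.
have := mxdot_mul_le_norm mb e del.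
set L := moment_dist2 mb 0 Sb 1%:M.
have L0 : 0 <= L by exact: moment_dist2_ge0.
have nD : mxnorm (1%:M - Sb) <= Num.sqrt L.
  rewrite ler_wsqrtr// /L /moment_dist2 -[1%:M - Sb]opprB mxdotNl mxdotNr opprK.
  by rewrite lerDl mulr_ge0 ?mxdot_ge0.
have nm : mxnorm mb <= Num.sqrt L.
  rewrite ler_wsqrtr// /L /moment_dist2 subr0 mulr_natl mulr2n addrCA lerDl.
  by rewrite addr_ge0 ?mxdot_ge0.
rewrite /moment_dist2 -/e -/del -!sqr_mxnorm.
move: Q0; move: (mxnorm_ge0 e) (mxnorm_ge0 del) (mxnorm_ge0 mb) nm nD.
move: (mxnorm_ge0 (1%:M - Sb)) (mxdot (mb *m e) del) (mxdot (del *m _) del).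
move: (mxdot (e *m _) e) (dissipation m del S e).
move: (mxnorm e) (mxnorm del) (mxnorm mb) (mxnorm (1%:M - Sb)).
move: (Num.sqrt L : R) => l x y z D A Q D0 C B x0 y0 z0 zl Dl Q0.
move=> /ler_normlP[h1 _] /ler_normlP[_ h2] /ler_normlP[_ h3].
have h4 : x * D * x <= l * x ^+ 2 by rewrite mulrAC -expr2 mulrC ler_wpM2r// sqr_ge0.
have h5 : y * D * y <= l * y ^+ 2 by rewrite mulrAC -expr2 mulrC ler_wpM2r// sqr_ge0.
have h6 : z * x * y <= l * x ^+ 2 + l * y ^+ 2.
  rewrite -mulrDr -mulrA ler_pM// ?mulr_ge0//.
  have := sqr_ge0 (x - y); have := sqr_ge0 (x + y); rewrite !expr2; nra.
have l0 : 0 <= l by exact: le_trans zl.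
have := mulr_ge0 l0 (sqr_ge0 x); have := mulr_ge0 l0 (sqr_ge0 y).
have -> : 8 * l * (x ^+ 2 + 2 * y ^+ 2) = 8 * (l * x ^+ 2) + 16 * (l * y ^+ 2).
  by ring.
lra.
Qed.

Lemma moment_dist2_derive m mb S Sb (t : R) : moment_flow m S -> moment_flow mb Sb ->
  0 < t ->
  is_derive t 1 (fun t => moment_dist2 (m t) (mb t) (S t) (Sb t))
   (2 * mxdot (S t - Sb t) (2 *: (S t - S t *m S t - (m t)^T *m m t)
               - 2 *: (Sb t - Sb t *m Sb t - (mb t)^T *m mb t))
  + 4 * mxdot (m t - mb t) (- (m t *m S t) - - (mb t *m Sb t))).
Proof.
move=> [_ _ dm dS] [_ _ dmb dSb] t0.
apply: is_derive_eq.
  apply: is_deriveD.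
    by apply: mx_derive_mxdot; apply: mx_deriveB; [exact: dS|exact: dSb|exact: dS|exact: dSb].
  apply: is_deriveM; apply: mx_derive_mxdot; apply: mx_deriveB.
  - exact: dm.
  - exact: dmb.
  - exact: dm.
  - exact: dmb.
rewrite scaler0 addr0.
set X := (2 *: _ - 2 *: _); set Y := (- _ - - _).
rewrite (mxdotC X) (mxdotC Y) -[X in _ + X = _]/(2 * (_ + _)); ring.
Qed.

Lemma moment_dist2_continuous m mb S Sb : moment_flow m S -> moment_flow mb Sb ->
  {within Rplus, continuous (fun t => moment_dist2 (m t) (mb t) (S t) (Sb t))}.
Proof.
move=> [cm cS _ _] [cmb cSb _ _]; apply: within_continuousD.
  by apply: mx_continuous_mxdot; exact: mx_continuousB.
apply: within_continuousM; first exact: within_continuous_cst.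
by apply: mx_continuous_mxdot; exact: mx_continuousB.
Qed.

End moment_flow.

(** * Nondegeneracy and Gronwall estimates *)

Section nondegeneracy.
Context (R : realType).

Lemma normr_det_le n (A : 'M[R]_n) (K : R) : (forall i j, `|A i j| <= K) ->
  `|\det A| <= n`!%:R * K ^+ n.
Proof.
move=> hA; rewrite /determinant (le_trans (ler_norm_sum _ _ _))//.
have -> : n`!%:R * K ^+ n = \sum_(s : 'S_n) K ^+ n.
  by rewrite sumr_const cardT -cardE card_Sn mulr_natl.
apply: ler_sum => s _; rewrite normrMsign normr_prod.
have -> : K ^+ n = \prod_(i < n) K by rewrite prodr_const card_ord.
by apply: ler_prod => i _; rewrite normr_ge0 hA.
Qed.

Lemma mxdot_adj_le n (A : 'M[R]_n) (K : R) : (forall i j, `|A i j| <= K) ->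
  mxdot (\adj A) (\adj A) <= (n * n)%:R * (n.-1`!%:R * K ^+ n.-1) ^+ 2.
Proof.
move=> hA; rewrite mxdotE natrM -mulrA.
have cst (x : R) : n%:R * x = \sum_(i < n) x.
  by rewrite sumr_const card_ord mulr_natl.
rewrite cst; apply: ler_sum => i _; rewrite cst; apply: ler_sum => j _.
rewrite -expr2 -[leLHS]real_normK ?num_real//.
have h : `|(\adj A) i j| <= n.-1`!%:R * K ^+ n.-1.
  by rewrite mxE normrMsign; apply: normr_det_le => k l; rewrite !mxE.
by rewrite lerXn2r// nnegrE// (le_trans _ h).
Qed.

(** Since [A *m \adj A] is [\det A] times the identity, (det A)^2 |u|^2 is at most |u A|^2 |adj
    A|^2. The trace controls |u A|^2 by [psd_mul_le] and the adjugate through the entries of [A], so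
    a determinant bound becomes a bound on the smallest eigenvalue. *)
Lemma psd_det_lower_bound (n : nat) (K del : R) : 0 <= K -> 0 < del ->
  exists2 lam : R, 0 < lam & forall A : 'M[R]_n, psd A -> \tr A <= K ->
    del <= \det A ^+ 2 -> forall u : 'rV[R]_n, lam * mxdot u u <= mxdot (u *m A) u.
Proof.
move=> K0 del0.
set B := (n * n)%:R * (n.-1`!%:R * K ^+ n.-1) ^+ 2.
have B0 : 0 <= B by rewrite mulr_ge0 ?sqr_ge0.
have BK : 0 < B * K + 1 by rewrite ltr_wpDl// mulr_ge0.
(* The [+ 1] keeps the denominator positive when [B * K] vanishes. *)
exists (del / (B * K + 1)); first by rewrite divr_gt0.
move=> A pA trA dA u; rewrite mulrAC ler_pdivrMr//.
have uAu : 0 <= mxdot (u *m A) u by case/psdP : pA => _; apply.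
have adjB : mxdot (\adj A) (\adj A) <= B.
  by apply: mxdot_adj_le => i j; rewrite (le_trans (psd_norm_entry_le _ _ pA)).
have detE : \det A ^+ 2 * mxdot u u =
    mxdot (u *m A *m \adj A) (u *m A *m \adj A).
  rewrite -mulmxA mul_mx_adj mul_mx_scalar !mxdot_lin; ring.
rewrite (@le_trans _ _ (\det A ^+ 2 * mxdot u u))//.
  by rewrite ler_wpM2r ?mxdot_ge0.
rewrite detE (le_trans (mxdot_mul_le _ _))//.
rewrite (@le_trans _ _ (K * mxdot (u *m A) u * B))//.
  rewrite ler_pM ?mxdot_ge0// (le_trans (psd_mul_le _ pA))//.
  by rewrite ler_wpM2r.
have -> : K * mxdot (u *m A) u * B = mxdot (u *m A) u * (B * K) by ring.
by rewrite ler_wpM2l// lerDl.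
Qed.

End nondegeneracy.

Section stability.
Context (R : realType) (d : nat).
Local Notation Rplus := (`[0, +oo[%classic : set R).
Implicit Types (m : R -> 'rV[R]_d) (S : R -> 'M[R]_d).

(** The rate [k e^(- c t)] has total mass [k / c]. The integrating factor is the exponential of its
    tail [g]: the product [f e^g] is nonincreasing, [g 0 = k / c], and [g] is nonnegative. *)
Lemma gronwall_expdecay (f df : R -> R) (k c : R) : 0 <= k -> 0 < c ->
  (forall t, 0 <= f t) -> {within Rplus, continuous f} ->
  (forall t : R, 0 < t -> is_derive t 1 f (df t)) ->
  (forall t : R, 0 < t -> df t <= k * expR (- (c * t)) * f t) ->
  forall t : R, 0 <= t -> f t <= f 0 * expR (k / c).
Proof.
move=> k0 c0 f0 cf hf dfle t t0.
pose g (s : R) := k / c * expR (- c * s).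
have dg (s : R) : is_derive s 1 g (- k * expR (- c * s)).
  rewrite /g; apply: is_derive_eq.
  by rewrite /GRing.scale/= mulr1; field; rewrite gt_eqF.
pose h (s : R) := f s * expR (g s).
have dh (s : R) : 0 < s ->
    is_derive s 1 h (expR (g s) * (df s - k * expR (- (c * s)) * f s)).
  move=> s0.
  apply: (is_derive_eq (is_derive_mul (hf s s0) (is_derive_expR_comp (dg s)))).
  by rewrite [- c * s]mulNr; ring.
have ch : {within Rplus, continuous h}.
  apply: within_continuousM => //; apply: continuous_subspaceT => x.
  by have [/derivable1_diffP/differentiable_continuous] := is_derive_expR_comp (dg x).
have : h t <= h 0.
  apply: (nonincreasing_Rplus ch dh) => // s s0.
  by rewrite mulr_ge0_le0 ?expR_ge0// subr_le0 dfle.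
rewrite /h /g mulr0 expR0 mulr1; apply: le_trans.
rewrite -[leLHS]mulr1 ler_wpM2l// -expR0 ler_expR mulr_ge0 ?expR_ge0//.
by rewrite divr_ge0// ltW.
Qed.

Lemma exp_decay (f df : R -> R) (c : R) : {within Rplus, continuous f} ->
  (forall t : R, 0 < t -> is_derive t 1 f (df t)) ->
  (forall t : R, 0 < t -> df t <= - c * f t) ->
  forall t : R, 0 <= t -> f t <= f 0 * expR (- (c * t)).
Proof.
move=> cf hf dfle t t0.
have de (s : R) : is_derive s 1 (fun s => expR (c * s)) (c * expR (c * s)).
  apply: is_derive_eq.
  by rewrite /GRing.scale/= mulr1 mulrC.
pose h (s : R) := f s * expR (c * s).
have dh (s : R) : 0 < s -> is_derive s 1 h (expR (c * s) * (df s + c * f s)).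
  move=> s0; apply: (is_derive_eq (is_derive_mul (hf s s0) (de s))); ring.
have ch : {within Rplus, continuous h}.
  apply: within_continuousM => //; apply: continuous_subspaceT => x.
  by have [/derivable1_diffP/differentiable_continuous] := de x.
have : h t <= h 0.
  apply: (nonincreasing_Rplus ch dh) => // s s0.
  by rewrite mulr_ge0_le0 ?expR_ge0//; have := dfle _ s0; lra.
rewrite /h mulr0 expR0 mulr1 => h0.
by rewrite expRN -ler_pdivrMr ?invr_gt0 ?expR_gt0// invrK.
Qed.

End stability.

(** * Stability of the moment equations *)

Section stability_theorem.
Context (R : realType) (d : nat).
Local Notation Rplus := (`[0, +oo[%classic : set R).
Implicit Types (m : R -> 'rV[R]_d) (S : R -> 'M[R]_d).

Let le_add1_sqr (x : R) : x <= 1 + x ^+ 2.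
Proof. by have := sqr_ge0 (x - 1); have := sqr_ge0 (x + 1); rewrite !expr2; nra. Qed.

(** Seeing the equilibrium as a flow lets the distance to it be handled by the general distance
    identity. *)
Lemma gaussian_moment_flow : moment_flow (fun=> 0 : 'rV[R]_d) (fun=> 1%:M).
Proof.
split; try exact: mx_continuous_cst.
- by move=> t _; rewrite mul0mx oppr0; exact: mx_derive_cst.
- move=> t _; rewrite mulmx1 subrr trmx0 mul0mx subr0 scaler0.
  exact: mx_derive_cst.
Qed.

(** At [(mb, Sb) = (0, 1)] every remainder of [moment_dist2_identity] vanishes and only the
    dissipation survives, with [del = m]. *)
Lemma gaussian_dist_rate (m : 'rV[R]_d) (S : 'M[R]_d) : S^T = S ->
  2 * mxdot (S - 1%:M) (2 *: (S - S *m S - m^T *m m)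
               - 2 *: (1%:M - 1%:M *m 1%:M - 0^T *m (0 : 'rV[R]_d)))
  + 4 * mxdot (m - 0) (- (m *m S) - - (0 *m 1%:M)) =
  - 4 * dissipation m m S (S - 1%:M).
Proof.
move=> sS; rewrite moment_dist2_identity// ?trmx1// !subrr !mulmx0 !mul0mx.
by rewrite !mxdot0l subr0 !mulr0 subr0 !add0r mulNr.
Qed.

Lemma gaussian_dist_nonincreasing m S : moment_flow m S ->
  (forall t : R, 0 <= t -> psd (covariance_mx (m t) (S t))) ->
  forall t : R, 0 <= t ->
    moment_dist2 (m t) 0 (S t) 1%:M <= moment_dist2 (m 0) 0 (S 0) 1%:M.
Proof.
move=> mS pS t t0.
apply: (nonincreasing_Rplus (moment_dist2_continuous mS gaussian_moment_flow)
  (fun s => @moment_dist2_derive _ _ _ _ _ _ s mS gaussian_moment_flow)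
  _ (lexx 0) t0) => s s0.
have sS : (S s)^T = S s.
  by apply: (@covariance_mx_sym _ _ (m s)); case: (pS _ (ltW s0)).
rewrite gaussian_dist_rate// mulNr oppr_le0 mulr_ge0// dissipation_ge0//.
  by rewrite linearB/= sS trmx1.
exact: pS (ltW s0).
Qed.

(** The contribution of the mean turns the quadratic right-hand side into a Lyapunov equation driven
    by [1 - S]; in this shape the determinant of the covariance grows at the rate [2 tr (1 - S)]. *)
Lemma covariance_mx_derive m S (t : R) : moment_flow m S -> 0 < t ->
  (S t)^T = S t ->
  mx_derive t (fun s => covariance_mx (m s) (S s))
    ((1%:M - S t) *m covariance_mx (m t) (S t)
     + covariance_mx (m t) (S t) *m (1%:M - S t)).
Proof.
move=> [_ _ dm dS] t0 sS.
have h := mx_deriveB (dS _ t0) (mx_derive_mul (mx_derive_tr (dm _ t0)) (dm _ t0)).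
suff -> : (1%:M - S t) *m covariance_mx (m t) (S t)
     + covariance_mx (m t) (S t) *m (1%:M - S t) =
    2 *: (S t - S t *m S t - (m t)^T *m m t)
    - ((- (m t *m S t))^T *m m t + (m t)^T *m - (m t *m S t)) by [].
rewrite linearN/= trmx_mul sS /covariance_mx.
rewrite !(mulmxBl, mulmxBr, mulNmx, mulmxN) mul1mx mulmx1 !mulmxA scaler_nat.
rewrite mulr2n mul1mx mulmx1.
move: (S t) ((m t)^T *m m t) (S t *m S t) (S t *m (m t)^T *m m t).
move: ((m t)^T *m m t *m S t) => X A B Y Z.
by apply/matrixP => i j; rewrite !mxE; ring.
Qed.

(* Twice the relative entropy [(tr S - d - log det Sigma) / 2] of the Gaussian
   N(m, Sigma) decreases at the rate [2 (|1 - S|^2 + |m|^2)]; exponentiating it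
   avoids the logarithm of a possibly vanishing determinant. *)
Lemma det_covariance_ge m S : moment_flow m S ->
  (forall t : R, 0 <= t -> psd (covariance_mx (m t) (S t))) ->
  forall t : R, 0 <= t ->
  \det (covariance_mx (m 0) (S 0)) ^+ 2 * expR (- 2 * \tr (S 0)) <=
  \det (covariance_mx (m t) (S t)) ^+ 2 * expR (- 2 * \tr (S t)).
Proof.
move=> mS pS t t0; have [cm cS dm dS] := mS.
(* Up to a constant factor, the exponential of -4 times the relative entropy; the square makes it
   nonnegative with no information on the sign of the determinant. *)
pose q s := \det (covariance_mx (m s) (S s)) ^+ 2 * expR (- 2 * \tr (S s)).
have cc : mx_continuous (fun s => covariance_mx (m s) (S s)).
  apply: mx_continuousB => //; apply: mx_continuous_mul => //.
  exact: mx_continuous_tr.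
have sS (s : R) : 0 <= s -> (S s)^T = S s.
  by move=> s0; apply: (@covariance_mx_sym _ _ (m s)); case: (pS _ s0).
pose rate s := 4 * (mxdot (1%:M - S s) (1%:M - S s) + mxdot (m s) (m s)).
have dq (s : R) : 0 < s -> is_derive s 1 (fun s => - q s) (- (rate s * q s)).
  move=> s0; apply: is_deriveN.
  set Sig := covariance_mx (m s) (S s).
  have ddet : is_derive s 1 (fun s => \det (covariance_mx (m s) (S s)))
      (2 * \tr (1%:M - S s) * \det Sig).
    apply: (is_derive_eq (mx_derive_det (covariance_mx_derive mS s0 (sS _ (ltW s0))))).
    rewrite mulmxDl -!mulmxA mul_mx_adj mxtraceD [X in _ + X]mxtrace_mulC -mulmxA.
    rewrite mul_adj_mx !mul_mx_scalar !mxtraceZ; ring.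
  have dexp : is_derive s 1 (fun s => expR (- 2 * \tr (S s)))
      (expR (- 2 * \tr (S s)) * (- 2 *
         \tr (2 *: (S s - S s *m S s - (m s)^T *m m s)))).
    apply: is_derive_expR_comp; apply: is_derive_cstM; apply: mx_derive_trace.
    exact: dS.
  rewrite /q; apply: (is_derive_eq (is_derive_mul (is_derive_mul ddet ddet) dexp)).
  (* As [S] is symmetric, [tr (1 - S) - tr (S - S^2 - m^T m)] completes to |1 - S|^2 + |m|^2. *)
  have -> : rate s = 4 * (\tr (1%:M - S s) -
      \tr (S s - S s *m S s - (m s)^T *m m s)).
    rewrite /rate; congr (_ * _).
    rewrite /mxdot [(1%:M - S s)^T]linearB/= trmx1 sS ?ltW//.
    rewrite (mxtrace_mulC (m s)) mulmxBl !mulmxBr mul1mx !mulmx1 mul1mx.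
    rewrite !linearB/=; ring.
  rewrite mxtraceZ -/Sig; ring.
have cq : {within Rplus, continuous (fun s => - q s)}.
  have -> : (fun s => - q s) = (fun s => -1 * q s).
    by apply/funext => s; rewrite mulN1r.
  apply: within_continuousM; first exact: within_continuous_cst.
  apply: within_continuousM.
    by apply: within_continuousM; exact: mx_continuous_det.
  apply: within_continuous_expR; apply: within_continuousM.
    exact: within_continuous_cst.
  exact: mx_continuous_trace.
have := nonincreasing_Rplus cq dq _ (lexx 0) t0; rewrite lerN2; apply.
move=> s s0; rewrite oppr_le0 mulr_ge0//.
  by rewrite mulr_ge0// addr_ge0 ?mxdot_ge0.
by rewrite mulr_ge0 ?sqr_ge0 ?expR_ge0.
Qed.

(** Here [del = m], so [m e + del] is [m S], and the dissipation is the covariance form of [e] plus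
    |m S|^2. The first part dominates [lam |e|^2]; the second dominates [lam^2 |m|^2], because [S]
    lies above the covariance. The half compensates the weight 2 on |m|^2. *)
Lemma dissipation_lower_bound (lam : R) (m : 'rV[R]_d) (S : 'M[R]_d) : 0 < lam ->
  S^T = S ->
  (forall u : 'rV[R]_d, lam * mxdot u u <= mxdot (u *m covariance_mx m S) u) ->
  Num.min lam (lam ^+ 2 / 2) * moment_dist2 m 0 S 1%:M <=
  dissipation m m S (S - 1%:M).
Proof.
move=> lam0 sS hS.
rewrite dissipationE; last by rewrite linearB/= sS trmx1.
rewrite [m *m _]mulmxBr mulmx1 subrK /moment_dist2 subr0 mulrDr mulrCA mulrA.
apply: lerD.
  rewrite (le_trans _ (mxdot_rows_ge _ hS))// ler_wpM2r ?mxdot_ge0//.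
  by rewrite ge_min lexx.
rewrite (@le_trans _ _ (lam ^+ 2 * mxdot m m))//.
  rewrite ler_wpM2r ?mxdot_ge0// -ler_pdivlMl// mulrC.
  by rewrite ge_min lexx orbT.
have [->|m0] := eqVneq (mxdot m m) 0; first by rewrite mulr0 mxdot_ge0.
have {}m0 : 0 < mxdot m m by rewrite lt_def m0 mxdot_ge0.
rewrite -(ler_pM2r m0) (le_trans _ (mxdot_CS _ _))// -mulrA -expr2 -exprMn.
have mSm : lam * mxdot m m <= mxdot (m *m S) m.
  rewrite (le_trans (hS m))// mulmxBr mxdotDl mxdotNl gerDl oppr_le0.
  by rewrite mulmxA mxdot_mulr mxdot_ge0.
by rewrite lerXn2r// ?nnegrE ?(le_trans _ mSm)// mulr_ge0 ?ltW.
Qed.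

(** The second flow alone supplies the exponentially decaying rate that [gronwall_expdecay] needs:
    [K] bounds its distance to equilibrium and its trace, [c0] keeps its covariance away from
    singular matrices. *)
Lemma moment_flow_stable (c0 K : R) : 0 < c0 -> 0 <= K ->
  exists2 C : R, 0 <= C & forall m mb S Sb,
    moment_flow m S -> moment_flow mb Sb ->
    (forall t : R, 0 <= t -> psd (covariance_mx (m t) (S t))) ->
    (forall t : R, 0 <= t -> psd (covariance_mx (mb t) (Sb t))) ->
    (forall u : 'rV[R]_d,
      c0 * mxdot u u <= mxdot (u *m covariance_mx (mb 0) (Sb 0)) u) ->
    \tr (Sb 0) <= K ->
    forall t : R, 0 <= t -> moment_dist2 (m t) (mb t) (S t) (Sb t) <=
      C * moment_dist2 (m 0) (mb 0) (S 0) (Sb 0).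
Proof.
move=> c00 K0.
(* Bounds |Sb - 1|^2 + 2 |mb|^2 at time 0: expand the square, with |Sb|^2 at most [K^2] and |mb|^2
   at most [K]. *)
pose L0 : R := K ^+ 2 + d%:R + 2 * K.
have L00 : 0 <= L0 by rewrite !addr_ge0 ?sqr_ge0 ?mulr_ge0.
(* Bounds the trace at all times: [tr Sb] is [d] plus the product of [Sb - 1] with the identity,
   estimated by [x <= 1 + x^2] and Cauchy-Schwarz. *)
pose K1 : R := d%:R + 1 + L0 * d%:R.
have K10 : 0 <= K1 by rewrite !addr_ge0 ?mulr_ge0.
(* Lower bound for the squared determinant at all times: initially the determinant is at least
   [c0 ^+ d] and the exponential of [-2 tr Sb] at least [e^(-2 K)]; later that exponential is at
   most 1. *)
have del0 : 0 < (c0 ^+ d) ^+ 2 * expR (- 2 * K).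
  by rewrite mulr_gt0 ?expR_gt0// !exprn_gt0.
have [lam lam0 hlam] := psd_det_lower_bound d K10 del0.
(* [L] decays at the rate [2 c], hence its square root, which enters Gronwall, at the rate [c]. *)
pose c := 2 * Num.min lam (lam ^+ 2 / 2).
have c_gt0 : 0 < c by rewrite mulr_gt0// lt_min lam0 divr_gt0// exprn_gt0.
exists (expR (8 * Num.sqrt L0 / c)); first exact: expR_ge0.
move=> m mb S Sb mS mSb pS pSb hSb trSb.
pose L (t : R) := moment_dist2 (mb t) 0 (Sb t) 1%:M.
have sS (t : R) : 0 <= t -> (S t)^T = S t.
  by move=> t0; apply: (@covariance_mx_sym _ _ (m t)); case: (pS _ t0).
have sSb (t : R) : 0 <= t -> (Sb t)^T = Sb t.
  by move=> t0; apply: (@covariance_mx_sym _ _ (mb t)); case: (pSb _ t0).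
have trE (t : R) : \tr (Sb t) =
    \tr (covariance_mx (mb t) (Sb t)) + mxdot (mb t) (mb t).
  by rewrite /mxdot [X in _ + X]mxtrace_mulC -mxtraceD subrK.
have tr_ge (t : R) : 0 <= t -> \tr (covariance_mx (mb t) (Sb t)) <= \tr (Sb t).
  by move=> t0; rewrite trE lerDl mxdot_ge0.
have trSb0 : 0 <= \tr (Sb 0).
  by rewrite trE addr_ge0 ?mxdot_ge0// psd_trace_ge0//; exact: pSb.
have pSb0 : psd (Sb 0).
  apply/psdP; split; first exact: sSb.
  move=> u; have -> : Sb 0 = covariance_mx (mb 0) (Sb 0) + (mb 0)^T *m mb 0.
    by rewrite subrK.
  rewrite mulmxDr mxdotDl addr_ge0//.
    by have /psdP[_] := pSb 0 (lexx 0); exact.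
  by rewrite mulmxA mxdot_mulr mxdot_ge0.
have LL0 : L 0 <= L0.
  have m0 : mxdot (mb 0) (mb 0) <= K.
    rewrite (le_trans _ trSb)// trE lerDr psd_trace_ge0//; exact: pSb.
  have S0 : mxdot (Sb 0) (Sb 0) <= K ^+ 2.
    by rewrite (le_trans (psd_mxdot_le pSb0))// lerXn2r// nnegrE.
  have E : L 0 = mxdot (Sb 0) (Sb 0) - 2 * \tr (Sb 0) + d%:R
      + 2 * mxdot (mb 0) (mb 0).
    rewrite /L /moment_dist2 subr0 !mxdot_lin (mxdotC 1%:M).
    have -> : mxdot (Sb 0) 1%:M = \tr (Sb 0) by rewrite /mxdot trmx1 mulmx1.
    have -> : mxdot (1%:M : 'M[R]_d) 1%:M = d%:R.
      by rewrite /mxdot trmx1 mulmx1 mxtrace1.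
    ring.
  by rewrite E /L0; lra.
have LtL0 (t : R) : 0 <= t -> L t <= L0.
  by move=> t0; rewrite (le_trans _ LL0)//; exact: gaussian_dist_nonincreasing.
have trK1 (t : R) : 0 <= t -> \tr (Sb t) <= K1.
  move=> t0; have tE : \tr (Sb t) = mxdot (Sb t - 1%:M) 1%:M + d%:R.
    by rewrite /mxdot trmx1 mulmx1 -mxtrace1 -mxtraceD subrK.
  have := mxdot_CS (Sb t - 1%:M) 1%:M.
  have -> : mxdot (1%:M : 'M[R]_d) 1%:M = d%:R by rewrite /mxdot trmx1 mulmx1 mxtrace1.
  have eL : mxdot (Sb t - 1%:M) (Sb t - 1%:M) <= L0.
    rewrite (le_trans _ (LtL0 _ t0))// /L /moment_dist2 lerDl.
    by rewrite mulr_ge0 ?mxdot_ge0.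
  have := ler_wpM2r (ler0n R d) eL.
  rewrite tE /K1; move: (mxdot _ 1%:M : R) (mxdot _ _ * _ : R) (L0 * _ : R) => x y z yz xy.
  by rewrite addrC -addrA lerD2l; have := le_add1_sqr x; lra.
have nondeg (t : R) : 0 <= t ->
    forall u : 'rV[R]_d, lam * mxdot u u <= mxdot (u *m covariance_mx (mb t) (Sb t)) u.
  move=> t0; apply: hlam; [exact: pSb|exact: le_trans (tr_ge _ t0) (trK1 _ t0)|].
  have := det_covariance_ge mSb pSb t0.
  have det0 : c0 ^+ d <= \det (covariance_mx (mb 0) (Sb 0)).
    by apply: det_ge_expr => //; have [] := pSb 0 (lexx 0).
  set D0 := \det _ in det0 *; set Dt := \det _ => h.
  have h1 : (c0 ^+ d) ^+ 2 <= D0 ^+ 2.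
    by rewrite lerXn2r// nnegrE ?(le_trans _ det0)// exprn_ge0// ltW.
  have h2 : expR (- 2 * K) <= expR (- 2 * \tr (Sb 0)).
    by rewrite ler_expR; lra.
  have trt : 0 <= \tr (Sb t).
    by rewrite (le_trans _ (tr_ge _ t0))// psd_trace_ge0//; exact: pSb.
  have h3 : expR (- 2 * \tr (Sb t)) <= 1 by rewrite -[leRHS]expR0 ler_expR; lra.
  rewrite (@le_trans _ _ (D0 ^+ 2 * expR (- 2 * \tr (Sb 0))))//.
    by rewrite ler_pM ?expR_ge0// sqr_ge0.
  by rewrite (le_trans h)// -[leRHS]mulr1 ler_wpM2l// sqr_ge0.
have cL : {within Rplus, continuous L}.
  exact: moment_dist2_continuous mSb gaussian_moment_flow.
have Ldecay (t : R) : 0 <= t -> L t <= L 0 * expR (- (2 * c * t)).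
  apply: (exp_decay cL
    (fun s => @moment_dist2_derive _ _ _ _ _ _ s mSb gaussian_moment_flow)).
  move=> s s0; have s0' := ltW s0.
  rewrite gaussian_dist_rate ?sSb//.
  have := dissipation_lower_bound lam0 (sSb _ s0') (nondeg _ s0').
  rewrite -/(L s) /c; move: (Num.min _ _ : R) (dissipation _ _ _ _ : R) => x y xy.
  by rewrite mulrA -mulNr -mulrA; lra.
have sqrtL (t : R) : 0 <= t -> Num.sqrt (L t) <= Num.sqrt L0 * expR (- (c * t)).
  move=> t0; have -> : expR (- (c * t)) = Num.sqrt (expR (- (2 * c * t))).
    have -> : expR (- (2 * c * t)) = expR (- (c * t)) ^+ 2.
      by rewrite -expRM_natl; congr expR; ring.
    by rewrite sqrtr_sqr ger0_norm ?expR_ge0.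
  rewrite -sqrtrM// ler_wsqrtr// (le_trans (Ldecay _ t0))//.
  by rewrite ler_wpM2r ?expR_ge0.
move=> t t0; rewrite mulrC.
apply: (@gronwall_expdecay _ (fun s => moment_dist2 (m s) (mb s) (S s) (Sb s)) _
  (8 * Num.sqrt L0) c _ c_gt0 _ (moment_dist2_continuous mS mSb)
  (fun s => @moment_dist2_derive _ _ _ _ _ _ s mS mSb)) => //.
- by move=> s; exact: moment_dist2_ge0.
- move=> s s0; have s0' := ltW s0.
  rewrite (le_trans (@moment_dist2_rate_le _ _ _ _ _ _ (sS _ s0') (sSb _ s0') (pS _ s0')))//.
  rewrite ler_wpM2r ?moment_dist2_ge0// -mulrA ler_wpM2l//.
  exact: sqrtL.
Qed.

End stability_theorem.

(** * Integrals and moments *)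

Lemma cvg_bigsum (R : realType) (T I : Type) (F : set_system T) (r : seq I)
    (f : I -> T -> R) (a : I -> R) : Filter F -> (forall i, f i @ F --> a i) ->
  \sum_(i <- r) f i x @[x --> F] --> \sum_(i <- r) a i.
Proof.
move=> FF fa; elim: r => [|i r IHr].
  by rewrite big_nil; under eq_fun do rewrite big_nil; exact: cvg_cst.
by rewrite big_cons; under eq_fun do rewrite big_cons; exact: cvgD.
Qed.

Section rintegral.
Context (R : realType) (disp : measure_display) (T : measurableType disp).
Variable mu : {measure set T -> \bar R}.

Lemma dominated_cvg_Rintegral (D : set T) (f_ : nat -> T -> R) (f g : T -> R) :
  measurable D -> (forall n, measurable_fun D (f_ n)) ->
  (forall x, D x -> f_ ^~ x @ \oo --> f x) ->
  mu.-integrable D (EFin \o g) -> (forall n x, D x -> `|f_ n x| <= g x) ->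
  \int[mu]_(x in D) f_ n x @[n --> \oo] --> \int[mu]_(x in D) f x.
Proof.
move=> mD mf_ f_f ig f_g.
have mfE n : measurable_fun D (EFin \o f_ n) by apply/measurable_EFinP.
have cf (x : T) : D x -> (EFin \o f_ n) x @[n --> \oo] --> (EFin \o f) x.
  by move=> Dx; apply: cvg_EFin; [exact: nearW|exact: f_f].
have mf : measurable_fun D (EFin \o f).
  exact: (emeasurable_fun_cvg (fun n => EFin \o f_ n)).
have [||intf _ cvgf] := @dominated_convergence _ _ _ mu D mD
    (fun n => EFin \o f_ n) (EFin \o f) (EFin \o g) mfE mf _ ig.
  exact: aeW.
  by apply: aeW => x n Dx /=; rewrite lee_fin f_g.
apply: fine_cvg; rewrite fineK//.
exact: integrable_fin_num.
Qed.

Lemma integrable_RD (D : set T) (f g : T -> R) : measurable D ->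
  mu.-integrable D (EFin \o f) -> mu.-integrable D (EFin \o g) ->
  mu.-integrable D (EFin \o (fun x => f x + g x)).
Proof. by move=> mD fi gi; exact: (integrableD mD fi gi). Qed.

Lemma integrable_RB (D : set T) (f g : T -> R) : measurable D ->
  mu.-integrable D (EFin \o f) -> mu.-integrable D (EFin \o g) ->
  mu.-integrable D (EFin \o (fun x => f x - g x)).
Proof. by move=> mD fi gi; exact: (integrableB mD fi gi). Qed.

Lemma integrable_RZ (D : set T) (k : R) (f : T -> R) : measurable D ->
  mu.-integrable D (EFin \o f) -> mu.-integrable D (EFin \o (fun x => k * f x)).
Proof. by move=> mD fi; exact: (integrableZl mD k fi). Qed.

Lemma integrable_Rsum (D : set T) (I : Type) (r : seq I) (h : I -> T -> R) :
  measurable D -> (forall i, mu.-integrable D (EFin \o h i)) ->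
  mu.-integrable D (EFin \o (fun x => \sum_(i <- r) h i x)).
Proof.
move=> mD ih; rewrite (_ : _ \o _ = fun x => (\sum_(i <- r) (h i x)%:E)%E).
  by apply: integrable_sum => // i _; exact: ih.
by apply/funext => x /=; rewrite sumEFin.
Qed.

Lemma Rintegral_sum (D : set T) (I : Type) (r : seq I) (h : I -> T -> R) :
  measurable D -> (forall i, mu.-integrable D (EFin \o h i)) ->
  \int[mu]_(x in D) (\sum_(i <- r) h i x) = \sum_(i <- r) \int[mu]_(x in D) h i x.
Proof.
move=> mD ih; elim: r => [|i r IHr].
  by under eq_Rintegral do rewrite big_nil; rewrite Rintegral_cst// mul0r big_nil.
under eq_Rintegral do rewrite big_cons.
by rewrite RintegralD//; [rewrite IHr big_cons|exact: integrable_Rsum].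
Qed.

End rintegral.

(** * Coordinates, Euclidean norm and Borel measurability of vectors *)

Section vectors.
Context (R : realType) (d : nat).
Implicit Types (x y u v : 'rV[R]_d).

Lemma dot_mxdot x y : dot x y = mxdot x y.
Proof. by rewrite mxdotE big_ord1. Qed.

Lemma sqr_enorm x : enorm x ^+ 2 = mxdot x x.
Proof. by rewrite /enorm dot_mxdot sqr_sqrtr// mxdot_ge0. Qed.

Lemma sqr_frobenius (A : 'M[R]_d) : frobenius A ^+ 2 = mxdot A A.
Proof.
rewrite /frobenius; under eq_bigr do under eq_bigr do rewrite expr2.
by rewrite -mxdotE sqr_sqrtr// mxdot_ge0.
Qed.

Lemma D2_sqr (m1 m2 : 'rV[R]_d) (S1 S2 : 'M[R]_d) :
  D2 (m1, S1) (m2, S2) ^+ 2 = mxdot (m1 - m2) (m1 - m2) + mxdot (S1 - S2) (S1 - S2).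
Proof.
by rewrite /D2 sqr_sqrtr/= ?sqr_enorm ?sqr_frobenius// addr_ge0// mxdot_ge0.
Qed.

Lemma coord_le_norm x i : `|x 0 i| <= 1 + enorm x ^+ 2.
Proof.
have := mxdot_entry x 0 i; rewrite sqr_enorm -[x 0 i ^+ 2]real_normK ?num_real//.
have := sqr_ge0 (`|x 0 i| - 1); have := sqr_ge0 (`|x 0 i| + 1).
move: `|x 0 i| (mxdot x x) => a b; rewrite !expr2; nra.
Qed.

Lemma coord2_le_norm x i j : `|x 0 i * x 0 j| <= enorm x ^+ 2.
Proof.
have := mxdot_entry x 0 i; have := mxdot_entry x 0 j.
rewrite sqr_enorm normrM -[x 0 i ^+ 2]real_normK ?num_real//.
rewrite -[x 0 j ^+ 2]real_normK ?num_real//.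
have := sqr_ge0 (`|x 0 i| - `|x 0 j|).
move: `|x 0 i| `|x 0 j| (mxdot x x) => a b c; rewrite !expr2; nra.
Qed.

Lemma is_derive_coord (x v : 'rV[R]_d) i :
  is_derive x v (fun y : 'rV[R]_d => y 0 i) (v 0 i).
Proof.
pose f (y : 'rV[R]_d) : R := y 0 i.
have lf : linear f by move=> a y z; rewrite /f !mxE.
pose fL : {linear 'rV[R]_d -> R} := HB.pack f (GRing.isLinear.Build _ _ _ _ f lf).
have cf : continuous fL by exact: coord_continuous.
have df : differentiable fL x by exact: linear_differentiable.
split; first exact: diff_derivable.
by rewrite (deriveE _ df) diff_lin.
Qed.

Lemma continuous_measurable_rV (f : 'rV[R]_d -> R) : continuous f ->
  measurable_fun setT f.
Proof.
move=> /continuousP cf; apply: (measurability _ (RGenOpens.measurableE R)).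
move=> _ [_ [a [b ->] <-]]; rewrite setTI; apply: sub_sigma_algebra.
exact/cf/interval_open.
Qed.

End vectors.

Lemma continuous_coordM (R : realType) d (i j : 'I_d) :
  continuous (fun x : 'rV[R]_d => x 0 i * x 0 j).
Proof.
by apply: continuousM_fun; exact: coord_continuous.
Qed.

Section moments_of_measure.
Context (R : realType) (d : nat).
(** A measure of mass one rather than a [probability], since [empirical] carries only a measure
    structure; the same lemmas then serve particles and mean field. *)
Variable rho : {measure set 'rV[R]_d -> \bar R}.
Hypothesis rho1 : rho setT = 1%E.
Hypothesis rho2 : (\int[rho]_x (enorm x ^+ 2)%:E < +oo)%E.

Lemma continuous_sqr_enorm : continuous (fun x : 'rV[R]_d => enorm x ^+ 2).
Proof.
rewrite (_ : (fun x => _) = (fun x : 'rV[R]_d => \sum_i x 0 i * x 0 i)); last first.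
  by apply/funext => x; rewrite sqr_enorm mxdotE big_ord1.
by apply: continuous_bigsum => i; exact: continuous_coordM.
Qed.

Lemma integrable_sqr_enorm : rho.-integrable setT (fun x => (enorm x ^+ 2)%:E).
Proof.
apply/integrableP; split.
  by apply/measurable_EFinP; apply: continuous_measurable_rV; exact: continuous_sqr_enorm.
rewrite (le_lt_trans _ rho2)// le_eqVlt; apply/orP; left; apply/eqP.
by apply: eq_integral => x _; rewrite gee0_abs// lee_fin sqr_ge0.
Qed.

Lemma integrable_cst1 (c : R) : rho.-integrable setT (fun=> c%:E).
Proof.
apply/integrableP; split; first exact: measurable_cst.
by rewrite integral_cst// rho1 mule1 ltry.
Qed.

Lemma integrable_growth (g : 'rV[R]_d -> R) (C : R) : measurable_fun setT g ->
  (forall x, `|g x| <= C * (1 + enorm x ^+ 2)) ->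
  rho.-integrable setT (EFin \o g).
Proof.
move=> mg gC; apply: (@le_integrable _ _ _ _ _ _ _
  (fun x => (C * (1 + enorm x ^+ 2))%:E)) => //.
- exact/measurable_EFinP.
- by move=> x _; rewrite /= lee_fin (le_trans (gC x))// ler_norm.
- have -> : (fun x => (C * (1 + enorm x ^+ 2))%:E) =
      (fun x => C%:E * ((1 : R)%:E + (enorm x ^+ 2)%:E))%E by [].
  apply: integrableZl => //; apply: integrableD => //.
    exact: integrable_cst1.
  exact: integrable_sqr_enorm.
Qed.

Lemma integrable_coord i : rho.-integrable setT (fun x => (x 0 i)%:E).
Proof.
apply: (@integrable_growth (fun x => x 0 i) 1).
  by apply: continuous_measurable_rV; exact: coord_continuous.
by move=> x; rewrite mul1r coord_le_norm.
Qed.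

Lemma integrable_coord2 i j : rho.-integrable setT (fun x => (x 0 i * x 0 j)%:E).
Proof.
apply: (@integrable_growth (fun x => x 0 i * x 0 j) 1).
  by apply: continuous_measurable_rV; exact: continuous_coordM.
by move=> x; rewrite mul1r (le_trans (coord2_le_norm x i j))// lerDr.
Qed.

Lemma Rintegral_cst1 (c : R) : \int[rho]_x c = c.
Proof. by rewrite Rintegral_cst// rho1 mulr1. Qed.

(** The form of the covariance at [u] is the variance of the linear functional [mxdot u]; expanding
    the square leaves finite sums of first and second moments. *)
Lemma covariance_mx_quad (u : 'rV[R]_d) :
  mxdot (u *m covariance_mx (mean rho) (second_moment rho)) u =
  \int[rho]_x ((mxdot u x - mxdot u (mean rho)) ^+ 2).
Proof.
set a := mxdot u (mean rho); have aE : a = mxdot u (mean rho) by [].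
clearbody a; have ux x : mxdot u x = \sum_i u 0 i * x 0 i by rewrite mxdotE big_ord1.
have iZ (c : R) i : rho.-integrable setT (EFin \o (fun x => c * x 0 i)).
  rewrite (_ : _ \o _ = fun x => (c%:E * (x 0 i)%:E)%E)//.
  by apply: integrableZl => //; exact: integrable_coord.
have iZ2 (c : R) i j : rho.-integrable setT (EFin \o (fun x => c * (x 0 i * x 0 j))).
  rewrite (_ : _ \o _ = fun x => (c%:E * (x 0 i * x 0 j)%:E)%E)//.
  by apply: integrableZl => //; exact: integrable_coord2.
transitivity (\int[rho]_x (\sum_i \sum_j u 0 i * u 0 j * (x 0 i * x 0 j)
   + (\sum_i (- 2 * a * u 0 i) * x 0 i + a ^+ 2))); last first.
  apply: eq_Rintegral => x _; rewrite sqrrB ux.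
  have -> : (\sum_i u 0 i * x 0 i) ^+ 2 =
      \sum_i \sum_j u 0 i * u 0 j * (x 0 i * x 0 j).
    rewrite expr2 big_distrlr/=; apply: eq_bigr => i _.
    by apply: eq_bigr => j _; ring.
  have -> : \sum_i (- 2 * a * u 0 i) * x 0 i = - 2 * a * (\sum_i u 0 i * x 0 i).
    by rewrite mulr_sumr; apply: eq_bigr => i _; rewrite mulrA.
  ring.
rewrite RintegralD//; last 2 first.
- by apply: integrable_Rsum => // i; apply: integrable_Rsum => // j; exact: iZ2.
- apply: integrable_RD => //; last exact: integrable_cst1.
  by apply: integrable_Rsum => // i; exact: iZ.
rewrite RintegralD//; last 2 first.
- by apply: integrable_Rsum => // i; exact: iZ.
- exact: integrable_cst1.
rewrite Rintegral_cst1 Rintegral_sum//; last first.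
  by move=> i; apply: integrable_Rsum => // j; exact: iZ2.
rewrite [X in _ + (X + _)]Rintegral_sum//; last by move=> i; exact: iZ.
have -> : \sum_i \int[rho]_x (\sum_j u 0 i * u 0 j * (x 0 i * x 0 j)) =
    mxdot (u *m second_moment rho) u.
  rewrite mxdot_mulr mxdotE big_ord1; apply: eq_bigr => i _.
  rewrite Rintegral_sum//; last by move=> j; exact: iZ2.
  rewrite mxE mulr_sumr; apply: eq_bigr => j _.
  rewrite RintegralZl//; last exact: integrable_coord2.
  by rewrite !mxE -mulrA; congr (_ * (_ * _)); apply: eq_Rintegral => x _; rewrite mulrC.
have -> : \sum_i \int[rho]_x (- 2 * a * u 0 i * x 0 i) = - 2 * a * mxdot u (mean rho).
  rewrite mxdotE big_ord1 mulr_sumr; apply: eq_bigr => i _.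
  rewrite RintegralZl//; last exact: integrable_coord.
  by rewrite mxE mulrA.
rewrite -aE mulmxBr mxdotDl mxdotNl mulmxA [mxdot (_ *m _ *m _) _]mxdot_mulr.
rewrite [X in _ - X]mxdotE !big_ord1 -expr2.
have -> : (u *m (mean rho)^T) 0 0 = a by rewrite aE /mxdot /mxtrace big_ord1.
ring.
Qed.

Lemma psd_covariance_mx : psd (covariance_mx (mean rho) (second_moment rho)).
Proof.
apply/psdP; split.
  rewrite /covariance_mx linearB/= trmx_mul trmxK; congr (_ - _).
  by apply/matrixP => i j; rewrite !mxE; apply: eq_Rintegral => x _; rewrite mulrC.
move=> u; rewrite covariance_mx_quad; apply: Rintegral_ge0 => x _.
exact: sqr_ge0.
Qed.

Lemma grad_gaussian_potential (y : 'rV[R]_d) : grad (@gaussian_potential R d) y = y.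
Proof.
apply/rowP => i; rewrite mxE /partial.
have -> : @gaussian_potential R d = (fun z => \sum_j 2^-1 * (z 0 j * z 0 j)).
  apply/funext => z; rewrite /gaussian_potential sqr_enorm mxdotE big_ord1.
  by rewrite mulrC mulr_sumr.
have h := @is_derive_bigsum R _ _ _ (index_enum 'I_d) xpredT _ _ y (delta_mx 0 i)
  (fun j => is_derive_cstM 2^-1 (is_derive_mul (is_derive_coord y (delta_mx 0 i) j)
     (is_derive_coord y (delta_mx 0 i) j))).
rewrite (@derive_val _ _ _ _ _ _ _ h) (bigD1 i)//= big1 ?addr0.
  by rewrite mxE !eqxx/=; field.
by move=> j /negPf ji; rewrite !mxE ji andbF mulr0 addr0 mulr0.
Qed.

Lemma div2_K2 (x y : 'rV[R]_d) : div2 (@K2 R d) x y = x.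
Proof.
apply/rowP => a; rewrite mxE (bigD1 a)//= big1 ?addr0 => [|b /negPf ba].
  rewrite /partial.
  have -> : (fun z => K2 x z a a) = (fun z => 1 + \sum_j x 0 j * z 0 j).
    by apply/funext => z; rewrite /K2 mxE eqxx.
  have h := is_deriveD (is_derive_cst (1 : R) y (delta_mx 0 a))
   (@is_derive_bigsum R _ _ _ (index_enum 'I_d) xpredT _ _ y (delta_mx 0 a)
     (fun j => is_derive_cstM (x 0 j) (is_derive_coord y (delta_mx 0 a) j))).
  rewrite (@derive_val _ _ _ _ _ _ _ h) add0r (bigD1 a)//= big1 ?addr0.
    by rewrite mxE !eqxx mulr1.
  by move=> j /negPf ja; rewrite !mxE ja andbF mulr0.
rewrite /partial (_ : (fun z => _) = cst 0) ?derive_cst//.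
by apply/funext => z; rewrite /K2 mxE eq_sym ba.
Qed.

(** The integrand [- (1 + <x, y>) y + x] is affine in [x], and its integral only sees the first two
    moments of [rho]. *)
Lemma velocity_gaussian (x : 'rV[R]_d) :
  velocity (@gaussian_potential R d) (@K2 R d) rho x =
  x - mean rho - x *m second_moment rho.
Proof.
apply/rowP => a; rewrite mxE.
have iZ2 (c : R) i j : rho.-integrable setT (EFin \o (fun x => c * (x 0 i * x 0 j))).
  rewrite (_ : _ \o _ = fun x => (c%:E * (x 0 i * x 0 j)%:E)%E)//.
  by apply: integrableZl => //; exact: integrable_coord2.
transitivity (\int[rho]_y (x 0 a - (y 0 a + \sum_b x 0 b * (y 0 b * y 0 a)))).
  apply: eq_Rintegral => y _.
  rewrite grad_gaussian_potential div2_K2 /K2 mul_scalar_mx linearZ/=.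
  rewrite trmxK !mxE dot_mxdot mxdotE big_ord1 mulrDl mul1r addrC mulr_suml.
  by congr (_ - (_ + _)); apply: eq_bigr => b _; rewrite mulrA.
rewrite RintegralB//; last 2 first.
- exact: integrable_cst1.
- apply: integrable_RD => //; first exact: integrable_coord.
  by apply: integrable_Rsum => // b; exact: iZ2.
rewrite RintegralD//; last 2 first.
- exact: integrable_coord.
- by apply: integrable_Rsum => // b; exact: iZ2.
rewrite Rintegral_cst1 Rintegral_sum; [|by []|by move=> b; exact: iZ2].
rewrite !mxE opprD addrA; congr (_ - _ - _); apply: eq_bigr => b _.
by rewrite RintegralZl//; [rewrite mxE|exact: integrable_coord2].
Qed.

End moments_of_measure.

(** * Moments of the particle system *)

Section empirical_moments.
Context (R : realType) (d N : nat) (x : 'I_N -> 'rV[R]_d).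
Hypothesis N0 : (0 < N)%N.

Lemma ge0_integral_empirical (f : 'rV[R]_d -> \bar R) :
  measurable_fun setT f -> (forall y, 0 <= f y)%E ->
  (\int[empirical x]_y f y = (N%:R^-1)%:E * \sum_(i < N) f (x i))%E.
Proof.
move=> mf f0.
(* The family used to define [empirical], rebuilt because it is local there; its zero tail is never
   summed. *)
pose atom (k : nat) : {measure set 'rV[R]_d -> \bar R} :=
  if insub k is Some i then \d_(x i) else mzero.
rewrite (@eq_measure_integral _ _ _ _ (mscale (N%:R^-1)%:nng (msum atom N))).
  rewrite ge0_integral_mscale//= ge0_integral_measure_sum//; congr (_ * _)%E.
  by apply: eq_bigr => i _; rewrite /atom valK integral_dirac// diracT mul1e.
move=> A _ _; rewrite /empirical /mscale /= /msum; congr (_ * _)%E.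
by apply: eq_bigr => i _; rewrite /atom valK.
Qed.

Lemma empirical_setT : empirical x setT = 1%E.
Proof.
rewrite /empirical; under eq_bigr do rewrite diracT.
rewrite sumEFin sumr_const card_ord -EFinM mulVf// pnatr_eq0 -lt0n//.
Qed.

Lemma empirical_sqr_enorm : (\int[empirical x]_y (enorm y ^+ 2)%:E < +oo)%E.
Proof.
rewrite ge0_integral_empirical; first by rewrite sumEFin -EFinM ltry.
  by apply/measurable_EFinP; apply: continuous_measurable_rV; exact: continuous_sqr_enorm.
by move=> y; rewrite lee_fin sqr_ge0.
Qed.

(** Only finitely many real values are averaged, so positive and negative parts recombine whatever
    the growth of [f]. *)
Lemma Rintegral_empirical (f : 'rV[R]_d -> R) : measurable_fun setT f ->
  \int[empirical x]_y f y = N%:R^-1 * \sum_i f (x i).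
Proof.
move=> mf; rewrite /Rintegral integralE.
have mfE : measurable_fun setT (EFin \o f) by apply/measurable_EFinP.
rewrite !ge0_integral_empirical//; [|exact: measurable_funeneg|exact: measurable_funepos].
have posE y : (EFin \o f)^\+%E y = (Num.max (f y) 0)%:E by rewrite funeposE EFin_max.
have negE y : (EFin \o f)^\-%E y = (Num.max (- f y) 0)%:E by rewrite funenegE EFin_max.
under eq_bigr do rewrite posE; under [X in (_ - _ * X)%E]eq_bigr do rewrite negE.
rewrite !sumEFin -!EFinM -EFinB/= -mulrBr -sumrB; congr (_ * _).
apply: eq_bigr => i _; have [h|] := boolP (0 <= f (x i)).
  by rewrite max_l// max_r ?oppr_le0// subr0.
rewrite -ltNge => /ltW h.
by rewrite max_r// max_l ?oppr_ge0// opprK add0r.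
Qed.

Lemma mean_empirical i :
  mean (empirical x) 0 i = N%:R^-1 * \sum_k x k 0 i.
Proof.
rewrite mxE Rintegral_empirical//.
by apply: continuous_measurable_rV; exact: coord_continuous.
Qed.

Lemma second_moment_empirical i j :
  second_moment (empirical x) i j = N%:R^-1 * \sum_k x k 0 i * x k 0 j.
Proof.
rewrite mxE Rintegral_empirical//.
by apply: continuous_measurable_rV; exact: continuous_coordM.
Qed.

End empirical_moments.

Section particles.
Context (R : realType) (d N : nat) (X : 'I_N -> R -> 'rV[R]_d).
Hypothesis N0 : (0 < N)%N.
Hypothesis solX : particle_solution (@gaussian_potential R d) (@K2 R d) X.

Let muX t := empirical (fun i => X i t).

Lemma particle_coord_derive k i (t : R) : 0 < t ->
  is_derive t 1 (fun s => X k s 0 i)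
    (X k t 0 i - mean (muX t) 0 i - (X k t *m second_moment (muX t)) 0 i).
Proof.
move=> t0; have [_ /(_ _ t0) [dX DX]] := solX k.
have /derivable_mxP dXi := dX; split; first exact: dXi.
have := DX; rewrite derive_mx// velocity_gaussian; last 2 first.
- exact: empirical_setT.
- exact: empirical_sqr_enorm.
by move=> /matrixP /(_ 0 i); rewrite !mxE.
Qed.

Lemma particle_coord_continuous k i :
  {within `[0, +oo[, continuous (fun s => X k s 0 i)}.
Proof.
have [cX _] := solX k; move=> t.
apply: (@continuous_comp (subspace (`[0, +oo[%classic : set R)) 'rV[R]_d R
  (X k) (fun y : 'rV[R]_d => y 0 i) t (cX t)).
exact: coord_continuous.
Qed.

(** The velocity is affine in the position, so averaging the derivatives of coordinates and of their
    products returns empirical moments of order at most two: the system closes. *)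
Lemma particle_moment_flow :
  moment_flow (fun t => mean (muX t)) (fun t => second_moment (muX t)).
Proof.
split.
- move=> i j; rewrite ord1.
  rewrite (_ : (fun s => _) = (fun s => N%:R^-1 * \sum_k X k s 0 j)); last first.
    by apply/funext => s; rewrite mean_empirical.
  apply: within_continuousM; first exact: within_continuous_cst.
  by apply: within_continuous_bigsum => k; exact: particle_coord_continuous.
- move=> i j.
  rewrite (_ : (fun s => _) = (fun s => N%:R^-1 * \sum_k X k s 0 i * X k s 0 j)).
    apply: within_continuousM; first exact: within_continuous_cst.
    apply: within_continuous_bigsum => k.
    by apply: within_continuousM; exact: particle_coord_continuous.
  by apply/funext => s; rewrite second_moment_empirical.
- move=> t t0 i j; rewrite ord1.
  rewrite (_ : (fun s => _) = (fun s => N%:R^-1 * \sum_k X k s 0 j)); last first.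
    by apply/funext => s; rewrite mean_empirical.
  apply: (is_derive_eq (is_derive_cstM _ (is_derive_bigsum _ xpredT
    (fun k => particle_coord_derive k j t0)))).
  have Nm (a : R) : N%:R^-1 * (\sum_(k < N) a) = a.
    by rewrite sumr_const card_ord -[a *+ N]mulr_natl mulrA mulVf ?mul1r ?pnatr_eq0 -?lt0n.
  rewrite [RHS]mxE !sumrB mulrBr mulrBr -mean_empirical// Nm.
  rewrite subrr sub0r; congr (- _).
  under eq_bigr do rewrite mxE.
  rewrite exchange_big mulr_sumr [RHS]mxE; apply: eq_bigr => l _.
  by rewrite -mulr_suml mulrA -mean_empirical.
- move=> t t0 i j.
  rewrite (_ : (fun s => _) = (fun s => N%:R^-1 * \sum_k X k s 0 i * X k s 0 j)).
    apply: (is_derive_eq (is_derive_cstM _ (is_derive_bigsum _ xpredT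
      (fun k => is_derive_mul (particle_coord_derive k i t0)
        (particle_coord_derive k j t0))))).
    set m := mean _; set S := second_moment _.
    have SE (a b : 'I_d) : N%:R^-1 * (\sum_k X k t 0 a * X k t 0 b) = S a b.
      by rewrite second_moment_empirical.
    have mE (a : 'I_d) : N%:R^-1 * (\sum_k X k t 0 a) = m 0 a.
      by rewrite mean_empirical.
    have XS (a b : 'I_d) : N%:R^-1 * (\sum_k X k t 0 a * (X k t *m S) 0 b) =
        (S *m S) a b.
      under eq_bigr do rewrite mxE mulr_sumr.
      rewrite exchange_big/= mulr_sumr [RHS]mxE; apply: eq_bigr => l _.
      under eq_bigr do rewrite mulrA.
      by rewrite -mulr_suml mulrA SE.
    have sSS : (S *m S) j i = (S *m S) i j.
      have sS : S^T = S.
        apply/matrixP => a b; rewrite mxE -!SE; congr (_ * _).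
        by apply: eq_bigr => k _; rewrite mulrC.
      by rewrite -[in LHS]sS -trmx_mul mxE.
    transitivity (N%:R^-1 * (\sum_k X k t 0 i * X k t 0 j)
      + N%:R^-1 * (\sum_k X k t 0 i * X k t 0 j)
      - N%:R^-1 * (\sum_k X k t 0 i) * m 0 j
      - N%:R^-1 * (\sum_k X k t 0 j) * m 0 i
      - N%:R^-1 * (\sum_k X k t 0 i * (X k t *m S) 0 j)
      - N%:R^-1 * (\sum_k X k t 0 j * (X k t *m S) 0 i)).
      rewrite [X in N%:R^-1 * X = _](_ : _ = (\sum_k X k t 0 i * X k t 0 j)
        + (\sum_k X k t 0 i * X k t 0 j) - (\sum_k X k t 0 i) * m 0 j
        - (\sum_k X k t 0 j) * m 0 i - (\sum_k X k t 0 i * (X k t *m S) 0 j)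
        - (\sum_k X k t 0 j * (X k t *m S) 0 i)); first by ring.
      rewrite !mulr_suml -!sumrN -!big_split/=; apply: eq_bigr => k _.
      by rewrite -/m -/S; ring.
    rewrite !SE !mE !XS sSS; clearbody m S; rewrite !mxE big_ord1 !mxE; ring.
  by apply/funext => s; rewrite second_moment_empirical.
Qed.

End particles.

(** * Cutoff functions *)

Section flat_function.
Context (R : realType).

(** The smooth function [e^(-1/w)] extended by 0, multiplied by [w^(-k)]. Keeping the pole order as
    a parameter lets derivatives be expressed within the family. *)
Definition flat (k : nat) (w : R) : R :=
  if 0 < w then expR (- w^-1) * w^-1 ^+ k else 0.

Lemma flat_ge0 k w : 0 <= flat k w.
Proof.
rewrite /flat; case: ifP => // w0.
by rewrite mulr_ge0 ?expR_ge0// exprn_ge0// invr_ge0 ltW.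
Qed.

Lemma exprM_expRN_le k (x : R) : 0 <= x -> expR (- x) * x ^+ k <= k`!%:R.
Proof.
move=> x0; rewrite expRN mulrC ler_pdivrMr ?expR_gt0//.
case: k => [|k].
  by rewrite expr0 fact0 mul1r (le_trans _ (expR_ge1Dx _))// lerDl.
have f0 : 0 < k.+1`!%:R :> R by rewrite ltr0n fact_gt0.
by rewrite mulrC -ler_pdivrMr// (le_trans _ (expR_ge1Dxn k x0))// lerDr.
Qed.

Lemma flat_le k w : flat k w <= k`!%:R.
Proof.
by rewrite /flat; case: ifP => // w0; rewrite exprM_expRN_le// invr_ge0 ltW.
Qed.

(** Trades a pole for a factor [w], also where both sides are zero. This brings different orders to
    a common one and resolves the difference quotient at 0. *)
Lemma flatS k w : flat k w = w * flat k.+1 w.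
Proof.
rewrite /flat; case: ifP => [w0|_]; last by rewrite mulr0.
rewrite exprSr; move: (w^-1 ^+ k) (expR _) => a e.
by field; rewrite gt_eqF.
Qed.

Lemma is_derive_flat k (w : R) :
  is_derive w 1 (flat k) (flat k.+2 w - k%:R * flat k.+1 w).
Proof.
have [w0|w0|<-] := ltgtP 0 w.
- have h : is_derive w 1 (fun y => expR (- y^-1) * y^-1 ^+ k)
      (flat k.+2 w - k%:R * flat k.+1 w).
    have hV : is_derive w 1 (fun y : R => y^-1) (- w ^- 2).
      apply: (is_derive_eq (is_deriveV _ (is_derive_id w 1))).
        by rewrite gt_eqF.
      by rewrite [_ *: _]mulr1.
    have hX := is_derive_exprn k hV.
    have hE := is_derive_expR_comp (is_deriveN hV).
    have hEX := is_derive_mul hE hX.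
    apply: (is_derive_eq hEX).
    rewrite /flat w0 /= /GRing.scale/= opprK.
    have -> : w ^- 2 = w^-1 ^+ 2 by rewrite exprVn.
    case: k {hX hEX} => [|k] /=; first by rewrite !mul0r mulr0 expr0 !exprS expr0; ring.
    rewrite !exprS; ring.
  apply: near_eq_is_derive h; near=> y.
  have y0 : 0 < y by near: y; exact: lt_nbhsr.
  by rewrite /flat y0.
- have -> : flat k.+2 w - k%:R * flat k.+1 w = 0.
    by rewrite /flat !ltNge (ltW w0)/= mulr0 subr0.
  apply: near_eq_is_derive (is_derive_cst (0 : R) w (1 : R)); near=> y.
  have y0 : y < 0 by near: y; exact: lt_nbhsl.
  by rewrite /flat ltNge (ltW y0).
- have -> : flat k.+2 0 - k%:R * flat k.+1 0 = 0 by rewrite /flat ltxx mulr0 subr0.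
  (* By [flatS] used twice the quotient at 0 is [h * flat k.+2 h], of size at most |h| (k+2)!. *)
  have cv : (fun h : R => h^-1 *: (flat k (h *: 1 + 0) - flat k 0)) @ 0^' --> (0 : R).
    apply/cvgrPdist_le => /= e e0.
    have K0 : 0 < k.+2`!%:R :> R by rewrite ltr0n fact_gt0.
    near=> h; rewrite addr0 [h *: 1]mulr1 [flat k 0]/flat ltxx subr0 sub0r normrN.
    have -> : h^-1 *: flat k h = h * flat k.+2 h.
      have h0 : h != 0 by near: h; exact: nbhs_dnbhs_neq.
      by rewrite -[LHS]/(h^-1 * flat k h) (flatS k) mulKf// (flatS k.+1).
    rewrite normrM [`|flat _ _|]ger0_norm ?flat_ge0//.
    rewrite (@le_trans _ _ (`|h| * k.+2`!%:R))//.
      by rewrite ler_wpM2l// flat_le.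
    rewrite -ler_pdivlMr//; near: h; apply: dnbhs0_le.
    by rewrite divr_gt0.
  split; first by apply/cvg_ex; exists 0.
  exact: cvg_lim cv.
Unshelve. all: by end_near. Qed.

Lemma continuous_flat k : continuous (flat k).
Proof.
move=> w; have [/derivable1_diffP/differentiable_continuous h _] := is_derive_flat k w.
exact: h.
Qed.

End flat_function.

Section test_functions.
Context (R : realType) (d : nat).
Implicit Types (p q : 'rV[R]_d -> R).

(** A predicate on functions: continuity and closure under partial derivatives follow by induction,
    with no polynomial algebra. *)
Inductive polyfun : ('rV[R]_d -> R) -> Prop :=
| polyfun_cst c : polyfun (fun=> c)
| polyfun_coord i : polyfun (fun x => x 0 i)
| polyfunD p q : polyfun p -> polyfun q -> polyfun (fun x => p x + q x)
| polyfunM p q : polyfun p -> polyfun q -> polyfun (fun x => p x * q x).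

Lemma polyfun_continuous p : polyfun p -> continuous p.
Proof.
elim=> [c|i|p1 p2 _ c1 _ c2|p1 p2 _ c1 _ c2].
- exact: cst_continuous.
- exact: coord_continuous.
- exact: continuousD_fun.
- exact: continuousM_fun.
Qed.

Lemma polyfun_derive p i : polyfun p -> exists2 q, polyfun q &
  forall x, is_derive x (delta_mx 0 i) p (q x).
Proof.
elim=> [c|j|p1 p2 h1 [q1 pq1 d1] h2 [q2 pq2 d2]|p1 p2 h1 [q1 pq1 d1] h2 [q2 pq2 d2]].
- by exists (fun=> 0); [exact: polyfun_cst|move=> x; exact: is_derive_cst].
- exists (fun=> (delta_mx 0 i : 'rV[R]_d) 0 j); first exact: polyfun_cst.
  by move=> x; exact: is_derive_coord.
- exists (fun x => q1 x + q2 x); first exact: polyfunD.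
  by move=> x; exact: is_deriveD.
- exists (fun x => p1 x * q2 x + p2 x * q1 x).
    by apply: polyfunD; exact: polyfunM.
  by move=> x; exact: is_derive_mul.
Qed.

Lemma polyfun_sum (I : Type) (r : seq I) (h : I -> 'rV[R]_d -> R) :
  (forall i, polyfun (h i)) -> polyfun (fun x => \sum_(i <- r) h i x).
Proof.
move=> hp; elim: r => [|i r IHr].
  by under eq_fun do rewrite big_nil; exact: polyfun_cst.
by under eq_fun do rewrite big_cons; exact: polyfunD.
Qed.

Definition cutoff_arg (l : R) (x : 'rV[R]_d) : R := 1 - l * enorm x ^+ 2.

Lemma polyfun_cutoff_arg l : polyfun (cutoff_arg l).
Proof.
have -> : cutoff_arg l = (fun x => 1 + (- l) * \sum_i x 0 i * x 0 i).
  by apply/funext => x; rewrite /cutoff_arg sqr_enorm mxdotE big_ord1 mulNr.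
apply: polyfunD; first exact: polyfun_cst.
apply: polyfunM; first exact: polyfun_cst.
by apply: polyfun_sum => i; apply: polyfunM; exact: polyfun_coord.
Qed.

Lemma is_derive_cutoff_arg l x i :
  is_derive x (delta_mx 0 i) (cutoff_arg l) (- 2 * l * x 0 i).
Proof.
have -> : cutoff_arg l = (fun x => 1 + (- l) * \sum_i x 0 i * x 0 i).
  by apply/funext => y; rewrite /cutoff_arg sqr_enorm mxdotE big_ord1 mulNr.
have h := is_deriveD (is_derive_cst (1 : R) x (delta_mx 0 i))
  (is_derive_cstM (- l) (is_derive_bigsum (index_enum 'I_d) xpredT
    (fun j => is_derive_mul (is_derive_coord x (delta_mx 0 i) j)
      (is_derive_coord x (delta_mx 0 i) j)))).
apply: (is_derive_eq h); rewrite add0r (bigD1 i)//= big1 ?addr0.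
  by rewrite mxE !eqxx/=; ring.
by move=> j /negPf ji; rewrite !mxE ji andbF mulr0 addr0.
Qed.

(** For positive [l] these functions vanish off the ball [l |x|^2 < 1], and polynomial factors make
    the class stable under partial derivatives, so smoothness is an induction on the list of
    derivatives. *)
Definition bump l p k (x : 'rV[R]_d) : R := p x * flat k (cutoff_arg l x).

Lemma is_derive_bump l p (dp : R) k x i : is_derive x (delta_mx 0 i) p dp ->
  is_derive x (delta_mx 0 i) (bump l p k)
    (p x * ((flat k.+2 (cutoff_arg l x) - k%:R * flat k.+1 (cutoff_arg l x))
            * (- 2 * l * x 0 i)) + flat k (cutoff_arg l x) * dp).
Proof.
move=> hp; apply: is_derive_mul hp _.
exact: is_derive_comp (is_derive_flat _ _) (is_derive_cutoff_arg _ _ _).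
Qed.

(** Differentiation raises the order by 2. The terms of orders [k] and [k.+1] are rewritten at order
    [k.+2] by [flatS], at the price of factors [cutoff_arg l], so that a single polynomial
    suffices. *)
Lemma bump_partial l p k i : polyfun p -> exists q, polyfun q /\
  forall x, is_derive x (delta_mx 0 i) (bump l p k) (bump l q k.+2 x).
Proof.
move=> pp; have [q pq dq] := polyfun_derive i pp.
exists (fun x => p x * ((1 + (- k%:R) * cutoff_arg l x) * ((- 2 * l) * x 0 i))
  + cutoff_arg l x * cutoff_arg l x * q x); split.
  have pw := polyfun_cutoff_arg l.
  apply: polyfunD; apply: polyfunM => //; last exact: polyfunM.
  apply: polyfunM; last by apply: polyfunM; [exact: polyfun_cst|exact: polyfun_coord].
  by apply: polyfunD; [exact: polyfun_cst|apply: polyfunM => //; exact: polyfun_cst].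
move=> x; apply: (is_derive_eq (is_derive_bump _ _ (dq x))).
rewrite /bump [flat k _]flatS [flat k.+1 _]flatS; ring.
Qed.

Lemma bump_continuous l p k : polyfun p -> continuous (bump l p k).
Proof.
move=> pp; apply: continuousM_fun; first exact: polyfun_continuous.
move=> x; apply: continuous_comp; last exact: continuous_flat.
exact: (polyfun_continuous (polyfun_cutoff_arg l)).
Qed.

Lemma bump_smooth l p k : polyfun p -> smooth (bump l p k).
Proof.
move=> pp s.
have [q [j [pq ->]]] : exists q j, polyfun q /\
    foldr (@partial R d) (bump l p k) s = bump l q j.
  elim: s => [|i s [q [j [pq /= ->]]]]; first by exists p, k.
  have [q' [pq' dq]] := bump_partial l j i pq.
  exists q', j.+2; split=> //; apply/funext => x.
  by rewrite /partial (@derive_val _ _ _ _ _ _ _ (dq x)).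
split; first exact: bump_continuous.
by move=> i x; have [q' [_ dq]] := bump_partial l j i pq; have [] := dq x.
Qed.

Lemma bump_support l p k x : 0 < l -> bump l p k x != 0 -> l * enorm x ^+ 2 <= 1.
Proof.
move=> l0; rewrite /bump /flat; case: ifP => [|_]; last by rewrite mulr0 eqxx.
by rewrite /cutoff_arg subr_gt0 => /ltW.
Qed.

Lemma closed_enorm_ball (l : R) : closed [set x : 'rV[R]_d | l * enorm x ^+ 2 <= 1].
Proof.
have -> : [set x : 'rV[R]_d | l * enorm x ^+ 2 <= 1] =
    cutoff_arg l @^-1` [set y | 0 <= y].
  by apply/seteqP; split=> x /=; rewrite /cutoff_arg subr_ge0.
apply: closed_comp => [x _|]; last exact: closed_ge.
exact: (polyfun_continuous (polyfun_cutoff_arg l)).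
Qed.

Lemma compact_enorm_ball (l : R) : 0 < l ->
  compact [set x : 'rV[R]_d | l * enorm x ^+ 2 <= 1].
Proof.
move=> l0; apply: bounded_closed_compact; last exact: closed_enorm_ball.
(* On the ball every coordinate is at most [1 + |x|^2], hence at most [1 + 1/l], in absolute
   value. *)
exists (1 + l^-1); split; first exact: num_real.
move=> M hM x /= hx; rewrite (le_trans _ (ltW hM))//.
rewrite [leLHS]/Num.Def.normr/= mx_normrE; apply: bigmax_le => [|[i j] _ /=].
  by rewrite addr_ge0// invr_ge0 ltW.
rewrite ord1 (le_trans (coord_le_norm x j))// lerD2l.
by rewrite -[leRHS]mulr1 -ler_pdivrMl ?invr_gt0// invrK.
Qed.

Lemma bump_test_function l p k : 0 < l -> polyfun p -> test_function (bump l p k).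
Proof.
move=> l0 pp; split; first exact: bump_smooth.
apply: (subclosed_compact _ (compact_enorm_ball l0)); first exact: closed_closure.
rewrite [X in _ `<=` X](closure_id _).1; last exact: closed_enorm_ball.
by apply: closureS => x /=; exact: bump_support.
Qed.

End test_functions.

(** * Moments of the mean-field solution *)

Section cutoff.
Context (R : realType) (d : nat).
Implicit Types (x : 'rV[R]_d) (p : 'rV[R]_d -> R).

Lemma enorm_ge0 x : 0 <= enorm x.
Proof. exact: sqrtr_ge0. Qed.

Lemma coord_le_enorm x i : `|x 0 i| <= enorm x.
Proof.
rewrite -(ler_pXn2r (_ : 0 < 2)%N)// ?nnegrE ?enorm_ge0// sqr_enorm.
by rewrite real_normK ?num_real// mxdot_entry.
Qed.

Lemma sqr_1enorm_le x : (1 + enorm x) ^+ 2 <= 2 * (1 + enorm x ^+ 2).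
Proof. have := sqr_ge0 (1 - enorm x); rewrite !expr2; nra. Qed.

(** The factor [e] normalizes the value at the origin to 1, so that the cutoff tends to 1 pointwise
    as [l] tends to 0. *)
Definition cutoff (l : R) x : R := expR 1 * flat 0 (cutoff_arg l x).

Lemma cutoff_ge0 l x : 0 <= cutoff l x.
Proof. by rewrite mulr_ge0 ?expR_ge0 ?flat_ge0. Qed.

Lemma cutoff_le1 l x : 0 <= l -> cutoff l x <= 1.
Proof.
move=> l0; rewrite /cutoff /flat; case: ifP => [w0|_]; last by rewrite mulr0.
rewrite expr0 mulr1 -expRD -[leRHS]expR0 ler_expR subr_le0.
by rewrite invf_ge1// /cutoff_arg gerBl mulr_ge0// sqr_ge0.
Qed.

Lemma continuous_cutoff l : continuous (cutoff l).
Proof.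
apply: continuousM_fun; first exact: cst_continuous.
move=> x; apply: (@continuous_comp _ _ _ (cutoff_arg l) (@flat R 0)).
  exact: (polyfun_continuous (@polyfun_cutoff_arg R d l)).
exact: continuous_flat.
Qed.

Lemma cvg_cutoff_arg x : cutoff_arg n.+1%:R^-1 x @[n --> \oo] --> (1 : R).
Proof.
have e2 : 1 - 0 * enorm x ^+ 2 = 1 by rewrite mul0r subr0.
rewrite -[X in _ --> X]e2.
apply: cvgB; first exact: cvg_cst.
by apply: cvgM; [exact: cvg_harmonic|exact: cvg_cst].
Qed.

Lemma cvg_cutoff x : cutoff n.+1%:R^-1 x @[n --> \oo] --> (1 : R).
Proof.
have e1 : expR 1 * flat 0 1 = 1 :> R.
  by rewrite /flat ltr01 expr0 mulr1 invr1 -expRD subrr expR0.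
rewrite -[X in _ --> X]e1.
apply: cvgM; first exact: cvg_cst.
apply: (@continuous_cvg _ _ _ _ _ (fun n => cutoff_arg n.+1%:R^-1 x) (@flat R 0) 1).
  exact: continuous_flat.
exact: cvg_cutoff_arg.
Qed.

Lemma bump_cutoff l p x : bump l (fun x => expR 1 * p x) 0 x = p x * cutoff l x.
Proof. by rewrite /bump /cutoff; ring. Qed.

(** The subtracted term is the error due to the cutoff. Its factor [l] makes it vanish in the limit,
    and on its support [l |x|^2 <= 1] keeps it under control. *)
Lemma grad_cutoffM l p (q : 'I_d -> 'rV[R]_d -> R) x i :
  (forall x, is_derive x (delta_mx 0 i) p (q i x)) ->
  grad (fun x => p x * cutoff l x) x 0 i = q i x * cutoff l x -
    2 * expR 1 * l * flat 2 (cutoff_arg l x) * p x * x 0 i.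
Proof.
move=> dq; rewrite mxE /partial.
have := is_derive_bump l 0 (is_derive_cstM (expR 1) (dq x)).
rewrite (_ : bump _ _ _ = fun x => p x * cutoff l x); last first.
  by apply/funext => y; exact: bump_cutoff.
by move=> /@derive_val ->; rewrite /cutoff; ring.
Qed.

End cutoff.

Section mean_field.
Context (R : realType) (d : nat).
Variables (mu0 : probability 'rV[R]_d R) (mu : R -> probability 'rV[R]_d R).
Hypothesis solmu :
  mean_field_solution (@gaussian_potential R d) (@K2 R d) mu0 mu.
Local Notation Rplus := (`[0, +oo[%classic : set R).

Lemma mean_field_sqr_enorm t : 0 <= t ->
  (\int[mu t]_x (enorm x ^+ 2)%:E < +oo)%E.
Proof.
move=> t0; have [_ _ /(_ t)[M hM] _] := solmu.
by rewrite (le_lt_trans (hM t _)) ?ltry// t0 lexx.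
Qed.

Lemma mean_field_Rsqr_enorm (T : R) : exists2 M : R, 0 <= M &
  forall t, 0 <= t <= T -> \int[mu t]_x (enorm x ^+ 2) <= M.
Proof.
have [_ _ /(_ T)[M hM] _] := solmu.
exists `|M| => // t tT; rewrite (le_trans _ (ler_norm M))//.
have := hM _ tT; rewrite -lee_fin /Rintegral => h.
rewrite fineK// ge0_fin_numE; first by rewrite (le_lt_trans h) ?ltry.
by apply: integral_ge0 => x _; rewrite lee_fin sqr_ge0.
Qed.

Let mu1 t : mu t setT = 1%E. Proof. exact: probability_setT. Qed.

Lemma mean_field_integrable (g : 'rV[R]_d -> R) (C : R) (t : R) : 0 <= t ->
  measurable_fun setT g -> (forall x, `|g x| <= C * (1 + enorm x ^+ 2)) ->
  (mu t).-integrable setT (EFin \o g).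
Proof.
by move=> t0 mg gC; exact: (integrable_growth (mu1 t) (mean_field_sqr_enorm t0) mg gC).
Qed.

Lemma normr_Rintegral_growth (g : 'rV[R]_d -> R) (C t : R) : 0 <= t -> 0 <= C ->
  measurable_fun setT g -> (forall x, `|g x| <= C * (1 + enorm x ^+ 2)) ->
  `|\int[mu t]_x g x| <= C * (1 + \int[mu t]_x (enorm x ^+ 2)).
Proof.
move=> t0 C0 mg gC; have ig := mean_field_integrable t0 mg gC.
have mE : measurable_fun setT (fun x : 'rV[R]_d => enorm x ^+ 2).
  by apply: continuous_measurable_rV; exact: continuous_sqr_enorm.
have iE : (mu t).-integrable setT (EFin \o (fun x : 'rV[R]_d => enorm x ^+ 2)).
  exact: (integrable_sqr_enorm (mean_field_sqr_enorm t0)).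
have i1 : (mu t).-integrable setT (EFin \o (fun x : 'rV[R]_d => 1 : R)).
  exact: (integrable_cst1 (mu1 t) 1).
rewrite (le_trans (le_normr_Rintegral _ ig))//.
have -> : C * (1 + \int[mu t]_x (enorm x ^+ 2)) =
    \int[mu t]_x (C * (1 + enorm x ^+ 2)).
  rewrite RintegralZl//; last exact: integrable_RD.
  by rewrite RintegralD// (Rintegral_cst1 (mu1 t)).
apply: le_Rintegral => //.
- exact: (integrable_abse ig).
- by apply: integrable_RZ => //; exact: integrable_RD.
Qed.

Lemma cvg_cutoff_Rintegral (g : 'rV[R]_d -> R) (C t : R) : 0 <= t ->
  continuous g -> (forall x, `|g x| <= C * (1 + enorm x ^+ 2)) ->
  \int[mu t]_x (g x * cutoff n.+1%:R^-1 x) @[n --> \oo] --> \int[mu t]_x g x.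
Proof.
move=> t0 cg gC.
have mg := continuous_measurable_rV cg.
apply: (@dominated_cvg_Rintegral _ _ _ (mu t) setT
  (fun n x => g x * cutoff n.+1%:R^-1 x) g (fun x => C * (1 + enorm x ^+ 2))) => //.
- move=> n; apply: measurable_funM => //; apply: continuous_measurable_rV.
  exact: continuous_cutoff.
- move=> x _; rewrite -[X in _ --> X]mulr1; apply: cvgM; first exact: cvg_cst.
  exact: cvg_cutoff.
- apply: (@mean_field_integrable _ `|C|) => //.
    apply: continuous_measurable_rV; apply: continuousM_fun; first exact: cst_continuous.
    by apply: continuousD_fun; [exact: cst_continuous|exact: continuous_sqr_enorm].
  by move=> x; rewrite normrM ler_wpM2l// ger0_norm// addr_ge0// sqr_ge0.
- move=> n x _; rewrite normrM (le_trans _ (gC x))// ler_piMr// ger0_norm ?cutoff_ge0//.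
  by rewrite cutoff_le1// invr_ge0.
Qed.

(** Narrow continuity concerns bounded functions, whereas [g] may grow quadratically. Each cut-off
    version of [g] is bounded and integrates to a continuous function of time; the limit is at least
    measurable, which is enough to write time integrals. *)
Lemma mean_field_measurable (g : 'rV[R]_d -> R) (C : R) :
  continuous g -> (forall x, `|g x| <= C * (1 + enorm x ^+ 2)) ->
  measurable_fun Rplus (fun t => \int[mu t]_x g x).
Proof.
move=> cg gC; have [_ hc _ _] := solmu.
have cp t : Rplus t ->
    \int[mu t]_x (g x * cutoff n.+1%:R^-1 x) @[n --> \oo] --> \int[mu t]_x g x.
  by move=> /= t0; apply: cvg_cutoff_Rintegral gC => //; move: t0; rewrite in_itv/= andbT.
apply: (@measurable_fun_cvg _ _ R Rplus
  (fun n t => \int[mu t]_x (g x * cutoff n.+1%:R^-1 x))) => //.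
move=> n; apply: subspace_continuous_measurable_fun => //.
have l0 : 0 < n.+1%:R^-1 :> R by rewrite invr_gt0.
apply: hc.
  apply: continuousM_fun => //.
  exact: continuous_cutoff.
(* The cutoff vanishes unless |x|^2 is at most [n + 1]. *)
exists (`|C| * (1 + n.+1%:R)); split; first exact: num_real.
move=> M hM x _ /=; rewrite (le_trans _ (ltW hM))//.
have [wx|wx] := leP (n.+1%:R^-1 * enorm x ^+ 2) 1.
  have Ex : enorm x ^+ 2 <= n.+1%:R.
    by rewrite -[leRHS]mulr1 -ler_pdivrMl.
  rewrite normrM [`|cutoff _ _|]ger0_norm ?cutoff_ge0//.
  rewrite (@le_trans _ _ `|g x|)//; first by rewrite ler_piMr// cutoff_le1// ltW.
  rewrite (le_trans (gC x))// (@le_trans _ _ (`|C| * (1 + enorm x ^+ 2)))//.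
    by rewrite ler_wpM2r ?ler_norm// addr_ge0// sqr_ge0.
  by rewrite ler_wpM2l// lerD2l.
have -> : cutoff n.+1%:R^-1 x = 0.
  by rewrite /cutoff /flat /cutoff_arg subr_gt0 ltNge (ltW wx)/= mulr0.
by rewrite mulr0 normr0 mulr_ge0.
Qed.

End mean_field.

(** * Polynomial test functions in the weak equation *)

Section mean_field_moments.
Context (R : realType) (d : nat).
Variables (mu0 : probability 'rV[R]_d R) (mu : R -> probability 'rV[R]_d R).
Hypothesis solmu :
  mean_field_solution (@gaussian_potential R d) (@K2 R d) mu0 mu.
Local Notation Rplus := (`[0, +oo[%classic : set R).
Local Notation m s := (mean (mu s)).
Local Notation S s := (second_moment (mu s)).

Let mu1 t : mu t setT = 1%E. Proof. exact: probability_setT. Qed.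

Let growthM (h1 h2 : 'rV[R]_d -> R) (C1 C2 : R) : 0 <= C1 -> 0 <= C2 ->
  (forall x, `|h1 x| <= C1 * (1 + enorm x)) ->
  (forall x, `|h2 x| <= C2 * (1 + enorm x)) ->
  forall x, `|h1 x * h2 x| <= 2 * (C1 * C2) * (1 + enorm x ^+ 2).
Proof.
move=> C10 C20 h1C h2C x.
rewrite normrM (le_trans (ler_pM _ _ (h1C x) (h2C x)))//.
have -> : C1 * (1 + enorm x) * (C2 * (1 + enorm x)) = C1 * C2 * (1 + enorm x) ^+ 2.
  by ring.
have -> : 2 * (C1 * C2) * (1 + enorm x ^+ 2) = C1 * C2 * (2 * (1 + enorm x ^+ 2)).
  by ring.
by rewrite ler_wpM2l ?mulr_ge0// sqr_1enorm_le.
Qed.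

Let coord_growth i (x : 'rV[R]_d) : `|x 0 i| <= 1 * (1 + enorm x).
Proof. by rewrite mul1r (le_trans (coord_le_enorm x i))// lerDr. Qed.

Let lin_quad (h : 'rV[R]_d -> R) (C : R) : 0 <= C ->
  (forall x, `|h x| <= C * (1 + enorm x)) ->
  forall x, `|h x| <= 2 * C * (1 + enorm x ^+ 2).
Proof.
move=> C0 hC x; rewrite (le_trans (hC x))// [2 * C]mulrC -mulrA ler_wpM2l//.
rewrite (le_trans _ (sqr_1enorm_le x))// expr2 ler_peMl ?addr_ge0 ?enorm_ge0//.
by rewrite lerDl enorm_ge0.
Qed.

Let mean_bound i (s : R) : 0 <= s ->
  `|m s 0 i| <= 1 + \int[mu s]_x (enorm x ^+ 2).
Proof.
move=> s0; rewrite mxE -[leRHS]mul1r.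
apply: (normr_Rintegral_growth solmu) => //.
  by apply: continuous_measurable_rV; exact: coord_continuous.
by move=> x; rewrite mul1r coord_le_norm.
Qed.

Lemma coord2_growth i j (x : 'rV[R]_d) : `|x 0 i * x 0 j| <= 1 * (1 + enorm x ^+ 2).
Proof. by rewrite mul1r (le_trans (coord2_le_norm x i j))// lerDr. Qed.

Let second_bound i j (s : R) : 0 <= s ->
  `|S s i j| <= 1 + \int[mu s]_x (enorm x ^+ 2).
Proof.
move=> s0; rewrite mxE -[leRHS]mul1r.
apply: (normr_Rintegral_growth solmu) => //; last exact: coord2_growth.
by apply: continuous_measurable_rV; exact: continuous_coordM.
Qed.

(** Closed form of the velocity; it agrees with [velocity] at times [s >= 0], where second moments
    are known to be finite. *)
Definition vel (s : R) (x : 'rV[R]_d) i : R := x 0 i - m s 0 i - (x *m S s) 0 i.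

Let velE s x i : 0 <= s ->
  velocity (@gaussian_potential R d) (@K2 R d) (mu s) x 0 i = vel s x i.
Proof.
move=> s0; rewrite (velocity_gaussian (mu1 s) (mean_field_sqr_enorm solmu s0)).
by rewrite 2!mxE [in X in _ + X]mxE [in X in _ + X - _]mxE.
Qed.

Let vel_bound (T : R) : exists2 A : R, 0 <= A & forall s x i, 0 <= s <= T ->
  `|vel s x i| <= A * (1 + enorm x).
Proof.
have [M M0 hM] := mean_field_Rsqr_enorm solmu T.
exists (1 + (1 + M) + d%:R * (1 + M)); first by rewrite !addr_ge0 ?mulr_ge0 ?addr_ge0.
move=> s x i sT; have s0 : 0 <= s by case/andP : sT.
have Ms := hM _ sT.
have h1 := coord_le_enorm x i.
have h2 : `|m s 0 i| <= 1 + M by rewrite (le_trans (mean_bound i s0))// lerD2l.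
have h3 : `|(x *m S s) 0 i| <= d%:R * (1 + M) * enorm x.
  rewrite mxE (le_trans (ler_norm_sum _ _ _))//.
  rewrite (@le_trans _ _ (\sum_(j < d) (1 + M) * enorm x))//; last first.
    by rewrite sumr_const card_ord -[leLHS]mulr_natl mulrA.
  apply: ler_sum => j _; rewrite normrM mulrC ler_pM//.
    by rewrite (le_trans (second_bound _ _ s0))// lerD2l.
  exact: coord_le_enorm.
have E0 := enorm_ge0 x.
rewrite /vel (le_trans (ler_normB _ _))// (le_trans (lerD (ler_normB _ _) (lexx _)))//.
have dM : 0 <= d%:R * (1 + M) by rewrite mulr_ge0// addr_ge0.
have ME : 0 <= (1 + M) * enorm x by rewrite mulr_ge0// addr_ge0.
rewrite (le_trans (lerD (lerD h1 h2) h3))//.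
move: (d%:R * (1 + M)) (enorm x) dM E0 ME => a e a0 e0; nra.
Qed.

Section drift.
Variables (h : 'I_d -> 'rV[R]_d -> R) (C : R).
Hypothesis C0 : 0 <= C.
Hypothesis ch : forall i, continuous (h i).
Hypothesis hC : forall i x, `|h i x| <= C * (1 + enorm x).

(** [h] stands for the gradient of a test function. Allowing any continuous family of linear growth
    treats exact gradients and their cut-off versions together. *)
Definition drift s x := \sum_i h i x * vel s x i.

Let chx i j : continuous (fun x : 'rV[R]_d => h i x * x 0 j).
Proof. by apply: continuousM_fun => //; exact: coord_continuous. Qed.

Let hxC i j x : `|h i x * x 0 j| <= 2 * (C * 1) * (1 + enorm x ^+ 2).
Proof. exact: growthM (hC i) (coord_growth j) x. Qed.

Let hC2 i x : `|h i x| <= 2 * C * (1 + enorm x ^+ 2).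
Proof. exact: lin_quad (hC i) x. Qed.

(** Writes the drift through integrals of functions that do not depend on time, whose measurability
    in [s] is known; that of the drift follows. *)
Lemma drift_integralE s : 0 <= s ->
  \int[mu s]_x drift s x = \sum_i (\int[mu s]_x (h i x * x 0 i)
    - m s 0 i * \int[mu s]_x h i x
    - \sum_j S s j i * \int[mu s]_x (h i x * x 0 j)).
Proof.
move=> s0.
have ihx i j : (mu s).-integrable setT (EFin \o (fun x => h i x * x 0 j)).
  apply: (mean_field_integrable solmu s0 _ (hxC i j)).
  exact: continuous_measurable_rV.
have ih i : (mu s).-integrable setT (EFin \o (h i)).
  apply: (mean_field_integrable solmu s0 _ (hC2 i)).
  exact: continuous_measurable_rV.
have iS i : (mu s).-integrable setT
    (EFin \o (fun x => \sum_j S s j i * (h i x * x 0 j))).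
  by apply: integrable_Rsum => // j; apply: integrable_RZ.
have im i : (mu s).-integrable setT (EFin \o (fun x => m s 0 i * h i x)).
  exact: integrable_RZ.
have dE x : drift s x = \sum_i (h i x * x 0 i - m s 0 i * h i x
    - \sum_j S s j i * (h i x * x 0 j)).
  apply: eq_bigr => i _; rewrite /vel [(x *m S s) 0 i]mxE !mulrBr; congr (_ - _ - _).
    by rewrite mulrC.
  by rewrite mulr_sumr; apply: eq_bigr => j _; ring.
under eq_Rintegral do rewrite dE.
rewrite Rintegral_sum//; last first.
  by move=> i; apply: integrable_RB => //; exact: integrable_RB.
apply: eq_bigr => i _; rewrite RintegralB//; last exact: integrable_RB.
rewrite RintegralB// RintegralZl// Rintegral_sum//; last first.
  by move=> j; exact: integrable_RZ.
by congr (_ - _); apply: eq_bigr => j _; rewrite RintegralZl.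
Qed.

Lemma drift_measurable : measurable_fun Rplus (fun s => \int[mu s]_x drift s x).
Proof.
have mf (g : 'rV[R]_d -> R) K : continuous g ->
    (forall x, `|g x| <= K * (1 + enorm x ^+ 2)) ->
    measurable_fun Rplus (fun t => \int[mu t]_x g x).
  exact: (mean_field_measurable solmu).
apply: (@eq_measurable_fun _ _ _ _ _ (fun s => \sum_i (\int[mu s]_x (h i x * x 0 i)
    - m s 0 i * \int[mu s]_x h i x
    - \sum_j S s j i * \int[mu s]_x (h i x * x 0 j)))).
  by move=> s; rewrite inE/= in_itv/= andbT => s0; rewrite drift_integralE.
apply: measurable_sum => i; apply: measurable_funB.
  apply: measurable_funB; first exact: mf (hxC i i).
  apply: measurable_funM; last exact: mf (hC2 i).
  rewrite (_ : (fun s => _) = (fun s => \int[mu s]_x x 0 i)).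
    apply: (mf _ 1); first exact: coord_continuous.
    by move=> x; rewrite mul1r coord_le_norm.
  by apply/funext => s; rewrite mxE.
apply: measurable_sum => j; apply: measurable_funM; last exact: mf (hxC i j).
rewrite (_ : (fun s => _) = (fun s => \int[mu s]_x (x 0 j * x 0 i))).
  by apply: (mf _ 1); [exact: continuous_coordM|exact: coord2_growth].
by apply/funext => s; rewrite mxE.
Qed.

Lemma drift_growth (T : R) : exists2 K : R, 0 <= K &
  forall s x, 0 <= s <= T -> `|drift s x| <= K * (1 + enorm x ^+ 2).
Proof.
have [A A0 hA] := vel_bound T.
exists (d%:R * (2 * (C * A))); first by rewrite !mulr_ge0.
move=> s x sT; rewrite (le_trans (ler_norm_sum _ _ _))//.
rewrite (@le_trans _ _ (\sum_(i < d) (2 * (C * A)) * (1 + enorm x ^+ 2)))//.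
  by apply: ler_sum => i _; exact: (growthM C0 A0 (hC i) (fun x => hA s x i sT)).
by rewrite sumr_const card_ord -[leLHS]mulr_natl mulrA.
Qed.

Lemma drift_continuous s : continuous (drift s).
Proof.
apply: continuous_bigsum => i; apply: continuousM_fun => //.
have -> : (fun x => vel s x i) = (fun x => x 0 i +
    (- m s 0 i + \sum_j (- S s j i) * x 0 j)).
  apply/funext => x; rewrite /vel [(x *m S s) 0 i]mxE -addrA; congr (_ + (_ + _)).
  by rewrite -sumrN; apply: eq_bigr => j _; ring.
apply: continuousD_fun; first exact: coord_continuous.
apply: continuousD_fun; first exact: cst_continuous.
apply: continuous_bigsum => j; apply: continuousM_fun; first exact: cst_continuous.
exact: coord_continuous.
Qed.

End drift.

Lemma grad_bump l (p : 'rV[R]_d -> R) k i : polyfun p ->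
  exists2 q, polyfun q & forall x, grad (bump l p k) x 0 i = bump l q k.+2 x.
Proof.
move=> pp; have [q [pq dq]] := bump_partial l k i pp.
by exists q => // x; rewrite mxE /partial (@derive_val _ _ _ _ _ _ _ (dq x)).
Qed.

(** The equation for [p] is the limit of the one for [p] times the cutoff. Gradients keep a linear
    growth uniform in the cutoff, which allows dominated convergence in space at each fixed time,
    then in time. *)
Lemma mean_field_weak_polyfun (p : 'rV[R]_d -> R) (q : 'I_d -> 'rV[R]_d -> R)
    (Cp Cq : R) : 0 <= Cp -> 0 <= Cq -> polyfun p ->
  (forall i, continuous (q i)) ->
  (forall i x, is_derive x (delta_mx 0 i) p (q i x)) ->
  (forall x, `|p x| <= Cp * (1 + enorm x ^+ 2)) ->
  (forall i x, `|q i x| <= Cq * (1 + enorm x)) ->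
  let G s := \int[mu s]_x drift q s x in
  (forall T : R, lebesgue_measure.-integrable `[0, T] (EFin \o G)) /\
  forall t : R, 0 <= t -> \int[mu t]_x p x =
    \int[mu 0]_x p x + \int[lebesgue_measure]_(s in `[0, t]) G s.
Proof.
move=> Cp0 Cq0 pp cq dq hp hq G.
have mG : measurable_fun Rplus G by exact: (drift_measurable Cq0 cq hq).
pose l n : R := n.+1%:R^-1.
have l0 n : 0 < l n by rewrite invr_gt0.
have l1 n : l n <= 1 by rewrite invf_le1// ler1n.
pose f n x := p x * cutoff (l n) x.
have fE n : f n = bump (l n) (fun x => expR 1 * p x) 0.
  by apply/funext => x; rewrite bump_cutoff.
have pep : polyfun (fun x => expR 1 * p x) by apply: polyfunM => //; exact: polyfun_cst.
pose hn n i x := grad (f n) x 0 i.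
have hnE n i x : hn n i x = q i x * cutoff (l n) x -
    2 * expR 1 * l n * flat 2 (cutoff_arg (l n) x) * p x * x 0 i.
  by rewrite /hn; exact: grad_cutoffM.
(* The 8 is 2 from the derivative of [cutoff_arg], 2! from the bound on [flat 2], and 2 from the
   bound [2 * Cp] on [l |p|]. *)
pose H := Cq + 8 * expR 1 * Cp.
have H0 : 0 <= H by rewrite addr_ge0// !mulr_ge0// expR_ge0.
have chn n i : continuous (hn n i).
  have [q' pq' hq'] := grad_bump (l n) 0 i pep.
  rewrite (_ : hn n i = bump (l n) q' 2); first exact: bump_continuous.
  by apply/funext => x; rewrite /hn fE hq'.
have hnH n i x : `|hn n i x| <= H * (1 + enorm x).
  rewrite hnE (le_trans (ler_normB _ _))// [leRHS]mulrDl; apply: lerD.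
    rewrite normrM (le_trans _ (hq i x))// ler_piMr//.
    by rewrite ger0_norm ?cutoff_ge0// cutoff_le1// ltW.
  (* Off the support the error term is zero; on it [l |x|^2 <= 1] absorbs the quadratic growth of
     [p]. *)
  have [wx|wx] := ltP 0 (cutoff_arg (l n) x); last first.
    rewrite /flat ltNge wx/= mulr0 !mul0r normr0 !mulr_ge0 ?expR_ge0//.
    by rewrite addr_ge0 ?enorm_ge0.
  have lE : l n * enorm x ^+ 2 <= 1 by move: wx; rewrite /cutoff_arg subr_gt0 => /ltW.
  rewrite 2!normrM.
  have -> : `|2 * expR 1 * l n * flat 2 (cutoff_arg (l n) x)| =
      2 * expR 1 * l n * flat 2 (cutoff_arg (l n) x).
    by rewrite ger0_norm// !mulr_ge0 ?expR_ge0 ?flat_ge0// ltW.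
  have f2 : flat 2 (cutoff_arg (l n) x) <= 2 by exact: flat_le.
  have lp : l n * `|p x| <= 2 * Cp.
    rewrite (@le_trans _ _ (l n * (Cp * (1 + enorm x ^+ 2))))//.
      by rewrite ler_wpM2l// ltW.
    rewrite mulrCA mulrC ler_wpM2r// mulrDr mulr1.
    by have := l1 n; lra.
  have -> : 2 * expR 1 * l n * flat 2 (cutoff_arg (l n) x) * `|p x| * `|x 0 i| =
      2 * expR 1 * (flat 2 (cutoff_arg (l n) x) * (l n * `|p x|)) * `|x 0 i| by ring.
  have -> : 8 * expR 1 * Cp * (1 + enorm x) =
      2 * expR 1 * (2 * (2 * Cp)) * (1 + enorm x) by ring.
  have E0 := enorm_ge0 x.
  apply: ler_pM => //.
  - by rewrite !mulr_ge0 ?expR_ge0 ?flat_ge0// ltW.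
  - rewrite ler_wpM2l ?mulr_ge0 ?expR_ge0//.
    by apply: ler_pM; rewrite ?flat_ge0 ?mulr_ge0// ltW.
  - by rewrite (le_trans (coord_le_enorm x i))// lerDr.
pose Gn n s := \int[mu s]_x drift (hn n) s x.
have mGn n : measurable_fun Rplus (Gn n) by exact: (drift_measurable H0 (chn n) (hnH n)).
have mE (g : 'rV[R]_d -> R) : continuous g -> measurable_fun setT g.
  exact: continuous_measurable_rV.
have c1E (K : R) : continuous (fun x : 'rV[R]_d => K * (1 + enorm x ^+ 2)).
  apply: continuousM_fun; first exact: cst_continuous.
  by apply: continuousD_fun; [exact: cst_continuous|exact: continuous_sqr_enorm].
have i1E (K s : R) : 0 <= s ->
    (mu s).-integrable setT (EFin \o (fun x => K * (1 + enorm x ^+ 2))).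
  move=> s0; apply: (@mean_field_integrable _ _ _ _ solmu _ `|K|) => //.
    exact: mE.
  by move=> x; rewrite normrM ler_wpM2l// ger0_norm// addr_ge0// sqr_ge0.
have cvgGn s : 0 <= s -> Gn n s @[n --> \oo] --> G s.
  move=> s0; have ss : 0 <= s <= s by rewrite s0 lexx.
  have [K K0 hK] := drift_growth H0 (hnH 0%N) s.
  have [A A0 hA] := vel_bound s.
  apply: (@dominated_cvg_Rintegral _ _ _ (mu s) setT
    (fun n => drift (hn n) s) _
    (fun x => d%:R * (2 * (H * A)) * (1 + enorm x ^+ 2))) => //.
  - by move=> n; apply: mE; exact: (@drift_continuous _ (chn n) s).
  - move=> x _; apply: cvg_bigsum => i; apply: cvgM; last exact: cvg_cst.
    have -> : q i x = q i x * 1 - 2 * expR 1 * 0 * flat 2 1 * p x * x 0 i by ring.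
    under eq_fun do rewrite hnE.
    have cl : l n @[n --> \oo] --> (0 : R) by exact: cvg_harmonic.
    apply: cvgB.
      by apply: cvgM; [exact: cvg_cst|exact: cvg_cutoff].
    do 2 (apply: cvgM; last exact: cvg_cst).
    apply: cvgM; first by apply: cvgM => //; exact: cvg_cst.
    apply: (@continuous_cvg _ _ _ _ _ (fun n => cutoff_arg (l n) x) (@flat R 2) 1).
      exact: continuous_flat.
    exact: cvg_cutoff_arg.
  - exact: i1E.
  - move=> n x _; rewrite (le_trans (ler_norm_sum _ _ _))//.
    rewrite (@le_trans _ _ (\sum_(i < d) (2 * (H * A)) * (1 + enorm x ^+ 2)))//.
      apply: ler_sum => i _.
      exact: (growthM H0 A0 (hnH n i) (fun x => hA s x i ss)).
    by rewrite sumr_const card_ord -[leLHS]mulr_natl mulrA.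
(* One bound for [G] and all the [Gn n] on a bounded time interval: it dominates the time integrals
   and yields integrability of [G]. *)
have Kbound (T : R) : exists2 K : R, 0 <= K & forall s, 0 <= s <= T ->
    (forall n, `|Gn n s| <= K) /\ `|G s| <= K.
  have [M M0 hM] := mean_field_Rsqr_enorm solmu T.
  have [A A0 hA] := vel_bound T.
  have CqH0 : 0 <= Cq + H by exact: addr_ge0.
  have K0 : 0 <= d%:R * (2 * ((Cq + H) * A)) by rewrite !mulr_ge0.
  have bnd (h : 'I_d -> 'rV[R]_d -> R) C : 0 <= C -> (forall i, continuous (h i)) ->
      (forall i x, `|h i x| <= C * (1 + enorm x)) -> C <= Cq + H ->
      forall s, 0 <= s <= T -> `|\int[mu s]_x drift h s x| <=
        d%:R * (2 * ((Cq + H) * A)) * (1 + M).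
    move=> C0 ch hC CH s sT; have s0 : 0 <= s by case/andP : sT.
    rewrite (@le_trans _ _ (d%:R * (2 * ((Cq + H) * A)) *
      (1 + \int[mu s]_x (enorm x ^+ 2))))//; last first.
      by rewrite ler_wpM2l// lerD2l hM.
    apply: (normr_Rintegral_growth solmu) => //.
      by apply: mE; exact: drift_continuous.
    move=> x; rewrite (le_trans (ler_norm_sum _ _ _))//.
    rewrite (@le_trans _ _ (\sum_(i < d) (2 * ((Cq + H) * A)) * (1 + enorm x ^+ 2)))//.
      apply: ler_sum => i _.
      rewrite (le_trans (growthM C0 A0 (hC i) (fun x => hA s x i sT) x))//.
      by rewrite ler_wpM2r ?addr_ge0 ?sqr_ge0// ler_wpM2l// ler_wpM2r.
    by rewrite sumr_const card_ord -[leLHS]mulr_natl mulrA.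
  exists (d%:R * (2 * ((Cq + H) * A)) * (1 + M)).
    by rewrite mulr_ge0// addr_ge0.
  move=> s sT; split; last by apply: bnd hq _ _ sT => //; rewrite lerDl.
  by move=> n; apply: bnd (hnH n) _ _ sT => //; rewrite lerDr.
have subT (T : R) : `[0, T]%classic `<=` Rplus by exact: subset_itvl.
have icst (T K : R) : lebesgue_measure.-integrable `[0, T] (EFin \o (fun=> K)).
  apply/integrableP; split; first exact/measurable_EFinP/measurable_cst.
  rewrite integral_cst//= lebesgue_measure_itv/=.
  by case: ifP; rewrite ?mule0 ?ltry// -EFinD -EFinM ltry.
split.
  move=> T; have [K K0 hK] := Kbound T.
  apply: (le_integrable _ _ _ (icst T K)) => //.
    by apply/measurable_EFinP; exact: measurable_funS (subT T) mG.
  move=> s /=; rewrite in_itv/= => sT; rewrite lee_fin [leRHS]ger0_norm//.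
  exact: (hK s sT).2.
move=> t t0; have [K K0 hK] := Kbound t.
have [_ _ _ hw] := solmu.
have cvgl : \int[mu t]_x f n x @[n --> \oo] --> \int[mu t]_x p x.
  by apply: (cvg_cutoff_Rintegral solmu t0 _ hp); exact: polyfun_continuous.
have cvg0 : \int[mu 0]_x f n x @[n --> \oo] --> \int[mu 0]_x p x.
  by apply: (cvg_cutoff_Rintegral solmu (lexx 0) _ hp); exact: polyfun_continuous.
have cvgG : \int[lebesgue_measure]_(s in `[0, t]) Gn n s @[n --> \oo] -->
    \int[lebesgue_measure]_(s in `[0, t]) G s.
  apply: (@dominated_cvg_Rintegral _ _ _ (@lebesgue_measure R)
    `[0, t]%classic Gn G (fun=> K)) => //.
  - by move=> n; exact: measurable_funS (subT t) (mGn n).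
  - by move=> s /=; rewrite in_itv/= => /andP[s0 _]; exact: cvgGn.
  - by move=> n s /=; rewrite in_itv/= => /hK[].
have wn n : \int[mu t]_x f n x = \int[mu 0]_x f n x +
    \int[lebesgue_measure]_(s in `[0, t]) Gn n s.
  have tf : test_function (f n) by rewrite fE; exact: bump_test_function.
  rewrite (hw _ tf _ t0); congr (_ + _); apply: eq_Rintegral => s.
  rewrite inE/= in_itv/= => /andP[s0 _]; apply: eq_Rintegral => x _.
  by apply: eq_bigr => i _; rewrite velE.
have cvgS : \int[mu 0]_x f n x + \int[lebesgue_measure]_(s in `[0, t]) Gn n s
    @[n --> \oo] --> \int[mu 0]_x p x + \int[lebesgue_measure]_(s in `[0, t]) G s.
  exact: cvgD cvg0 cvgG.
have fS : (fun n => \int[mu t]_x f n x) = (fun n => \int[mu 0]_x f n x +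
    \int[lebesgue_measure]_(s in `[0, t]) Gn n s) by exact/funext.
by rewrite fS in cvgl; apply: cvg_unique cvgl cvgS.
Qed.

End mean_field_moments.

(** * Time regularity from the integrated equation *)

Section primitive.
Context (R : realType).
Local Notation Rplus := (`[0, +oo[%classic : set R).
Variables (F G : R -> R).
Hypothesis iG : forall T : R, lebesgue_measure.-integrable `[0, T] (EFin \o G).
Hypothesis FG : forall t : R, 0 <= t ->
  F t = F 0 + \int[lebesgue_measure]_(s in `[0, t]) G s.

Lemma primitive_within_continuous : {within Rplus, continuous F}.
Proof.
have cT (T : R) : 0 < T -> {within `[0, T], continuous F}.
  move=> T0.
  have h : {within `[0, T], continuous
      (fun t => F 0 + \int[lebesgue_measure]_(s in `[0, t]) G s)}.
    apply: within_continuousD; first exact: within_continuous_cst.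
    exact: (parameterized_integral_continuous (ltW T0) (iG T)).
  apply: subspace_eq_continuous h.
  by move=> t; rewrite inE/= in_itv/= => /andP[t0 _]; exact/esym/FG.
apply/continuous_within_itvcyP; split.
  move=> t; rewrite in_itv/= andbT => t0.
  have t1 : 0 < t + 1 by rewrite ltr_wpDl// ltW.
  have /(continuous_within_itvP _ t1)[h _ _] := cT _ t1.
  by apply: h; rewrite in_itv/= t0 ltrDl ltr01.
by have /(continuous_within_itvP _ ltr01)[_ h _] := cT 1 ltr01.
Qed.

(** The integral formula is available at nonnegative times only, but a positive [t] has a
    neighbourhood of such times, so [F] has the derivative of the primitive. *)
Lemma primitive_is_derive (t : R) : 0 < t -> {for t, continuous G} ->
  is_derive t 1 F (G t).
Proof.
move=> t0 cG; have tt1 : t < t + 1 by rewrite ltrDl.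
have [dP dPE] := continuous_FTC1_closed tt1 (iG (t + 1)) t0 cG.
have hP : is_derive t 1 (fun t => \int[lebesgue_measure]_(s in `[0, t]) G s) (G t).
  by split => //; rewrite -derive1E.
have h := is_deriveD (is_derive_cst (F 0) t 1) hP; rewrite add0r in h.
apply: near_eq_is_derive h; near=> s; apply/esym/FG.
by apply: ltW; near: s; exact: lt_nbhsr.
Unshelve. all: by end_near. Qed.

Lemma within_continuous_at (f : R -> R) (t : R) : {within Rplus, continuous f} ->
  0 < t -> {for t, continuous f}.
Proof.
move=> /continuous_within_itvcyP[h _] t0; apply: h.
by rewrite in_itv/= t0.
Qed.

End primitive.

Section mean_field_moment_flow.
Context (R : realType) (d : nat).
Variables (mu0 : probability 'rV[R]_d R) (mu : R -> probability 'rV[R]_d R).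
Hypothesis solmu :
  mean_field_solution (@gaussian_potential R d) (@K2 R d) mu0 mu.
Local Notation Rplus := (`[0, +oo[%classic : set R).
Local Notation m s := (mean (mu s)).
Local Notation S s := (second_moment (mu s)).

Let mu1 t : mu t setT = 1%E. Proof. exact: probability_setT. Qed.

(** [q1] and [q2] are the gradients, indexed by [k], of the monomials [x_i] and [x_i x_j]. *)
Let q1 (i k : 'I_d) (x : 'rV[R]_d) : R := (k == i)%:R.

Let q2 (i j k : 'I_d) (x : 'rV[R]_d) : R := (k == i)%:R * x 0 j + (k == j)%:R * x 0 i.

Let bool_le1 (b : bool) : `|b%:R| <= 1 :> R.
Proof. by case: b; rewrite ?normr1 ?normr0. Qed.

Let q1_le i k x : `|q1 i k x| <= 1 * (1 + enorm x).
Proof. by rewrite mul1r (le_trans (bool_le1 _))// lerDl enorm_ge0. Qed.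

Let q2_le i j k x : `|q2 i j k x| <= 2 * (1 + enorm x).
Proof.
have b (c : bool) l : `|c%:R * x 0 l| <= 1 + enorm x.
  rewrite normrM -[leRHS]mul1r ler_pM// (le_trans (coord_le_enorm x l))//.
  by rewrite lerDr.
by rewrite (le_trans (ler_normD _ _))// [leRHS]mulr_natl mulr2n lerD.
Qed.

Let cq1 i k : continuous (q1 i k).
Proof. exact: cst_continuous. Qed.

Let cq2 i j k : continuous (q2 i j k).
Proof.
by apply: continuousD_fun; apply: continuousM_fun;
  [exact: cst_continuous|exact: coord_continuous|
   exact: cst_continuous|exact: coord_continuous].
Qed.

Let ic s i : 0 <= s -> (mu s).-integrable setT (EFin \o (fun x : 'rV[R]_d => x 0 i)).
Proof. by move=> s0; exact: (integrable_coord (mu1 s) (mean_field_sqr_enorm solmu s0) i). Qed.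

Let ic2 s i j : 0 <= s ->
  (mu s).-integrable setT (EFin \o (fun x : 'rV[R]_d => x 0 i * x 0 j)).
Proof. by move=> s0; exact: (integrable_coord2 (mu1 s) (mean_field_sqr_enorm solmu s0) i j). Qed.

Let drift1 i s : 0 <= s -> \int[mu s]_x drift mu (q1 i) s x = (- (m s *m S s)) 0 i.
Proof.
move=> s0; rewrite (drift_integralE solmu (C := 1) _ (@cq1 i) (q1_le i))//.
rewrite (bigD1 i)//= [X in _ + X]big1 ?addr0 => [|k /negPf ki]; last first.
  have z (f : 'rV[R]_d -> R) : \int[mu s]_x (q1 i k x * f x) = 0.
    by under eq_Rintegral do rewrite /q1 ki mul0r; rewrite Rintegral_cst// mul0r.
  have -> : \int[mu s]_x q1 i k x = 0.
    by under eq_Rintegral do rewrite /q1 ki; rewrite Rintegral_cst// mul0r.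
  by rewrite z mulr0 subr0 big1 ?subr0// => l _; rewrite z mulr0.
have e (f : 'rV[R]_d -> R) : \int[mu s]_x (q1 i i x * f x) = \int[mu s]_x f x.
  by apply: eq_Rintegral => x _; rewrite /q1 eqxx mul1r.
have -> : \int[mu s]_x q1 i i x = 1.
  rewrite -[RHS](Rintegral_cst1 (mu1 s)).
  by apply: eq_Rintegral => x _; rewrite /q1 eqxx.
rewrite e mulr1 [m s 0 i]mxE subrr sub0r !mxE; congr (- _).
by apply: eq_bigr => l _; rewrite e !mxE mulrC.
Qed.

Let drift2 i j s : 0 <= s -> \int[mu s]_x drift mu (q2 i j) s x =
  (2 *: (S s - S s *m S s - (m s)^T *m m s)) i j.
Proof.
move=> s0; rewrite (drift_integralE solmu (C := 2) _ (@cq2 i j) (q2_le i j))//.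
have E1 k : \int[mu s]_x q2 i j k x = (k == i)%:R * m s 0 j + (k == j)%:R * m s 0 i.
  rewrite RintegralD//; [|by apply: integrable_RZ => //; exact: ic..].
  by rewrite !RintegralZl//; [rewrite !mxE|exact: ic..].
have E2 k l : \int[mu s]_x (q2 i j k x * x 0 l) =
    (k == i)%:R * S s j l + (k == j)%:R * S s i l.
  have -> : \int[mu s]_x (q2 i j k x * x 0 l) =
      \int[mu s]_x ((k == i)%:R * (x 0 j * x 0 l) + (k == j)%:R * (x 0 i * x 0 l)).
    by apply: eq_Rintegral => x _; rewrite /q2 mulrDl !mulrA.
  rewrite RintegralD//; [|by apply: integrable_RZ => //; exact: ic2..].
  by rewrite !RintegralZl//; [rewrite !mxE|exact: ic2..].
have sS : (S s)^T = S s.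
  apply/matrixP => a b; rewrite !mxE.
  by apply: eq_Rintegral => x _; rewrite mulrC.
have pick (a : 'I_d) (f : 'I_d -> R) : \sum_k (k == a)%:R * f k = f a.
  rewrite (bigD1 a)//= big1 ?addr0 ?eqxx ?mul1r// => k /negPf ->.
  by rewrite mul0r.
have SS a b : \sum_l S s l a * S s b l = (S s *m S s) b a.
  by rewrite [RHS]mxE; apply: eq_bigr => l _; rewrite mulrC.
transitivity (\sum_k ((k == i)%:R * (S s j k - m s 0 k * m s 0 j - (S s *m S s) j k)
    + (k == j)%:R * (S s i k - m s 0 k * m s 0 i - (S s *m S s) i k))).
  apply: eq_bigr => k _; rewrite E1 E2.
  have -> : \sum_l S s l k * \int[mu s]_x (q2 i j k x * x 0 l) =
      (k == i)%:R * (S s *m S s) j k + (k == j)%:R * (S s *m S s) i k.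
    rewrite -!SS !mulr_sumr -big_split/=; apply: eq_bigr => l _.
    by rewrite E2; ring.
  ring.
rewrite big_split/= !pick.
have -> : S s j i = S s i j by rewrite -[in LHS]sS mxE.
have -> : (S s *m S s) j i = (S s *m S s) i j.
  by rewrite -[in LHS]sS -trmx_mul mxE.
move: (S s) (m s) => A b; rewrite !mxE big_ord1 !mxE; ring.
Qed.

(** A bootstrap: the integrated equations make the moments continuous; their right-hand sides are
    polynomial in the moments, hence continuous too; the fundamental theorem of calculus then gives
    the derivatives. *)
Lemma mean_field_moment_flow :
  moment_flow (fun t => m t) (fun t => S t).
Proof.
pose dm i s := (- (m s *m S s)) 0 i.
pose dS i j s := (2 *: (S s - S s *m S s - (m s)^T *m m s)) i j.
(* Drift integrals are computed at nonnegative times only, which suffices under integrals over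
   bounded intervals starting at 0. *)
have eqG (G G' : R -> R) : (forall s, 0 <= s -> G s = G' s) ->
    (forall T : R, lebesgue_measure.-integrable `[0, T] (EFin \o G)) ->
    (forall T : R, lebesgue_measure.-integrable `[0, T] (EFin \o G')) /\
    (forall t : R, \int[lebesgue_measure]_(s in `[0, t]) G s =
       \int[lebesgue_measure]_(s in `[0, t]) G' s).
  move=> GG' iG; have e (T s : R) : s \in `[0, T]%classic -> G s = G' s.
    by rewrite inE/= in_itv/= => /andP[s0 _]; exact: GG'.
  split=> [T|t]; last by apply: eq_Rintegral => s; exact: e.
  apply: eq_integrable (iG T) => // s sT.
  by rewrite /= (e T).
have Fm i : (forall T : R, lebesgue_measure.-integrable `[0, T] (EFin \o dm i)) /\
    (forall t : R, 0 <= t -> m t 0 i = m 0 0 i +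
       \int[lebesgue_measure]_(s in `[0, t]) dm i s).
  have [||iG hG] := mean_field_weak_polyfun solmu (p := fun x => x 0 i)
    ler01 ler01 (polyfun_coord _ i) (@cq1 i) _ _ (q1_le i).
  - move=> k x; have := is_derive_coord x (delta_mx 0 k) i.
    by rewrite mxE eqxx/= eq_sym.
  - by move=> x; rewrite mul1r coord_le_norm.
  have [iG' GG'] := eqG _ _ (drift1 i) iG.
  split => // t t0; rewrite !mxE hG// GG'; reflexivity.
have FS i j : (forall T : R, lebesgue_measure.-integrable `[0, T] (EFin \o dS i j)) /\
    (forall t : R, 0 <= t -> S t i j = S 0 i j +
       \int[lebesgue_measure]_(s in `[0, t]) dS i j s).
  have [||iG hG] := mean_field_weak_polyfun solmu (p := fun x => x 0 i * x 0 j)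
    ler01 (ler0n R 2) (polyfunM (polyfun_coord _ i) (polyfun_coord _ j))
    (@cq2 i j) _ _ (q2_le i j).
  - move=> k x; apply: (is_derive_eq (is_derive_mul (is_derive_coord x (delta_mx 0 k) i)
      (is_derive_coord x (delta_mx 0 k) j))).
    by rewrite !mxE eqxx/= /q2 [i == k]eq_sym [j == k]eq_sym; ring.
  - exact: coord2_growth.
  have [iG' GG'] := eqG _ _ (drift2 i j) iG.
  by split => // t t0; rewrite ![S _ i j]mxE hG// GG'.
have cm : mx_continuous (fun t => m t).
  move=> i j; rewrite ord1; have [iG hG] := Fm j.
  exact: (primitive_within_continuous iG hG).
have cS : mx_continuous (fun t => S t).
  move=> i j; have [iG hG] := FS i j.
  exact: (primitive_within_continuous iG hG).
have cmS := mx_continuous_mul cm cS.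
split => //.
- move=> t t0 i j; rewrite ord1; have [iG hG] := Fm j.
  apply: (primitive_is_derive iG hG t0); apply: within_continuous_at => //.
  rewrite (_ : dm j = fun s => -1 * (m s *m S s) 0 j); last first.
    by apply/funext => s; rewrite /dm mxE mulN1r.
  by apply: within_continuousM; [exact: within_continuous_cst|exact: cmS].
- move=> t t0 i j; have [iG hG] := FS i j.
  apply: (primitive_is_derive iG hG t0); apply: within_continuous_at => //.
  have h := mx_continuousB (mx_continuousB cS (mx_continuous_mul cS cS))
    (mx_continuous_mul (mx_continuous_tr cm) cm).
  rewrite (_ : dS i j = fun s => 2 * (S s - S s *m S s - (m s)^T *m m s) i j).
    by apply: within_continuousM; [exact: within_continuous_cst|exact: h].
  by apply/funext => s; rewrite /dS mxE.
Qed.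

End mean_field_moment_flow.

(** * Variance of empirical averages and the theorem *)

Section iid_variance.
Context (disp : measure_display) (Omega : measurableType disp) (R : realType).
Context (d N : nat) (P : probability Omega R).
Variables (Y : 'I_N -> {mfun Omega >-> 'rV[R]_d}) (law : probability 'rV[R]_d R).
Hypothesis iidY : iid_with_law P Y law.

Lemma ge0_integral_iid k (f : 'rV[R]_d -> \bar R) : measurable_fun setT f ->
  (forall y, 0 <= f y)%E -> (\int[P]_w f (Y k w) = \int[law]_y f y)%E.
Proof.
move=> mf f0; rewrite -(@ge0_integral_distribution _ _ _ _ _ P (Y k) _ mf f0).
by apply: eq_measure_integral => A mA _; exact: iidY.1.
Qed.

Lemma integrable_iid k (f : 'rV[R]_d -> R) : law.-integrable setT (EFin \o f) ->
  P.-integrable setT (EFin \o (fun w => f (Y k w))).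
Proof.
move=> /integrableP[mf foo]; apply/integrableP; split.
  exact: (measurableT_comp mf).
rewrite (ge0_integral_iid k (f := fun y => `|(f y)%:E|%E))//.
exact: measurableT_comp.
Qed.

Lemma Rintegral_iid k (f : 'rV[R]_d -> R) : law.-integrable setT (EFin \o f) ->
  \int[P]_w f (Y k w) = \int[law]_y f y.
Proof.
move=> fi; rewrite /Rintegral; congr fine.
have mf : measurable_fun setT (EFin \o f) by case/integrableP : fi.
transitivity (\int[distribution P (Y k)]_y (EFin \o f) y)%E.
  by rewrite (@integral_distribution _ _ _ _ _ P (Y k) _ mf)//; exact: (integrable_iid k fi).
by apply: eq_measure_integral => A mA _; exact: iidY.1.
Qed.

(** Independence is stated for [N] events at once. Taking the whole space at the other indices gives
    the joint law of the pair on rectangles, hence the product measure by uniqueness, and Fubini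
    separates the factors. *)
Lemma Rintegral_iid_mul k l (f g : 'rV[R]_d -> R) : k != l ->
  law.-integrable setT (EFin \o f) -> law.-integrable setT (EFin \o g) ->
  P.-integrable setT (EFin \o (fun w => f (Y k w) * g (Y l w))) ->
  \int[P]_w (f (Y k w) * g (Y l w)) = (\int[law]_y f y) * (\int[law]_y g y).
Proof.
move=> kl fi gi fgi.
have mf : measurable_fun setT f by case/integrableP : fi => /measurable_EFinP.
have mg : measurable_fun setT g by case/integrableP : gi => /measurable_EFinP.
have mZ : measurable_fun setT (fun w => (Y k w, Y l w)) by exact: measurable_fun_pair.
pose Z : {mfun Omega >-> ('rV[R]_d * 'rV[R]_d)%type} :=
  HB.pack (fun w => (Y k w, Y l w)) (isMeasurableFun.Build _ _ _ _ _ mZ).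
pose phi (z : 'rV[R]_d * 'rV[R]_d) : \bar R := (f z.1 * g z.2)%:E.
have mphi : measurable_fun setT phi.
  apply/measurable_EFinP; apply: measurable_funM.
    exact: measurableT_comp mf measurable_fst.
  exact: measurableT_comp mg measurable_snd.
have joint A B : measurable A -> measurable B ->
    distribution P Z (A `*` B) = (law A * law B)%E.
  move=> mA mB.
  pose E i := if i == k then A else if i == l then B else setT.
  have mE i : measurable (E i) by rewrite /E; case: ifP => // _; case: ifP.
  have -> : distribution P Z (A `*` B) = P (\bigcap_i (Y i @^-1` E i)).
    congr (P _); apply/seteqP; split=> [w [Aw Bw] i _|w h].
      rewrite /= /E; case: eqVneq => [->//|_]; case: eqVneq => [->//|_]; exact: I.
    split; first by have := h k I; rewrite /= /E eqxx.
    by have := h l I; rewrite /= /E eq_sym (negPf kl) eqxx.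
  rewrite iidY.2// (bigD1 k)//= (bigD1 l) 1?eq_sym//= big1 => [|i /andP[ik il]].
    rewrite mule1 /E eqxx eq_sym (negPf kl) eqxx.
    by rewrite -[P (Y k @^-1` _)]/(distribution P (Y k) A)
      -[P (Y l @^-1` _)]/(distribution P (Y l) B) !iidY.1.
  by rewrite /E (negPf ik) (negPf il) preimage_setT probability_setT.
have Zlaw : (\int[P]_w phi (Z w) = \int[law \x law]_z phi z)%E.
  rewrite -[LHS](@integral_distribution _ _ _ _ _ P Z _ mphi)//.
  apply: eq_measure_integral => X mX _; symmetry.
  exact: (product_measure_unique joint).
have phii : (law \x law)%E.-integrable setT phi.
  apply/integrableP; split => //.
  have -> : (\int[law \x law]_z `|phi z| = \int[P]_w `|phi (Z w)|)%E.
    rewrite -[RHS](@ge0_integral_distribution _ _ _ _ _ P Z (fun z => `|phi z|%E))//.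
      apply: eq_measure_integral => X mX _.
      exact: (product_measure_unique joint).
    exact: measurableT_comp.
  by case/integrableP : fgi.
have -> : \int[P]_w (f (Y k w) * g (Y l w)) = fine (\int[law \x law]_z phi z)%E.
  by rewrite -Zlaw.
rewrite -integral12_prod_meas1// /Rintegral.
have -> : (\int[law]_x (\int[law]_y phi (x, y)) =
    \int[law]_x ((fine (\int[law]_y (g y)%:E)) * f x)%:E)%E.
  apply: eq_integral => x _; rewrite /phi/=.
  under eq_integral do rewrite EFinM.
  rewrite integralZl//= EFinM fineK ?integrable_fin_num// muleC; reflexivity.
have -> : (\int[law]_x ((fine (\int[law]_y (g y)%:E)) * f x)%:E =
    (fine (\int[law]_y (g y)%:E))%:E * \int[law]_x (f x)%:E)%E.
  by rewrite -integralZl.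
by rewrite fineM ?integrable_fin_num// mulrC.
Qed.

(** After centering, the squared average is a double sum whose off-diagonal terms have zero mean by
    independence; each of the [N] diagonal terms is a variance, at most the second moment. *)
Lemma iid_variance_le (g : 'rV[R]_d -> R) (K : R) : (0 < N)%N ->
  measurable_fun setT g -> law.-integrable setT (EFin \o g) ->
  law.-integrable setT (EFin \o (fun y => g y ^+ 2)) ->
  \int[law]_y (g y ^+ 2) <= K ->
  (\int[P]_w ((N%:R^-1 * (\sum_k g (Y k w)) - \int[law]_y g y) ^+ 2)%:E
    <= (K * N%:R^-1)%:E)%E.
Proof.
move=> N0 mg gi g2i gK; set c := \int[law]_y g y.
have NN : N%:R != 0 :> R by rewrite pnatr_eq0 -lt0n.
have law1 : law setT = 1%E by exact: probability_setT.
have icst (a : R) : law.-integrable setT (EFin \o (fun=> a)).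
  exact: integrable_cst1 law1 a.
pose h y := g y - c.
have mh : measurable_fun setT h by exact: measurable_funB.
have hi : law.-integrable setT (EFin \o h) by exact: integrable_RB.
have h0 : \int[law]_y h y = 0.
  by rewrite RintegralB// (Rintegral_cst1 law1) subrr.
have h2E y : h y ^+ 2 = g y ^+ 2 - 2 * c * g y + c ^+ 2.
  by rewrite /h; ring.
have cgi : law.-integrable setT (EFin \o (fun y => 2 * c * g y)).
  exact: integrable_RZ.
have gci : law.-integrable setT (EFin \o (fun y => g y ^+ 2 - 2 * c * g y)).
  exact: integrable_RB.
have h2i : law.-integrable setT (EFin \o (fun y => h y ^+ 2)).
  by under eq_fun do rewrite h2E; exact: integrable_RD.
have h2K : \int[law]_y (h y ^+ 2) <= K.
  under eq_Rintegral do rewrite h2E.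
  rewrite RintegralD// RintegralB// RintegralZl// (Rintegral_cst1 law1) -/c.
  have := sqr_ge0 c; rewrite !expr2; lra.
have mhY k : measurable_fun setT (fun w => h (Y k w)) by exact: measurableT_comp.
(* Products are dominated by the sum of the two squares, which needs no independence. *)
have hhi k l : P.-integrable setT (EFin \o (fun w => h (Y k w) * h (Y l w))).
  apply: (le_integrable measurableT _ _ (integrable_RD measurableT
     (integrable_iid k h2i) (integrable_iid l h2i))).
    by apply/measurable_EFinP; exact: measurable_funM.
  move=> w _ /=; rewrite lee_fin [leRHS]ger0_norm ?addr_ge0 ?sqr_ge0//.
  rewrite ler_norml; have := sqr_ge0 (h (Y k w) - h (Y l w)).
  have := sqr_ge0 (h (Y k w) + h (Y l w)); move: (h _) (h _) => a b.
  have := sqr_ge0 a; have := sqr_ge0 b.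
  by rewrite !expr2 => *; apply/andP; split; nra.
have sqE w : (N%:R^-1 * (\sum_k g (Y k w)) - c) ^+ 2 =
    N%:R^-1 ^+ 2 * \sum_k \sum_l h (Y k w) * h (Y l w).
  have -> : N%:R^-1 * (\sum_k g (Y k w)) - c = N%:R^-1 * \sum_k h (Y k w).
    rewrite sumrB mulrBr sumr_const card_ord -[c *+ N]mulr_natl mulrA mulVf//.
    by rewrite mul1r.
  by rewrite exprMn [X in _ * X]expr2 big_distrlr.
have si : P.-integrable setT
    (EFin \o (fun w => \sum_k \sum_l h (Y k w) * h (Y l w))).
  by apply: integrable_Rsum => // k; apply: integrable_Rsum.
under eq_integral do rewrite sqE.
have -> : (\int[P]_w (N%:R^-1 ^+ 2 * \sum_k \sum_l h (Y k w) * h (Y l w))%:E =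
    (\int[P]_w (N%:R^-1 ^+ 2 * \sum_k \sum_l h (Y k w) * h (Y l w)))%:E)%E.
  rewrite /Rintegral fineK// integrable_fin_num//.
  exact: integrable_RZ.
rewrite lee_fin RintegralZl// Rintegral_sum//; last first.
  by move=> k; exact: integrable_Rsum.
have diag k : \int[P]_w (\sum_l h (Y k w) * h (Y l w)) = \int[law]_y (h y ^+ 2).
  rewrite Rintegral_sum// (bigD1 k)//= big1 ?addr0 => [|l lk].
    under eq_Rintegral do rewrite -expr2.
    exact: (Rintegral_iid k h2i).
  by rewrite (@Rintegral_iid_mul k l h h) 1?eq_sym// h0 mul0r.
under eq_bigr do rewrite diag.
rewrite sumr_const card_ord; move: (\int[law]_y _) h2K => I IK.
have -> : N%:R^-1 ^+ 2 * (I *+ N) = I * N%:R^-1.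
  by rewrite -[I *+ N]mulr_natl; field.
by rewrite ler_wpM2r// invr_ge0.
Qed.

End iid_variance.

(** The integral of a nonnegative function is a supremum over simple functions below it, so
    monotonicity needs no measurability. This matters for a supremum over uncountably many times. *)
Lemma ge0_le_integral_any (disp : measure_display) (T : measurableType disp)
    (R : realType) (mu : {measure set T -> \bar R}) (f g : T -> \bar R) :
  (forall x, 0 <= f x)%E -> (forall x, f x <= g x)%E ->
  (\int[mu]_x f x <= \int[mu]_x g x)%E.
Proof.
move=> f0 fg; have g0 x : (0 <= g x)%E by exact: le_trans (f0 x) (fg x).
rewrite !ge0_integralTE//; apply: ereal_sup_le => _ [h hf <-].
by exists h => // x; exact: le_trans (hf x) (fg x).
Qed.

(** * Consequences of the hypotheses on the initial law *)

Section initial_law.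
Context (R : realType) (d : nat) (rho : probability 'rV[R]_d R).
Hypothesis rho2 : (\int[rho]_x (enorm x ^+ 2)%:E < +oo)%E.

Let rho1 : rho setT = 1%E. Proof. exact: probability_setT. Qed.

(** Square integrability makes the extended-real covariance finite, so [fine] loses nothing and the
    bound on [cov_mx] becomes one on moments. *)
Lemma cov_mxE : cov_mx rho = covariance_mx (mean rho) (second_moment rho).
Proof.
apply/matrixP => i j; rewrite mxE covarianceE; first last.
- by apply/Lfun1_integrable; exact: (integrable_coord2 rho1 rho2 i j).
- by apply/Lfun1_integrable; exact: (integrable_coord rho1 rho2 j).
- by apply/Lfun1_integrable; exact: (integrable_coord rho1 rho2 i).
have iE k : (\int[rho]_y (y 0 k)%:E)%E \is a fin_num.
  exact: (integrable_fin_num measurableT (integrable_coord rho1 rho2 k)).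
have i2E k l : (\int[rho]_y (y 0 k * y 0 l)%:E)%E \is a fin_num.
  exact: (integrable_fin_num measurableT (integrable_coord2 rho1 rho2 k l)).
have E1 k : expectation rho (fun y : 'rV[R]_d => y 0 k) = (mean rho 0 k)%:E.
  by rewrite unlock mxE /Rintegral fineK.
have E2 : expectation rho ((fun y : 'rV[R]_d => y 0 i) * (fun y => y 0 j)) =
    (second_moment rho i j)%:E.
  by rewrite unlock mxE /Rintegral fineK.
rewrite E2 !E1 -EFinM -EFinB /= /covariance_mx.
by move: (mean rho) (second_moment rho) => m S; rewrite !mxE big_ord1 !mxE.
Qed.

Lemma trace_second_moment : \tr (second_moment rho) = \int[rho]_x (enorm x ^+ 2).
Proof.
under eq_Rintegral do rewrite sqr_enorm mxdotE big_ord1.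
rewrite Rintegral_sum//; last by move=> i; exact: (integrable_coord2 rho1 rho2).
by apply: eq_bigr => i _; rewrite mxE.
Qed.

End initial_law.

Section exponential_moment.
Context (R : realType) (d : nat) (rho : probability 'rV[R]_d R) (alpha : R).
Hypothesis alpha0 : 0 < alpha.
Hypothesis exp_lty : (\int[rho]_y (expR (alpha * enorm y ^+ 2))%:E < +oo)%E.

Let M : R := fine (\int[rho]_y (expR (alpha * enorm y ^+ 2))%:E).

Let rho1 : rho setT = 1%E. Proof. exact: probability_setT. Qed.

Lemma integrable_exp_moment :
  rho.-integrable setT (EFin \o (fun y => expR (alpha * enorm y ^+ 2))).
Proof.
apply/integrableP; split.
  apply/measurable_EFinP; apply: measurableT_comp => //.
  apply: continuous_measurable_rV; apply: continuousM_fun.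
    exact: cst_continuous.
  exact: continuous_sqr_enorm.
rewrite (le_lt_trans _ exp_lty)// le_eqVlt; apply/orP; left; apply/eqP.
by apply: eq_integral => y _; rewrite /= ger0_norm// expR_ge0.
Qed.

(* [(alpha r)^(k+1) <= (k+1)! e^(alpha r)] *)
Lemma exp_moment_bound k (f : 'rV[R]_d -> R) : measurable_fun setT f ->
  (forall y, `|f y| <= (enorm y ^+ 2) ^+ k.+1) ->
  rho.-integrable setT (EFin \o f) /\
  \int[rho]_y f y <= k.+1`!%:R / alpha ^+ k.+1 * M.
Proof.
move=> mf hf; set c := k.+1`!%:R / alpha ^+ k.+1.
have c0 : 0 <= c by rewrite divr_ge0// exprn_ge0// ltW.
have fe y : `|f y| <= c * expR (alpha * enorm y ^+ 2).
  rewrite (le_trans (hf y))// /c mulrAC ler_pdivlMr ?exprn_gt0//.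
  rewrite -exprMn [_ ^+ 2 * alpha]mulrC [leRHS]mulrC -ler_pdivrMr ?ltr0n ?fact_gt0//.
  by rewrite (le_trans _ (expR_ge1Dxn k _)) ?lerDr// mulr_ge0 ?sqr_ge0// ltW.
have ie := integrable_RZ c measurableT integrable_exp_moment.
have fi : rho.-integrable setT (EFin \o f).
  apply: (le_integrable measurableT _ _ ie); first exact/measurable_EFinP.
  move=> y _ /=; rewrite lee_fin (le_trans (fe y))//.
  by rewrite ler_norm.
split=> //; rewrite -[M]/(\int[rho]_y (expR (alpha * enorm y ^+ 2))).
rewrite -RintegralZl//; last exact: integrable_exp_moment.
by apply: le_Rintegral => // y _; rewrite (le_trans (ler_norm _)).
Qed.

Lemma sqr_enorm_lty : (\int[rho]_x (enorm x ^+ 2)%:E < +oo)%E.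
Proof.
have [||i _] := @exp_moment_bound 0 (fun x => enorm x ^+ 2).
- by apply: continuous_measurable_rV; exact: continuous_sqr_enorm.
- by move=> y; rewrite expr1 ger0_norm// sqr_ge0.
exact: (integrable_lty measurableT i).
Qed.

End exponential_moment.

(** * Choice of the constant and proof of the theorem *)

Definition stable_with (R : realType) (d : nat) (c0 K C : R) :=
  forall (m mb : R -> 'rV[R]_d) (S Sb : R -> 'M[R]_d),
    moment_flow m S -> moment_flow mb Sb ->
    (forall t : R, 0 <= t -> psd (covariance_mx (m t) (S t))) ->
    (forall t : R, 0 <= t -> psd (covariance_mx (mb t) (Sb t))) ->
    (forall u : 'rV[R]_d,
      c0 * mxdot u u <= mxdot (u *m covariance_mx (mb 0) (Sb 0)) u) ->
    \tr (Sb 0) <= K ->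
    forall t : R, 0 <= t -> moment_dist2 (m t) (mb t) (S t) (Sb t) <=
      C * moment_dist2 (m 0) (mb 0) (S 0) (Sb 0).

(** The final constant is quantified before all the data; choice turns the existence in
    [moment_flow_stable] into a function of [d], [c0] and [K]. *)
Lemma stability_constant (R : realType) :
  exists C : nat -> R -> R -> R, forall d c0 K, 0 < c0 -> 0 <= K ->
  0 <= C d c0 K /\ stable_with d c0 K (C d c0 K).
Proof.
have h (a : nat * R * R) : exists C : R, 0 < a.1.2 -> 0 <= a.2 ->
    0 <= C /\ stable_with a.1.1 a.1.2 a.2 C.
  case: a => [[d c0] K] /=.
  (* Outside the admissible range the value is the default 0. *)
  have [c00|c00] := pselect (0 < c0); last by exists 0 => /c00.
  have [K0|K0] := pselect (0 <= K); last by exists 0 => _ /K0.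
  by have [C C0 hC] := moment_flow_stable d c00 K0; exists C.
have [C hC] := choice h.
by exists (fun d c0 K => C (d, c0, K)) => d c0 K; exact: (hC (d, c0, K)).
Qed.

Theorem proposition5p8 (R : realType) :
  exists C : nat -> R -> R -> R -> R,
  forall (d : nat) (alpha c0 : R) (mu0 : probability 'rV[R]_d R)
    (mu : R -> probability 'rV[R]_d R)
    (N : nat) (disp : measure_display) (Omega : measurableType disp)
    (P : probability Omega R)
    (Y : 'I_N -> R -> {mfun Omega >-> 'rV[R]_d}),
  (0 < d)%N -> (0 < N)%N -> 0 < alpha -> 0 < c0 ->
  (\int[mu0]_y (expR (alpha * enorm y ^+ 2))%:E < +oo)%E ->
  loewner_ge (cov_mx mu0) c0%:M ->
  iid_with_law P (fun i => Y i 0) mu0 ->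
  mean_field_solution (@gaussian_potential R d) (@K2 R d) mu0 mu ->
  (forall w, particle_solution (@gaussian_potential R d) (@K2 R d)
     (fun i t => Y i t w)) ->
  let muN w t := empirical (fun i => Y i t w) in
  (\int[P]_w ereal_sup
     [set (D2 (mean (muN w t), second_moment (muN w t))
              (mean (mu t), second_moment (mu t)) ^+ 2)%:E | t in `[0%R, +oo[]
   <= (C d c0 alpha (fine (\int[mu0]_y (expR (alpha * enorm y ^+ 2))%:E))
       * N%:R^-1)%:E)%E.
Proof.
have [C0 hC0] := stability_constant R.
(* [b1] and [b2] bound the second and fourth moments of the norm through the exponential moment;
   [b1] is also the trace bound [K]. *)
pose b1 (alpha M : R) : R := 1`!%:R / alpha ^+ 1 * M.
pose b2 (alpha M : R) : R := 2`!%:R / alpha ^+ 2 * M.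
(* The 2 comes from comparing [moment_dist2] with the squared [D2]; the [d] first moments and the
   [d^2] second moments contribute one variance each. *)
exists (fun d c0 alpha M => 2 * C0 d c0 (b1 alpha M) *
  (d%:R * b1 alpha M + (d * d)%:R * b2 alpha M)).
move=> d alpha c0 mu0 mu N disp Omega P Y _ N0 alpha0 c00 expM cov0 iidY solmu solY; cbv zeta.
pose muN w t := empirical (fun i => Y i t w).
set M := fine _.
have M0 : 0 <= M.
  by rewrite fine_ge0//; apply: integral_ge0 => y _; rewrite lee_fin expR_ge0.
have e2 := sqr_enorm_lty alpha0 expM.
have mu01 : mu0 setT = 1%E by exact: probability_setT.
have [h0 _ _ _] := solmu.
have mu00 (f : 'rV[R]_d -> R) : \int[mu 0]_x f x = \int[mu0]_x f x.
  by rewrite /Rintegral; congr fine; apply: eq_measure_integral => A mA _; exact: h0.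
have mE : mean (mu 0) = mean mu0 by apply/rowP => i; rewrite !mxE mu00.
have SE : second_moment (mu 0) = second_moment mu0.
  by apply/matrixP => i j; rewrite !mxE mu00.
have m2 : measurable_fun setT (fun x : 'rV[R]_d => enorm x ^+ 2).
  by apply: continuous_measurable_rV; exact: continuous_sqr_enorm.
have b10 : 0 <= b1 alpha M by rewrite mulr_ge0// divr_ge0// exprn_ge0// ltW.
have trK : \tr (second_moment (mu 0)) <= b1 alpha M.
  rewrite SE trace_second_moment//.
  have [||_ //] := @exp_moment_bound _ _ _ _ alpha0 expM 0 (fun x => enorm x ^+ 2).
    exact: m2.
  by move=> y; rewrite expr1 ger0_norm// sqr_ge0.
have [C0ge hC] := hC0 d c0 (b1 alpha M) c00 b10.
set C := C0 d c0 (b1 alpha M) in C0ge hC *.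
have nondeg (u : 'rV[R]_d) :
    c0 * mxdot u u <= mxdot (u *m covariance_mx (mean (mu 0)) (second_moment (mu 0))) u.
  rewrite mE SE -cov_mxE//; have /psdP[_ /(_ u)] := cov0.
  by rewrite mulmxBr mul_mx_scalar !mxdot_lin subr_ge0.
have flowN w : moment_flow (fun t => mean (muN w t)) (fun t => second_moment (muN w t)).
  exact: particle_moment_flow N0 (solY w).
have psdN w (t : R) : 0 <= t -> psd (covariance_mx (mean (muN w t)) (second_moment (muN w t))).
  by move=> _; apply: psd_covariance_mx; [exact: empirical_setT|exact: empirical_sqr_enorm].
have psdmu (t : R) : 0 <= t -> psd (covariance_mx (mean (mu t)) (second_moment (mu t))).
  move=> t0; apply: psd_covariance_mx; first exact: probability_setT.
  exact: (mean_field_sqr_enorm solmu t0).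
have stab w := hC _ _ _ _ (flowN w) (mean_field_moment_flow solmu) (psdN w) psdmu nondeg trK.
pose D0 w := D2 (mean (muN w 0), second_moment (muN w 0))
  (mean (mu 0), second_moment (mu 0)) ^+ 2.
have D0ge w : 0 <= D0 w by exact: sqr_ge0.
have stabD w (t : R) : 0 <= t -> D2 (mean (muN w t), second_moment (muN w t))
    (mean (mu t), second_moment (mu t)) ^+ 2 <= 2 * C * D0 w.
  move=> t0; rewrite D2_sqr.
  rewrite (@le_trans _ _ (moment_dist2 (mean (muN w t)) (mean (mu t))
    (second_moment (muN w t)) (second_moment (mu t))))//.
    rewrite /moment_dist2 addrC lerD2l mulr_natl mulr2n lerDl; exact: mxdot_ge0.
  rewrite (le_trans (stab w t t0))// [2 * C]mulrC -mulrA ler_wpM2l//.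
  rewrite /D0 D2_sqr /moment_dist2 mulrDr addrC lerD2l mulr_natl mulr2n lerDl.
  exact: mxdot_ge0.
(* The supremum over time gives way to a bound at time 0, pointwise in [w]; from here on the
   integrands are measurable. *)
rewrite (@le_trans _ _ (\int[P]_w (2 * C * D0 w)%:E)%E)//.
  apply: ge0_le_integral_any => w.
    (* The supremum is nonnegative because the index [t = 0] contributes a square. *)
    apply: le_trans (ereal_sup_ubound _); last first.
      by exists 0 => //=; rewrite in_itv/= lexx.
    by rewrite lee_fin sqr_ge0.
  apply: ge_ereal_sup => _ [t + <-]; rewrite /= in_itv/= andbT => t0.
  by rewrite lee_fin stabD.
pose gap1 i w := (N%:R^-1 * (\sum_k (Y k 0 w) 0 i) - \int[mu0]_y y 0 i) ^+ 2.
pose gap2 i j w := (N%:R^-1 * (\sum_k (Y k 0 w) 0 i * (Y k 0 w) 0 j)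
  - \int[mu0]_y (y 0 i * y 0 j)) ^+ 2.
have mY k i : measurable_fun setT (fun w => (Y k 0 w) 0 i).
  apply: (measurableT_comp (f := fun y : 'rV[R]_d => y 0 i)) => //.
  by apply: continuous_measurable_rV; exact: coord_continuous.
have mgap1 i : measurable_fun setT (fun w => (gap1 i w)%:E).
  apply/measurable_EFinP; apply: measurable_funX; apply: measurable_funB => //.
  apply: measurable_funM => //; exact: measurable_sum.
have mgap2 i j : measurable_fun setT (fun w => (gap2 i j w)%:E).
  apply/measurable_EFinP; apply: measurable_funX; apply: measurable_funB => //.
  apply: measurable_funM => //; apply: measurable_sum => k.
  exact: measurable_funM.
have D0E w : D0 w = \sum_i gap1 i w + \sum_i \sum_j gap2 i j w.
  rewrite /D0 D2_sqr !mxdotE big_ord1 mE SE; congr (_ + _).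
    apply: eq_bigr => i _; rewrite mxE -expr2 /gap1 !mxE.
    by rewrite -mean_empirical// mxE.
  apply: eq_bigr => i _; apply: eq_bigr => j _; rewrite -expr2 /gap2.
  by rewrite [X in X ^+ 2]mxE -second_moment_empirical// !mxE.
have egap1 i : (\int[P]_w (gap1 i w)%:E <= (b1 alpha M * N%:R^-1)%:E)%E.
  (* Index 0 means the first power of |y|^2, hence [b1]. *)
  have [||g2i g2K] := @exp_moment_bound _ _ _ _ alpha0 expM 0 (fun y => y 0 i ^+ 2).
  - by apply: measurable_funX; apply: continuous_measurable_rV; exact: coord_continuous.
  - move=> y; rewrite expr1 normrX sqr_enorm real_normK ?num_real//.
    exact: mxdot_entry.
  apply: (iid_variance_le iidY N0 _ (integrable_coord mu01 e2 i) g2i g2K).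
  by apply: continuous_measurable_rV; exact: coord_continuous.
have egap2 i j : (\int[P]_w (gap2 i j w)%:E <= (b2 alpha M * N%:R^-1)%:E)%E.
  have mg : measurable_fun setT (fun y : 'rV[R]_d => y 0 i * y 0 j).
    by apply: continuous_measurable_rV; exact: continuous_coordM.
  (* Index 1 means |y|^4, which dominates the square of [y_i y_j]; hence [b2]. *)
  have [||g2i g2K] := @exp_moment_bound _ _ _ _ alpha0 expM 1
      (fun y => (y 0 i * y 0 j) ^+ 2).
  - exact: measurable_funX.
  - by move=> y; rewrite normrX lerXn2r ?nnegrE ?sqr_ge0// coord2_le_norm.
  exact: (iid_variance_le iidY N0 mg (integrable_coord2 mu01 e2 i j) g2i g2K).
have g10 i w : (0 <= (gap1 i w)%:E)%E by rewrite lee_fin sqr_ge0.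
have g20 i j w : (0 <= (gap2 i j w)%:E)%E by rewrite lee_fin sqr_ge0.
have s10 w : (0 <= \sum_i (gap1 i w)%:E)%E by exact: sume_ge0.
have s20 w : (0 <= \sum_i \sum_j (gap2 i j w)%:E)%E.
  by apply: sume_ge0 => i _; exact: sume_ge0.
have ms1 : measurable_fun setT (fun w => \sum_i (gap1 i w)%:E)%E.
  exact: emeasurable_sum.
have ms2 i : measurable_fun setT (fun w => \sum_j (gap2 i j w)%:E)%E.
  exact: emeasurable_sum.
have ms3 : measurable_fun setT (fun w => \sum_i \sum_j (gap2 i j w)%:E)%E.
  exact: emeasurable_sum.
have -> : (\int[P]_w (2 * C * D0 w)%:E =
    (2 * C)%:E * (\sum_i \int[P]_w (gap1 i w)%:E
      + \sum_i \sum_j \int[P]_w (gap2 i j w)%:E))%E.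
  transitivity (\int[P]_w ((2 * C)%:E * (\sum_i (gap1 i w)%:E +
      \sum_i \sum_j (gap2 i j w)%:E)))%E.
    apply: eq_integral => w _; rewrite D0E EFinM EFinD -!sumEFin.
    by congr (_ * (_ + _))%E; apply: eq_bigr => i _; rewrite sumEFin.
  rewrite ge0_integralZl_EFin//; last 3 first.
  - by move=> w _; exact: adde_ge0.
  - exact: emeasurable_funD.
  - by rewrite mulr_ge0.
  rewrite ge0_integralD// !ge0_integral_sum//; last first.
    by move=> i w _; exact: sume_ge0.
  by congr (_ * (_ + _))%E; apply: eq_bigr => i _; rewrite ge0_integral_sum.
have cst_sum (x : R) : (\sum_(i < d) x%:E = (d%:R * x)%:E)%E.
  by rewrite sumEFin sumr_const card_ord mulr_natl.
have -> : (2 * C * (d%:R * b1 alpha M + (d * d)%:R * b2 alpha M) * N%:R^-1)%:E =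
    ((2 * C)%:E * (\sum_(i < d) (b1 alpha M * N%:R^-1)%:E
      + \sum_(i < d) \sum_(j < d) (b2 alpha M * N%:R^-1)%:E))%E.
  under [X in (_ * (_ + X))%E]eq_bigr do rewrite cst_sum.
  rewrite !cst_sum -EFinD -EFinM natrM; congr EFin; ring.
apply: lee_wpmul2l; first by rewrite lee_fin mulr_ge0.
apply: leeD; first by apply: lee_sum => i _.
by apply: lee_sum => i _; apply: lee_sum => j _.
Qed.
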